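(* Let $n\ge 1$, $\delta>0$, $\beta<n+2$, and $\mu,\lambda^*\in\mathbb{R}$. The Fourier multiplier of the linear peridynamic operator $\mathcal{L}^{\delta,\beta}$ is the matrix-valued function $M^{\delta,\beta}=M_b+M_s$ on $\mathbb{R}^n$, where for $\nu\in\mathbb{R}^n$ $$M_b(\nu)=(n+2)\,\mu\,c^{\delta,\beta}\int_{B_\delta(0)}\frac{w\otimes w}{\|w\|^{\beta+2}}\big(\cos(\nu\cdot w)-1\big)\,dw,$$ $$M_s(\nu)=-(\lambda^*-\mu)\frac{(c^{\delta,\beta})^2}{4}\left(\int_{B_\delta(0)}\frac{w}{\|w\|^\beta}\sin(\nu\cdot w)\,dw\right)\otimes\left(\int_{B_\delta(0)}\frac{w}{\|w\|^\beta}\sin(\nu\cdot w)\,dw\right).$$ That is, for every Schwartz vector field $\mathbf{u}$ on $\mathbb{R}^n$ and every $x\in\mathbb{R}^n$, $$\mathcal{L}^{\delta,\beta}\mathbf{u}(x)=\frac{1}{(2\pi)^n}\int_{\mathbb{R}^n}M^{\delta,\beta}(\nu)\,\widehat{\mathbf{u}}(\nu)\,e^{i\nu\cdot x}\,d\nu,$$ i.e. $\widehat{\mathcal{L}^{\delta,\beta}\mathbf{u}}=M^{\delta,\beta}\,\widehat{\mathbf{u}}$.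
   Context: $B_\delta(x)$ is the ball of radius $\delta$ centered at $x$ in $\mathbb{R}^n$; $v\otimes w$ is the matrix with entries $v_iw_j$. The Fourier transform is normalized by $\mathbf{u}(x)=\frac{1}{(2\pi)^n}\int_{\mathbb{R}^n}\widehat{\mathbf{u}}(\nu)e^{i\nu\cdot x}\,d\nu$. The scaling constant is $$c^{\delta,\beta}=\left(\frac{1}{2n}\int_{B_\delta(0)}\frac{\|w\|^2}{\|w\|^\beta}\,dw\right)^{-1}=\frac{2(n+2-\beta)\Gamma\left(\frac n2+1\right)}{\pi^{n/2}\delta^{n+2-\beta}}.$$ The linear state-based peridynamic operator (homogeneous isotropic medium, Lamé parameters $\mu,\lambda^*$) acts on vector fields $\mathbf{u}$ on $\mathbb{R}^n$ by $$\mathcal{L}^{\delta,\beta}\mathbf{u}(x)=(n+2)\mu\,c^{\delta,\beta}\int_{B_\delta(x)}\frac{(y-x)\otimes(y-x)}{\|y-x\|^{\beta+2}}\big(\mathbf{u}(y)-\mathbf{u}(x)\big)\,dy+(\lambda^*-\mu)\frac{(c^{\delta,\beta})^2}{4}\int_{B_\delta(x)}\int_{B_\delta(y)}\frac{y-x}{\|y-x\|^\beta}\otimes\frac{z-y}{\|z-y\|^\beta}\,\mathbf{u}(z)\,dz\,dy.$$ When these integrals are not absolutely convergent they are understood in the principal value sense: the single integral as $\lim_{\varepsilon\to0^+}\int_{\varepsilon<\|y-x\|<\delta}$, and in the double integral first the inner and then the outer integral in the same way. *)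

(* Defs.v *)
From HB Require Import structures.
From mathcomp Require Import all_boot all_order all_algebra.
From mathcomp Require Import all_classical all_reals all_analysis.
From mathcomp Require Import complex.

Set Implicit Arguments.
Unset Strict Implicit.
Unset Printing Implicit Defensive.

Import Order.TTheory GRing.Theory Num.Theory.
Import numFieldNormedType.Exports.

Local Open Scope classical_set_scope.
Local Open Scope ring_scope.
Local Open Scope complex_scope.

Section measurable_cV.
Context (R : realType) (n : nat).

Let coord (i : 'I_n) (x : 'cV[R]_n) : R := x i ord0.

Let cV_set0 : g_sigma_preimage coord set0.
Proof. exact: sigma_algebra0. Qed.

Let cV_setC A : g_sigma_preimage coord A -> g_sigma_preimage coord (~` A).
Proof. exact: sigma_algebraC. Qed.

Let cV_bigcup (F : (set 'cV[R]_n)^nat) :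
  (forall i, g_sigma_preimage coord (F i)) ->
  g_sigma_preimage coord (\bigcup_i F i).
Proof. exact: sigma_algebra_bigcup. Qed.

(* The product sigma-algebra generated by the coordinates, i.e. the Borel sets
   of R^n; same construction as the library's instance on n.-tuple R. *)
HB.instance Definition _ := @isMeasurable.Build
  (measure_tuple_display default_measure_display) 'cV[R]_n
  (g_sigma_preimage coord) cV_set0 cV_setC cV_bigcup.

Lemma measurable_coord (i : 'I_n) :
  measurable_fun [set: 'cV[R]_n] (fun x => x i ord0).
Proof.
move=> _ Y mY; rewrite setTI; apply: sub_sigma_algebra => /=.
rewrite -bigcup_seq/=; exists i => /=; first by rewrite mem_index_enum.
by exists Y => //; rewrite setTI.
Qed.

Lemma measurable_fun_coordP d (T : measurableType d) (f : T -> 'cV[R]_n) :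
  (forall i, measurable_fun [set: T] (fun t => f t i ord0)) ->
  measurable_fun [set: T] f.
Proof.
move=> mf _ A mA; rewrite setTI.
have : preimage_set_system [set: T] f measurable (f @^-1` A).
  by exists A => //; rewrite setTI.
rewrite {1}/measurable /= -g_sigma_preimage_comp.
apply: smallest_sub; first exact: sigma_algebra_measurable.
rewrite -bigcup_seq => B [i _] [Y mY <-].
exact: mf.
Qed.

End measurable_cV.

Section lebesgue_cV.
Context (R : realType).
Local Notation mu1 := (@lebesgue_measure R).

Definition cons_cV n (p : measurableTypeR R * 'cV[R]_n) : 'cV[R]_n.+1 :=
  col_mx (const_mx p.1 : 'cV[R]_1) p.2.

Lemma cons_cV0 n p : @cons_cV n p ord0 ord0 = p.1.
Proof.
rewrite /cons_cV; have -> : @ord0 n = lshift n (@ord0 0) by exact/val_inj.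
by rewrite (col_mxEu (const_mx p.1 : 'cV[R]_1)) mxE.
Qed.

Lemma cons_cVS n p (i : 'I_n) : @cons_cV n p (lift ord0 i) ord0 = p.2 i ord0.
Proof.
rewrite /cons_cV; have -> : lift ord0 i = rshift 1 i by exact/val_inj.
by rewrite (col_mxEd (const_mx p.1 : 'cV[R]_1)).
Qed.

Lemma measurable_cons_cV n : measurable_fun setT (@cons_cV n).
Proof.
apply: measurable_fun_coordP => i.
have [->|[j ->]] : i = ord0 \/ exists j, i = lift ord0 j.
  by case: (unliftP ord0 i) => [j ->|->]; [right; exists j|left].
- by under eq_fun do rewrite cons_cV0; exact: measurable_fst.
- under eq_fun do rewrite cons_cVS.
  apply: (measurableT_comp (@measurable_coord R n j)).
  exact: measurable_snd.
Qed.

Section step.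
Variables (n : nat) (mu : {sigma_finite_measure set 'cV[R]_n -> \bar R}).

Definition lebesgue_cV_step : set 'cV[R]_n.+1 -> \bar R :=
  pushforward (mu1 \x mu)%E (@cons_cV n).

Let preimage_measurable A : measurable A -> measurable (@cons_cV n @^-1` A).
Proof.
by move=> mA; rewrite -[X in measurable X]setTI; exact: measurable_cons_cV.
Qed.

Let step0 : (lebesgue_cV_step set0 = 0)%E.
Proof. by rewrite /lebesgue_cV_step /pushforward preimage_set0 measure0. Qed.

Let step_ge0 A : (0 <= lebesgue_cV_step A)%E.
Proof. by rewrite /lebesgue_cV_step /pushforward; exact: measure_ge0. Qed.

Let step_sigma_additive : semi_sigma_additive lebesgue_cV_step.
Proof.
move=> F mF tF mUF; rewrite /lebesgue_cV_step /pushforward preimage_bigcup.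
apply: measure_semi_sigma_additive.
- by move=> k; exact: preimage_measurable.
- apply/trivIsetP => /= i j _ _ ij; rewrite -preimage_setI.
  by move/trivIsetP : tF => /(_ _ _ _ _ ij) ->//; rewrite preimage_set0.
- by rewrite -preimage_bigcup; exact: preimage_measurable.
Qed.

HB.instance Definition _ := isMeasure.Build _ _ _ lebesgue_cV_step
  step0 step_ge0 step_sigma_additive.

Lemma lebesgue_cV_stepE A B : measurable A -> measurable B ->
  (lebesgue_cV_step [set x | A (x ord0 ord0) /\ B (\col_i x (lift ord0 i) ord0)]
   = lebesgue_measure A * mu B)%E.
Proof.
move=> mA mB; rewrite -product_measure1E//; congr (_ \x _)%E.
apply/seteqP; split=> -[x y] /=; rewrite cons_cV0/=;
  suff -> : (\col_i cons_cV (x, y) (lift ord0 i) ord0) = y by [].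
- by apply/colP => i; rewrite mxE cons_cVS.
- by apply/colP => i; rewrite mxE cons_cVS.
Qed.

Let step_sigma_finite : sigma_finite setT lebesgue_cV_step.
Proof.
have [F FT Foo] := sigma_finiteT mu1.
have [G GT Goo] := sigma_finiteT mu.
pose pr (q : nat * nat) : set 'cV[R]_n.+1 :=
  [set x | F q.1 (x ord0 ord0) /\ G q.2 (\col_i x (lift ord0 i) ord0)].
have mcol : measurable_fun setT
    (fun x : 'cV[R]_n.+1 => \col_i x (lift ord0 i) ord0 : 'cV[R]_n).
  apply: measurable_fun_coordP => i.
  by under eq_fun do rewrite mxE; exact: measurable_coord.
exists (fun k => if unpickle k is Some q then pr q else set0).
  apply/esym/seteqP; split=> // x _.
  have [i _ Fi] : (\bigcup_i F i) (x ord0 ord0) by rewrite -FT.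
  have [j _ Gj] : (\bigcup_i G i) (\col_i x (lift ord0 i) ord0) by rewrite -GT.
  by exists (pickle (i, j)) => //; rewrite pickleK.
move=> k; case: unpickle => [[i j]|]; last by rewrite measure0.
have [mF Fi] := Foo i; have [mG Gj] := Goo j.
split.
  apply: measurableI.
    by rewrite -[X in measurable X]setTI; exact: measurable_coord.
  by rewrite -[X in measurable X]setTI; exact: mcol.
by rewrite lebesgue_cV_stepE// lte_mul_pinfty// ge0_fin_numE.
Qed.

HB.instance Definition _ :=
  @Measure_isSigmaFinite.Build _ _ _ lebesgue_cV_step step_sigma_finite.

End step.

(* Lebesgue measure on R^n: the n-fold product of the one-dimensional one,
   transported to column vectors; the unit mass on the point R^0. *)
Fixpoint lebesgue_cV n : {sigma_finite_measure set 'cV[R]_n -> \bar R} :=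
  if n is m.+1
  then lebesgue_cV_step (lebesgue_cV m) : {sigma_finite_measure set _ -> \bar R}
  else \d_(0 : 'cV[R]_0) : {sigma_finite_measure set _ -> \bar R}.

Lemma lebesgue_cV_box n (A : 'I_n -> set R) : (forall i, measurable (A i)) ->
  lebesgue_cV n [set x | forall i, A i (x i ord0)] =
  (\prod_(i < n) lebesgue_measure (A i))%E.
Proof.
elim: n A => [|n ih] A mA.
  by rewrite big_ord0 /= diracE mem_set// => -[].
rewrite big_ord_recl -ih//.
pose B := [set x : 'cV[R]_n | forall i, A (lift ord0 i) (x i ord0)].
have mB : measurable B.
  rewrite (_ : B = \bigcap_i ((fun x => x i ord0) @^-1` A (lift ord0 i))).
    apply: fin_bigcap_measurable => // i _.
    by rewrite -[X in measurable X]setTI; exact: measurable_coord.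
  by apply/seteqP; split=> [x Bx i _|x Bx i]; exact: Bx.
rewrite -(lebesgue_cV_stepE (lebesgue_cV n))//=.
congr (lebesgue_cV_step _ _); apply/seteqP; split=> x /=.
- by move=> Ax; split=> [|i]; [exact: Ax|rewrite mxE; exact: Ax].
- move=> [A0 AS] i; case: (unliftP ord0 i) => [j ->|->//].
  by have := AS j; rewrite mxE.
Qed.

End lebesgue_cV.

Section euclidean.
Context (R : realType) (n : nat).
Implicit Types v w x y : 'cV[R]_n.

Definition dot v w : R := \sum_i v i ord0 * w i ord0.

(* The norm `|x| that the library puts on 'cV[R]_n is the sup norm. *)
Definition enorm v : R := Num.sqrt (dot v v).

Definition eball x (r : R) : set 'cV[R]_n := [set y | enorm (y - x) < r].

Definition eannulus x (e r : R) : set 'cV[R]_n :=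
  [set y | e < enorm (y - x) < r].

Definition outer v w : 'M[R]_n := v *m w^T.

End euclidean.

Definition cplx_mx (R : realType) p q (A : 'M[R]_(p, q)) : 'M[R[i]]_(p, q) :=
  map_mx (real_complex R) A.

Definition expi (R : realType) (t : R) : R[i] := cos t +i* sin t.

Section integrals.
Context (R : realType) (n : nat).
Implicit Types (D : set 'cV[R]_n) (x : 'cV[R]_n) (delta : R).

Definition integral_mx p q D (F : 'cV[R]_n -> 'M[R]_(p, q)) : 'M[R]_(p, q) :=
  \matrix_(i, j) \int[lebesgue_cV R n]_(x in D) F x i j.

(* Extends an integration functional to complex matrix-valued functions,
   entry by entry and on real and imaginary parts. *)
Definition complexify (I : ('cV[R]_n -> R) -> R) p q
    (F : 'cV[R]_n -> 'M[R[i]]_(p, q)) : 'M[R[i]]_(p, q) :=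
  \matrix_(i, j) (I (fun x => complex.Re (F x i j)) +i*
                  I (fun x => complex.Im (F x i j))).

Definition integral_Cmx p q D (F : 'cV[R]_n -> 'M[R[i]]_(p, q)) :=
  complexify (fun g => \int[lebesgue_cV R n]_(x in D) g x) F.

(* Principal value at x over the ball of radius delta centered at x; it agrees
   with the Lebesgue integral over the ball when g is integrable there. *)
Definition pv x delta (g : 'cV[R]_n -> R) : R :=
  lim ((\int[lebesgue_cV R n]_(y in eannulus x e delta) g y) @[e --> 0^'+]).

Definition pv_exists x delta (g : 'cV[R]_n -> R) : Prop :=
  (forall e, 0 < e < delta ->
     (lebesgue_cV R n).-integrable (eannulus x e delta) (EFin \o g)) /\
  cvg ((\int[lebesgue_cV R n]_(y in eannulus x e delta) g y) @[e --> 0^'+]).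

Definition pv_Cmx p q x delta (F : 'cV[R]_n -> 'M[R[i]]_(p, q)) :=
  complexify (pv x delta) F.

Definition pv_Cmx_exists p q x delta (F : 'cV[R]_n -> 'M[R[i]]_(p, q)) : Prop :=
  forall i j, pv_exists x delta (fun y => complex.Re (F y i j)) /\
              pv_exists x delta (fun y => complex.Im (F y i j)).

End integrals.

Section schwartz.
Context (R : realType) (n : nat).

Definition partials (s : seq 'I_n) (f : 'cV[R]_n -> R) : 'cV[R]_n -> R :=
  foldr (fun i g x => 'D_(delta_mx i ord0) g x) f s.

Definition smooth (f : 'cV[R]_n -> R) : Prop :=
  forall s, continuous (partials s f) /\
            forall i x, derivable (partials s f) x (delta_mx i ord0).

Definition schwartz (f : 'cV[R]_n -> R) : Prop :=
  smooth f /\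
  forall (k : nat) s, exists K : R,
    forall x, enorm x ^+ k * `|partials s f x| <= K.

Definition schwartz_field (u : 'cV[R]_n -> 'cV[R[i]]_n) : Prop :=
  forall i, schwartz (fun x => complex.Re (u x i ord0)) /\
            schwartz (fun x => complex.Im (u x i ord0)).

(* The convention inverse to
   u(x) = (2 pi)^-n \int \hat u(nu) e^(i nu . x) dnu. *)
Definition fourier (u : 'cV[R]_n -> 'cV[R[i]]_n) (nu : 'cV[R]_n) : 'cV[R[i]]_n :=
  integral_Cmx setT (fun x => expi (- dot nu x) *: u x).

End schwartz.

Section peridynamics.
Context (R : realType) (n : nat).
Variables (delta beta mu lambda : R).
Implicit Types (u : 'cV[R]_n -> 'cV[R[i]]_n) (w x y z nu : 'cV[R]_n).

Definition scaling_const : R :=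
  ((2 * n%:R)^-1 * \int[lebesgue_cV R n]_(w in eball 0 delta)
                     (enorm w ^+ 2 / enorm w `^ beta))^-1.

Local Notation c := scaling_const.

Definition bond_integrand u x y : 'cV[R[i]]_n :=
  cplx_mx ((enorm (y - x) `^ (beta + 2))^-1 *: outer (y - x) (y - x))
  *m (u y - u x).

Definition state_integrand u x y z : 'cV[R[i]]_n :=
  cplx_mx (outer ((enorm (y - x) `^ beta)^-1 *: (y - x))
                 ((enorm (z - y) `^ beta)^-1 *: (z - y)))
  *m u z.

Definition peridynamic u x : 'cV[R[i]]_n :=
  ((n%:R + 2) * mu * c)%:C *: pv_Cmx x delta (bond_integrand u x)
  + ((lambda - mu) * (c ^+ 2 / 4))%:C *:
      pv_Cmx x delta (fun y => pv_Cmx y delta (state_integrand u x y)).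

Definition peridynamic_exists u x : Prop :=
  [/\ pv_Cmx_exists x delta (bond_integrand u x),
      forall y, eball x delta y ->
        pv_Cmx_exists y delta (state_integrand u x y) &
      pv_Cmx_exists x delta
        (fun y => pv_Cmx y delta (state_integrand u x y))].

Definition multiplier_b nu : 'M[R]_n :=
  ((n%:R + 2) * mu * c) *:
    integral_mx (eball 0 delta) (fun w =>
      (cos (dot nu w) - 1) *: ((enorm w `^ (beta + 2))^-1 *: outer w w)).

Definition sine_moment nu : 'cV[R]_n :=
  integral_mx (eball 0 delta) (fun w =>
    sin (dot nu w) *: ((enorm w `^ beta)^-1 *: w)).

Definition multiplier_s nu : 'M[R]_n :=
  - ((lambda - mu) * (c ^+ 2 / 4)) *: outer (sine_moment nu) (sine_moment nu).

Definition multiplier nu : 'M[R]_n := multiplier_b nu + multiplier_s nu.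

End peridynamics.

(* Main.v *)
(* Against a kernel odd in w, f(x + w) may be replaced by (f(x + w) - f(x - w))/2,
   and against an even one f(x + w) - f(x) by (f(x + w) + f(x - w))/2 - f(x).
   For Schwartz f these are O(|w|) and O(|w|^2), which turns both principal
   values into absolutely convergent integrals, since |w|^(2 - beta) is
   integrable on the ball when beta < n + 2. The inner principal value of the
   double integral factors out of the outer integrand, so the state-based term
   is an odd operator applied to a sum of odd operators.

   By Fubini each operator acts on the Fourier side as multiplication by
   i \int k(w) sin(nu . w) dw, resp. \int k(w) (cos(nu . w) - 1) dw. The
   pointwise formula is Fourier inversion of the result, obtained with the Abel
   kernel exp(- e \sum_i |nu_i|), whose transform is a product of Poisson kernels.

   All integrability in x and nu is measured by the single weight
   \prod_i (1 + x_i^2)^-1, which is integrable, comparable to its translates by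
   bounded vectors, and beaten by Schwartz decay. *)

From HB Require Import structures.
Require Import Defs.
From mathcomp Require Import all_boot all_order all_algebra.
From mathcomp Require Import all_classical all_reals all_analysis.
From mathcomp Require Import measurable_realfun complex ring lra.

Set Implicit Arguments.
Unset Strict Implicit.
Unset Printing Implicit Defensive.

Import Order.TTheory GRing.Theory Num.Theory.
Import numFieldNormedType.Exports.

Local Open Scope classical_set_scope.
Local Open Scope ring_scope.

(** * Integration on R^n *)

(** The image of a Schwartz field is not shown to be smooth or rapidly decreasing, so inversion is
    proved for a weaker class: measurable, sequentially continuous, dominated by the weight, with
    integrable cosine and sine transforms. That integrability is read off the product of the
    multiplier with the decay of Schwartz transforms. Composing two singular odd operators is the
    delicate point, since after the first one only difference estimates are left. Mixed second
    differences of the field are bounded with one factor per increment: the first operator spends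
    one factor on its singularity, and the other becomes the Lipschitz bound that the second
    operator spends. The weight is a product over the coordinates because the measure is: its
    integral, its translates and the transform of the Abel kernel all reduce to dimension one. In
    place of polar coordinates, the singularity at the origin is summed over dyadic rings enclosed
    in boxes of known volume. Transforms are kept as real cosine and sine integrals; complex numbers
    appear only when components are assembled. *)

Section affine1.
Local Open Scope ereal_scope.
Context (R : realType) (a b : R) (a0 : a != 0%R).
Local Notation mu := (@lebesgue_measure R).

Let aff (t : measurableTypeR R) : measurableTypeR R := (a * t + b)%R.

Let maff : measurable_fun setT aff.
Proof. by apply: measurable_funD => //; exact: measurable_funM. Qed.

Let pushmu : {measure set (measurableTypeR R) -> \bar R}.
Proof. refine (pushforward mu aff : {measure set _ -> \bar R}); exact: maff. Defined.

Let affmu : {measure set (measurableTypeR R) -> \bar R} :=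
  mscale (NngNum (normr_ge0 a)) pushmu.

(** Lebesgue measure is determined by its values on half-open intervals, so it is enough to compare
    it there with the pushforward scaled by [|a|]. A negative slope moves the closed end to the
    other side, which leaves the length unchanged. *)
Lemma lebesgue_measure_affine A : measurable A ->
  mu A = `|a|%:E * mu (aff @^-1` A).
Proof.
move=> mA; apply: (@lebesgue_measure_unique _ affmu) => // _ [[x y]] _ <- /=.
rewrite /affmu /= /mscale /= /pushforward.
have [agt0|ale0] := ltP 0%R a.
  have -> : aff @^-1` `]x, y] = `]((x - b) / a)%R, ((y - b) / a)%R]%classic.
    apply/seteqP; split=> t /=; rewrite /aff !in_itv/= ltr_pdivrMr// ler_pdivlMr//;
    rewrite ltrBlDr lerBrDr mulrC//.
  rewrite !lebesgue_measure_itv/= !lte_fin ltr_pM2r ?invr_gt0// ltrD2r.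
  case: ifP => _; last by rewrite mule0.
  rewrite -!EFinB -EFinM; congr EFin; rewrite gtr0_norm//; field; exact: a0.
have alt0 : (a < 0)%R by rewrite lt_neqAle a0.
have -> : aff @^-1` `]x, y] = `[((y - b) / a)%R, ((x - b) / a)%R[%classic.
  apply/seteqP; split=> t /=; rewrite /aff !in_itv/= ltr_ndivlMr// ler_ndivrMr//;
  by rewrite ltrBlDr lerBrDr mulrC andbC.
rewrite !lebesgue_measure_itv/= !lte_fin ltr_nM2r ?invr_lt0// ltrD2r.
case: ifP => _; last by rewrite mule0.
rewrite -!EFinB -EFinM; congr EFin; rewrite ltr0_norm//; field; exact: a0.
Qed.

Lemma ge0_integral_affine (f : R -> \bar R) :
  measurable_fun setT f -> (forall t, 0 <= f t) ->
  \int[mu]_t f t = `|a|%:E * \int[mu]_t f (a * t + b)%R.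
Proof.
move=> mf f0.
rewrite (eq_measure_integral affmu); last first.
  by move=> A mA _; exact: lebesgue_measure_affine.
by rewrite ge0_integral_mscale//= ge0_integral_pushforward.
Qed.

End affine1.

Section lebesgue_cV_theory.
Context (R : realType).
Local Notation mu1 := (@lebesgue_measure R).
Local Notation leb n := (lebesgue_cV R n).

Lemma ge0_integral_cons_cV n (f : 'cV[R]_n.+1 -> \bar R) :
  measurable_fun setT f -> (forall x, 0 <= f x)%E ->
  (\int[leb n.+1]_x f x = \int[mu1]_t \int[leb n]_y f (cons_cV (t, y)))%E.
Proof.
move=> mf f0.
have mc := @measurable_cons_cV R n.
(* True by unfolding: the measure in dimension [n.+1] is this pushforward. *)
rewrite (eq_measure_integral (pushforward (mu1 \x leb n)%E (@cons_cV R n))) //.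
rewrite ge0_integral_pushforward//.
rewrite preimage_setT fubini_tonelli1//; last by move=> x; exact: f0.
exact: measurableT_comp.
Qed.

Lemma measurable_affine_cV d (T : measurableType d) n (a : R)
    (g h : T -> 'cV[R]_n) : measurable_fun setT g -> measurable_fun setT h ->
  measurable_fun setT (fun x => a *: g x + h x).
Proof.
move=> mg mh; apply: measurable_fun_coordP => i.
under eq_fun do rewrite !mxE.
apply: measurable_funD; last exact: (measurableT_comp (@measurable_coord R n i)).
apply: measurable_funM => //.
exact: (measurableT_comp (@measurable_coord R n i)).
Qed.

Lemma measurable_integral_cons_cV n (f : 'cV[R]_n.+1 -> \bar R) :
  measurable_fun setT f -> (forall x, 0 <= f x)%E ->
  measurable_fun setT
    (fun t : measurableTypeR R => \int[leb n]_y f (cons_cV (t, y)))%E.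
Proof.
move=> mf f0.
apply: (@measurable_fun_fubini_tonelli_F _ _ _ _ _ (leb n) (fun p => f (cons_cV p))) => //.
by apply: measurableT_comp => //; exact: measurable_cons_cV.
Qed.

(** The map acts on each coordinate separately with the same slope, so one coordinate is peeled off
    at a time and each contributes a factor [|a|]. *)
Lemma ge0_integral_cV_affine n (a : R) (b : 'cV[R]_n) (f : 'cV[R]_n -> \bar R) :
  a != 0 -> measurable_fun setT f -> (forall x, 0 <= f x)%E ->
  (\int[leb n]_x f x = (`|a| ^+ n)%:E * \int[leb n]_x f (a *: x + b)%R)%E.
Proof.
move=> a0; elim: n b f => [|n ih] b f mf f0.
  rewrite expr0 mul1e; apply: eq_integral => x _; congr f.
  by apply/matrixP => -[].
have maff m (c : 'cV[R]_m) : measurable_fun setT (fun x : 'cV[R]_m => a *: x + c).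
  by apply: measurable_affine_cV.
rewrite !ge0_integral_cons_cV//; last exact: (measurableT_comp mf (maff _ b)).
have F0 t : (0 <= \int[leb n]_y f (cons_cV (t, y)))%E by exact: integral_ge0.
pose b' : 'cV[R]_n := \col_i b (lift ord0 i) ord0.
rewrite (ge0_integral_affine (b ord0 ord0) a0 (measurable_integral_cons_cV mf f0) F0).
rewrite exprS EFinM -muleA; congr (_ * _)%E.
rewrite -ge0_integralZl//; last 2 first.
- exact: (@measurable_integral_cons_cV _ (fun x => f (a *: x + b)) (measurableT_comp mf (maff _ b)) (fun x => f0 _)).
- by move=> t _; exact: integral_ge0.
apply: eq_integral => t _.
rewrite (ih b')//; last first.
  apply: (measurableT_comp mf); apply: (measurableT_comp (@measurable_cons_cV R n)).
  exact: measurable_fun_pair.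
congr (_ * _)%E; apply: eq_integral => y _; congr f.
apply/colP => i; rewrite [RHS]mxE [X in _ = X + _]mxE.
case: (unliftP ord0 i) => [j ->|->].
  by rewrite !cons_cVS !mxE.
by rewrite !cons_cV0.
Qed.

Lemma integrable_cV_affine n (a : R) (b : 'cV[R]_n) (f : 'cV[R]_n -> R) :
  a != 0 -> (leb n).-integrable setT (EFin \o f) ->
  (leb n).-integrable setT (EFin \o (fun x => f (a *: x + b))).
Proof.
move=> a0 /integrableP[/measurable_EFinP mf foo]; apply/integrableP; split.
  apply/measurable_EFinP; apply: (measurableT_comp mf).
  exact: measurable_affine_cV.
have an0 : (0 < `|a| ^+ n) by rewrite exprn_gt0// normr_gt0.
move: foo; rewrite (ge0_integral_cV_affine b a0)//; last first.
  by apply: measurableT_comp => //; exact/measurable_EFinP.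
by rewrite !ltey; apply: contra_neq => ->; rewrite gt0_muley ?lte_fin.
Qed.

Lemma Rintegral_cV_affine n (a : R) (b : 'cV[R]_n) (f : 'cV[R]_n -> R) :
  a != 0 -> (leb n).-integrable setT (EFin \o f) ->
  \int[leb n]_x f (a *: x + b) = `|a| ^- n * \int[leb n]_x f x.
Proof.
move=> a0 fi.
have mf := measurable_int _ fi.
have an0 : `|a| ^+ n != 0 by rewrite expf_neq0// normr_eq0.
have e g : measurable_fun setT g -> (forall x, 0 <= g x)%E ->
  (\int[leb n]_x g (a *: x + b)%R = (`|a| ^- n)%:E * \int[leb n]_x g x)%E.
  move=> mg g0; rewrite (ge0_integral_cV_affine b a0 mg g0) muleA.
  by rewrite -EFinM mulVf// mul1e.
suff h : (\int[leb n]_x (f (a *: x + b)%R)%:E =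
    (`|a| ^- n)%:E * \int[leb n]_x (f x)%:E)%E.
  by rewrite /Rintegral h fineM//; exact: integrable_fin_num.
rewrite integralE [in RHS]integralE muleBr//; last first.
  by rewrite fin_num_adde_defr//; exact: integrable_pos_fin_num.
have ep := e _ (measurable_funepos mf) (fun x => funepos_ge0 _ x).
have en := e _ (measurable_funeneg mf) (fun x => funeneg_ge0 _ x).
rewrite -ep -en; congr (_ - _)%E; apply: eq_integral => x _;
    by rewrite ?funeposE ?funenegE.
Qed.
End lebesgue_cV_theory.

(** * Real-valued integrals: domination, dominated convergence, Fubini *)

Section integrable_real.
Context d (T : measurableType d) (R : realType).
Variable m : {measure set T -> \bar R}.
Implicit Types f g : T -> R.

Lemma integrable_scale c f : m.-integrable setT (EFin \o f) ->
  m.-integrable setT (EFin \o (fun x => c * f x)).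
Proof. by move=> fi; exact: (integrableZl measurableT c fi). Qed.

Lemma integrable_add f g : m.-integrable setT (EFin \o f) ->
  m.-integrable setT (EFin \o g) ->
  m.-integrable setT (EFin \o (fun x => f x + g x)).
Proof. by move=> fi gi; exact: (integrableD measurableT fi gi). Qed.

Lemma integrable_sub f g : m.-integrable setT (EFin \o f) ->
  m.-integrable setT (EFin \o g) ->
  m.-integrable setT (EFin \o (fun x => f x - g x)).
Proof. by move=> fi gi; exact: (integrableB measurableT fi gi). Qed.

Lemma integrable_measurable f : m.-integrable setT (EFin \o f) ->
  measurable_fun setT f.
Proof. by move=> /measurable_int/measurable_EFinP. Qed.

Lemma integrable_dom (f g : T -> R) : measurable_fun setT f ->
  m.-integrable setT (EFin \o g) -> (forall x, `|f x| <= g x) ->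
  m.-integrable setT (EFin \o f).
Proof.
move=> mf ig fg; apply: le_integrable ig => //; first exact/measurable_EFinP.
by move=> x _ /=; rewrite !lee_fin (le_trans (fg x))// ler_norm.
Qed.

Lemma Rintegral_cvg (f_ : nat -> T -> R) (f g : T -> R) :
  (forall k, measurable_fun setT (f_ k)) ->
  m.-integrable setT (EFin \o g) -> (forall k x, `|f_ k x| <= g x) ->
  (forall x, f_ ^~ x @ \oo --> f x) ->
  \int[m]_x f_ k x @[k --> \oo] --> \int[m]_x f x.
Proof.
move=> mf ig fg ff.
have mlim : measurable_fun setT f.
  by apply: (measurable_fun_cvg mf) => x _; exact: ff.
have /= [] := @dominated_convergence _ T R m setT measurableT
  (fun k => EFin \o f_ k) (EFin \o f) (EFin \o g) _ _ _ ig.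
- by move=> k; exact/measurable_EFinP.
- exact/measurable_EFinP.
- by apply: aeW => x _; apply: cvg_EFin; [exact: nearW|exact: ff].
- by apply: aeW => x k _ /=; rewrite lee_fin.
move=> fi _ h; apply: fine_cvg; rewrite fineK//; exact: integrable_fin_num.
Qed.

End integrable_real.

Section Rintegral_tools.
Context (R : realType) d1 d2 (T1 : measurableType d1) (T2 : measurableType d2).
Variables (m1 : {sigma_finite_measure set T1 -> \bar R}).
Variables (m2 : {sigma_finite_measure set T2 -> \bar R}).

(** By Tonelli, the integral of [|f|] is at most the product of the integrals of [|g|] and [|h|]. *)
Lemma integrable_prod_dom (f : T1 * T2 -> R) (g : T1 -> R) (h : T2 -> R) :
  measurable_fun setT f ->
  m1.-integrable setT (EFin \o g) -> m2.-integrable setT (EFin \o h) ->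
  (forall x y, `|f (x, y)| <= g x * h y) ->
  (m1 \x m2)%E.-integrable setT (EFin \o f).
Proof.
move=> mf ig ih fgh; apply/integrable12ltyP; first exact/measurable_EFinP.
(* Neither factor is assumed nonnegative by itself. *)
have {}fgh x y : `|f (x, y)| <= `|g x| * `|h y|.
  by rewrite (le_trans (fgh x y))// -normrM ler_norm.
have mg := measurable_int _ ig; have mh := measurable_int _ ih.
have mf1 x : measurable_fun setT (fun y => f (x, y)).
  exact: measurableT_comp.
apply: (@le_lt_trans _ _ (\int[m1]_x (`|(g x)%:E| * \int[m2]_y `|(h y)%:E|))%E).
  apply: ge0_le_integral => //.
  - by move=> x _; exact: integral_ge0.
  - apply: (@measurable_fun_fubini_tonelli_F _ _ _ _ _ m2 (fun p => `|(f p)%:E|%E)) => //.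
    by apply: measurableT_comp => //; exact/measurable_EFinP.
  - by apply: emeasurable_funM => //; exact: measurableT_comp.
  - move=> x _; rewrite -ge0_integralZl//; last exact: measurableT_comp.
    apply: ge0_le_integral => //.
    + by apply: measurableT_comp => //; exact/measurable_EFinP.
    + by apply: measurable_funeM; exact: measurableT_comp.
    + by move=> y _; rewrite -EFinM lee_fin.
move/integrableP : ih => [_ ih]; move/integrableP : ig => [_ ig].
have /fineK hE : (\int[m2]_y `|(h y)%:E|)%E \is a fin_num.
  by rewrite ge0_fin_numE//; exact: integral_ge0.
rewrite -hE; rewrite ge0_integralZr//; last 2 first.
- exact: measurableT_comp.
- by rewrite lee_fin fine_ge0//; exact: integral_ge0.
by rewrite muleC lte_mul_pinfty// lee_fin fine_ge0//; exact: integral_ge0.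
Qed.

End Rintegral_tools.

Section Rintegral_fubini.
Context (R : realType) d1 d2 (T1 : measurableType d1) (T2 : measurableType d2).
Variables (m1 : {sigma_finite_measure set T1 -> \bar R}).
Variables (m2 : {sigma_finite_measure set T2 -> \bar R}).
Variables (f : T1 * T2 -> R) (g : T1 -> R) (h : T2 -> R).
Hypothesis mf : measurable_fun setT f.
Hypothesis ig : m1.-integrable setT (EFin \o g).
Hypothesis ih : m2.-integrable setT (EFin \o h).
Hypothesis fgh : forall x y, `|f (x, y)| <= g x * h y.

Let fi : (m1 \x m2)%E.-integrable setT (EFin \o f).
Proof. exact: integrable_prod_dom ig ih fgh. Qed.

Let mf1 x : measurable_fun setT (fun y => f (x, y)).
Proof. exact: measurableT_comp. Qed.

Let mf2 y : measurable_fun setT (fun x => f (x, y)).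
Proof. exact: measurableT_comp. Qed.

(** Domination by a product makes every section integrable, not merely almost every one. The finite
    part in [Rintegral] can therefore be undone pointwise, which is what lets Fubini be stated for
    real iterated integrals. *)
Lemma integrable_section1 x : m2.-integrable setT (fun y => (f (x, y))%:E).
Proof.
apply: (@integrable_dom _ _ _ m2 (fun y => f (x, y)) (fun y => g x * h y)) => //.
exact: integrable_scale.
Qed.

Lemma integrable_section2 y : m1.-integrable setT (fun x => (f (x, y))%:E).
Proof.
apply: (@integrable_dom _ _ _ m1 (fun x => f (x, y)) (fun x => g x * h y)) => //.
under eq_fun do rewrite mulrC.
exact: integrable_scale.
Qed.

Lemma EFin_Rint1 x : (\int[m2]_y f (x, y))%:E = (\int[m2]_y (f (x, y))%:E)%E.
Proof. by rewrite fineK//; apply: integrable_fin_num => //; exact: integrable_section1. Qed.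

Lemma EFin_Rint2 y : (\int[m1]_x f (x, y))%:E = (\int[m1]_x (f (x, y))%:E)%E.
Proof. by rewrite fineK//; apply: integrable_fin_num => //; exact: integrable_section2. Qed.

Lemma integrable_Rintegral1 :
  m1.-integrable setT (fun x => (\int[m2]_y f (x, y))%:E).
Proof.
under eq_fun do rewrite EFin_Rint1.
exact: (integrable_fubini_F fi).
Qed.

Lemma Rfubini : \int[m1]_x \int[m2]_y f (x, y) = \int[m2]_y \int[m1]_x f (x, y).
Proof.
rewrite /Rintegral; congr fine.
under eq_integral do rewrite EFin_Rint1.
under [RHS]eq_integral do rewrite EFin_Rint2.
exact: (Fubini fi).
Qed.

Lemma Rintegral_prod : \int[(m1 \x m2)%E]_p f p = \int[m1]_x \int[m2]_y f (x, y).
Proof.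
rewrite /Rintegral; congr fine.
under [RHS]eq_integral do rewrite EFin_Rint1.
exact/esym/(integral12_prod_meas1 fi).
Qed.

End Rintegral_fubini.

(** * Borel measurability on R^n *)

Section cV_measurability.
Context (R : realType) (n : nat).
Local Notation T := 'cV[R]_n.

Lemma measurable_box (a b : 'I_n -> R) :
  measurable [set x : T | forall i, a i < x i ord0 < b i].
Proof.
rewrite (_ : [set _ | _] =
    \bigcap_i ((fun x : T => x i ord0) @^-1` `]a i, b i[)); last first.
  apply/seteqP; split=> [x h i _|x h i] /=; first by rewrite in_itv/=.
  by have := h i Logic.I; rewrite /= in_itv.
apply: fin_bigcap_measurable => // i _; rewrite -[X in measurable X]setTI.
exact: measurable_coord.
Qed.

(** The sigma-algebra is generated by the coordinates, so this is a countability argument: an open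
    set is the union of the boxes inside it with rational centre and radius [k.+1%:R^-1]. *)
Lemma open_measurable_cV (U : set T) : open U -> measurable U.
Proof.
move=> oU.
pose box (q : 'cV[rat]_n) (k : nat) : set T := [set x | forall i,
  ratr (q i ord0) - k.+1%:R^-1 < x i ord0 < ratr (q i ord0) + k.+1%:R^-1].
pose F m := if unpickle m is Some (q, k) then
  (if pselect (box q k `<=` U) then box q k else set0) else set0.
suff -> : U = \bigcup_m F m.
  apply: bigcup_measurable => m _; rewrite /F.
  case: unpickle => [[q k]|]; last exact: measurable0.
  case: pselect => _ /=; last exact: measurable0.
  exact: (measurable_box (fun i => ratr (q i ord0) - k.+1%:R^-1)
                         (fun i => ratr (q i ord0) + k.+1%:R^-1)).
apply/seteqP; split=> [x Ux|x [m _]]; last first.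
  rewrite /F; case: unpickle => [[q k]|]//.
  by case: pselect => // h; exact: h.
have := open_nbhs_nbhs (conj oU Ux); rewrite -nbhs_ballE => -[e /= e0 xeU].
(* The rational centre lies within one radius of [x], hence the box within two radii, which must fit
   into the sup-norm ball of radius [e]. *)
have [k ke] : exists k : nat, k.+1%:R^-1 < e / 2.
  have e20 : 0 < e / 2 by rewrite divr_gt0.
  by have [k _ kP] := near_infty_natSinv_lt (PosNum e20); exists k; apply: kP => /=.
have k0 : 0 < k.+1%:R^-1 :> R by rewrite invr_gt0.
have hq i : exists q : rat, x i ord0 - k.+1%:R^-1 < ratr q < x i ord0 + k.+1%:R^-1.
  have : x i ord0 - k.+1%:R^-1 < x i ord0 + k.+1%:R^-1.
    by rewrite ltrBlDr -addrA ltrDl addr_gt0.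
  by move=> /rat_in_itvoo[q]; rewrite in_itv/=; exists q.
pose q : 'cV[rat]_n := \col_i sval (cid (hq i)).
have qx i : x i ord0 - k.+1%:R^-1 < ratr (q i ord0) < x i ord0 + k.+1%:R^-1.
  by rewrite mxE; case: cid.
exists (pickle (q, k)) => //; rewrite /F pickleK.
case: pselect => [_ i|]; first by have := qx i; move: k.+1%:R^-1 => d; lra.
case=> y By; apply: xeU; split=> // i j.
rewrite (ord1 j) /ball/= ltr_norml.
by have := By i; have := qx i; move: ke; move: k.+1%:R^-1 => d; lra.
Qed.

Lemma continuous_measurable_cV (f : T -> R) : continuous f -> measurable_fun setT f.
Proof.
move=> /continuousP cf; apply: (measurability _ (RGenOpens.measurableE R)).
move=> _ [_ [a [b ->] <-]]; rewrite setTI.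
by apply: open_measurable_cV; apply: cf; exact: interval_open.
Qed.

Lemma measurable_cV_add d (S : measurableType d) (g h : S -> T) :
  measurable_fun setT g -> measurable_fun setT h ->
  measurable_fun setT (fun x => g x + h x).
Proof.
move=> mg mh; under eq_fun do rewrite -[g _]scale1r.
exact: measurable_affine_cV.
Qed.

Lemma measurable_cV_sub d (S : measurableType d) (g h : S -> T) :
  measurable_fun setT g -> measurable_fun setT h ->
  measurable_fun setT (fun x => g x - h x).
Proof.
move=> mg mh; under eq_fun do rewrite addrC -scaleN1r.
exact: measurable_affine_cV.
Qed.

Lemma measurable_cV_scale d (S : measurableType d) (a : R) (g : S -> T) :
  measurable_fun setT g -> measurable_fun setT (fun x => a *: g x).
Proof.
move=> mg; under eq_fun do rewrite -[_ *: _]addr0.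
exact: measurable_affine_cV.
Qed.

Lemma measurable_dot d (S : measurableType d) (g h : S -> T) :
  measurable_fun setT g -> measurable_fun setT h ->
  measurable_fun setT (fun x => dot (g x) (h x)).
Proof.
move=> mg mh; apply: measurable_sum => i.
by apply: measurable_funM; apply: (measurableT_comp (@measurable_coord R n i)).
Qed.

Lemma measurable_enorm d (S : measurableType d) (g : S -> T) :
  measurable_fun setT g -> measurable_fun setT (fun x => enorm (g x)).
Proof.
move=> mg; have ms : measurable_fun setT (@Num.sqrt R).
  by apply: continuous_measurable_fun => x; exact: sqrt_continuous.
exact: (measurableT_comp ms (measurable_dot mg mg)).
Qed.

Lemma measurable_eannulus (x : T) e r : measurable (eannulus x e r).
Proof.
have m : measurable_fun setT (fun y : T => enorm (y - x)).
  by apply: measurable_enorm; exact: measurable_cV_sub.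
rewrite (_ : eannulus x e r = (fun y : T => enorm (y - x)) @^-1` `]e, r[).
  by rewrite -[X in measurable X]setTI; exact: m.
by apply/seteqP; split=> y /=; rewrite in_itv.
Qed.

Lemma measurable_eball (x : T) r : measurable (eball x r).
Proof.
have m : measurable_fun setT (fun y : T => enorm (y - x)).
  by apply: measurable_enorm; exact: measurable_cV_sub.
rewrite (_ : eball x r = (fun y : T => enorm (y - x)) @^-1` `]-oo, r[).
  by rewrite -[X in measurable X]setTI; exact: m.
by apply/seteqP; split=> y /=; rewrite in_itv.
Qed.

End cV_measurability.

(** * Abel kernel and Fourier inversion *)

Section abel_kernel1.
Context (R : realType).
Local Notation mu1 := (@lebesgue_measure R).

Lemma integralT_oneDsqr : (\int[mu1]_x (oneDsqr x)^-1%:E = pi%:E)%E.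
Proof.
rewrite ge0_symfun_integralT.
- rewrite (_ : [set x | _] = `[0, +oo[%classic); last first.
    by apply/seteqP; split => x/=; rewrite in_itv/= andbT.
  by rewrite integral0y_oneDsqr -EFinM mulrC divfK.
- by move=> x; rewrite invr_ge0.
- exact: continuous_oneDsqrV.
- by move=> x /=; rewrite /oneDsqr sqrrN.
Qed.

Let prim (z t : R) := expR (- t) * ((z * sin (z * t) - cos (z * t)) / (1 + z ^+ 2) - 1).

Let oneDsq_gt0 (z : R) : 0 < 1 + z ^+ 2.
Proof. by rewrite ltr_pwDl// sqr_ge0. Qed.

Let is_derive_prim (z t : R) : is_derive t 1 (prim z) ((1 + cos (z * t)) * expR (- t)).
Proof.
apply: is_derive_eq.
rewrite /GRing.scale/=.
by field; rewrite gt_eqF.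
Qed.

Let prim_cvg0 (z : R) : prim z t @[t --> +oo] --> 0.
Proof.
apply/norm_cvg0P.
apply: (@squeeze_cvgr _ _ _ _ (cst 0) (fun t => expR (- t) * (`|z| + 2))).
- near=> t; rewrite normr_ge0/= normrM ger0_norm ?expR_ge0// ler_wpM2l ?expR_ge0//.
  rewrite (le_trans (ler_normB _ _))// normr1 -[2]/(1 + 1) addrA lerD2r.
  rewrite normrM normfV (ger0_norm (ltW (oneDsq_gt0 z))) ler_pdivrMr//.
  rewrite (@le_trans _ _ (`|z| + 1))//; last first.
    by rewrite ler_peMr ?addr_ge0// lerDl sqr_ge0.
  rewrite (le_trans (ler_normB _ _))// lerD//; last exact: cos_max.
  by rewrite normrM ler_piMr// sin_max.
- exact: cvg_cst.
- rewrite -[X in _ --> X](mul0r (`|z| + 2)).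
  by apply: cvgM; [exact: cvgr_expR|exact: cvg_cst].
Unshelve. all: by end_near. Qed.

Let kern_cont (z : R) : continuous (fun t : R => (1 + cos (z * `|t|)) * expR (- `|t|)).
Proof.
move=> t; have nt : `|x| @[x --> t] --> `|t| by exact: norm_continuous.
apply: cvgM.
  apply: cvgD; first exact: cvg_cst.
  apply: continuous_cvg; first exact: continuous_cos.
  by apply: cvgM => //; exact: cvg_cst.
apply: continuous_cvg; first exact: continuous_expR.
exact: cvgN.
Qed.

(** Adding 1 to the cosine makes the integrand nonnegative, as both the reduction to a half-line and
    the improper fundamental theorem of calculus require. The added term is subtracted later. *)
Lemma integral_1Dcos_abel (z : R) :
  (\int[mu1]_t ((1 + cos (z * t)) * expR (- `|t|))%:E =
   (2 * (1 + (1 + z ^+ 2)^-1))%:E)%E.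
Proof.
have cos1_ge0 (t : R) : 0 <= 1 + cos t by have := cos_geN1 t; lra.
have cosn (t : R) : cos (z * `|t|) = cos (z * t).
  by case: (ger0P t) => // _; rewrite mulrN cosN.
under eq_integral do rewrite -cosn.
rewrite ge0_symfun_integralT//=.
- rewrite (_ : [set x | _] = `[0, +oo[%classic); last first.
    by apply/seteqP; split => x/=; rewrite in_itv/= andbT.
  rewrite (ge0_continuous_FTC2y (F := prim z) (l := 0)).
  + rewrite -EFinB -EFinM; congr EFin.
    by rewrite /prim oppr0 expR0 mulr0 sin0 cos0; field; rewrite gt_eqF.
  + move=> x _; rewrite mulr_ge0 ?expR_ge0// cos1_ge0.
  + by apply: continuous_subspaceT; exact: kern_cont.
  + exact: prim_cvg0.
  + by move=> x _; have [] := is_derive_prim z x.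
  + apply: cvg_at_right_filter.
    apply: differentiable_continuous; apply/derivable1_diffP.
    by have [] := is_derive_prim z 0.
  + move=> x; rewrite in_itv/= andbT => x0; rewrite derive1E.
    by have [_ ->] := is_derive_prim z x; rewrite ger0_norm// ltW.
- by move=> x /=; rewrite normrN.
Qed.

Lemma measurable_expNnorm : measurable_fun setT (fun t : R => expR (- `|t|)).
Proof.
apply: continuous_measurable_fun => t.
apply: continuous_cvg; first exact: continuous_expR.
by apply: cvgN; exact: norm_continuous.
Qed.

Lemma integral_abel : (\int[mu1]_t (expR (- `|t|))%:E = 2%:E)%E.
Proof.
have mexp := measurable_expNnorm; have := integral_1Dcos_abel 0.
under eq_integral do rewrite mul0r cos0 (_ : 1 + 1 = 2 :> R)// EFinM.
rewrite ge0_integralZl//; last exact/measurable_EFinP.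
rewrite expr0n/= addr0 invr1.
(* Twice the integral equals 4, which excludes the infinite values. *)
case: (\int[mu1]_t _)%E => [r [h]||].
- by congr EFin; lra.
- by rewrite mulry gtr0_sg// mul1e.
- by rewrite mulrNy gtr0_sg// mul1e.
Qed.

Lemma integrable_abel : mu1.-integrable setT (fun t => (expR (- `|t|))%:E).
Proof.
have mexp := measurable_expNnorm; apply/integrableP; split; first exact/measurable_EFinP.
under eq_integral do rewrite /= ger0_norm ?expR_ge0//.
by rewrite integral_abel ltry.
Qed.

Let measurable_cosM (z : R) : measurable_fun setT (fun t : R => cos (z * t)).
Proof.
apply: measurableT_comp; last exact: measurable_funM.
exact: continuous_measurable_fun (@continuous_cos R).
Qed.

Let measurable_sinM (z : R) : measurable_fun setT (fun t : R => sin (z * t)).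
Proof.
apply: measurableT_comp; last exact: measurable_funM.
exact: continuous_measurable_fun (@continuous_sin R).
Qed.

Lemma integrable_cos_abel (z : R) :
  mu1.-integrable setT (EFin \o (fun t => cos (z * t) * expR (- `|t|))).
Proof.
apply: (integrable_dom (g := fun t : measurableTypeR R => expR (- `|t|))).
- exact: (measurable_funM (measurable_cosM z) measurable_expNnorm).
- exact: integrable_abel.
- by move=> t; rewrite normrM (ger0_norm (expR_ge0 _)) ler_piMl ?expR_ge0// cos_max.
Qed.

Lemma integrable_sin_abel (z : R) :
  mu1.-integrable setT (EFin \o (fun t => sin (z * t) * expR (- `|t|))).
Proof.
apply: (integrable_dom (g := fun t : measurableTypeR R => expR (- `|t|))).
- exact: (measurable_funM (measurable_sinM z) measurable_expNnorm).
- exact: integrable_abel.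
- by move=> t; rewrite normrM (ger0_norm (expR_ge0 _)) ler_piMl ?expR_ge0// sin_max.
Qed.

Lemma Rintegral_cos_abel (z : R) :
  \int[mu1]_t (cos (z * t) * expR (- `|t|)) = 2 * (oneDsqr z)^-1.
Proof.
have e : \int[mu1]_t ((1 + cos (z * t)) * expR (- `|t|)) =
    2 * (1 + (1 + z ^+ 2)^-1).
  by rewrite /Rintegral integral_1Dcos_abel.
have e1 : \int[mu1]_t (expR (- `|t|)) = 2 by rewrite /Rintegral integral_abel.
move: e; under eq_Rintegral do rewrite mulrDl mul1r.
rewrite RintegralD//; [|exact: integrable_abel|exact: integrable_cos_abel].
by rewrite e1 mulrDr mulr1 => /addrI.
Qed.

(** The integrand is odd. To stay with nonnegative functions, the reflection is applied to
    [1 + sin], which it exchanges with [1 - sin]. *)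
Lemma Rintegral_sin_abel (z : R) :
  \int[mu1]_t (sin (z * t) * expR (- `|t|)) = 0.
Proof.
have s1_ge0 (t : R) : 0 <= 1 + sin t by have := sin_geN1 t; lra.
have e : \int[mu1]_t ((1 + sin (z * t)) * expR (- `|t|)) =
    \int[mu1]_t ((1 - sin (z * t)) * expR (- `|t|)).
  rewrite /Rintegral (@ge0_integral_affine _ (- 1) 0)//.
  - rewrite normrN1 mul1e; congr fine; apply: eq_integral => t _.
    by rewrite mulN1r addr0 normrN mulrN sinN.
  - apply/measurable_EFinP; apply: (measurable_funM _ measurable_expNnorm).
    by apply: measurable_funD.
move: e; under eq_Rintegral do rewrite mulrDl mul1r.
under [RHS]eq_Rintegral do rewrite mulrBl mul1r.
rewrite RintegralD//; [|exact: integrable_abel|exact: integrable_sin_abel].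
rewrite RintegralB//; [|exact: integrable_abel|exact: integrable_sin_abel].
have h0 (x : R) : x = - x -> x = 0 by move=> h; lra.
by move=> /addrI/h0.
Qed.

End abel_kernel1.

(** * Kernels that are products over the coordinates *)

Section product_kernels.
Context (R : realType).
Local Notation mu1 := (@lebesgue_measure R).
Local Notation leb n := (lebesgue_cV R n).

Definition prod_cV (g : R -> R) n (x : 'cV[R]_n) : R := \prod_i g (x i ord0).

Lemma measurable_prod_cV (g : R -> R) n : measurable_fun setT g ->
  measurable_fun setT (@prod_cV g n).
Proof.
move=> mg; apply: measurable_prod => i _.
exact: (measurableT_comp mg (@measurable_coord R n i)).
Qed.

Lemma prod_cV_ge0 g n (x : 'cV[R]_n) : (forall t, 0 <= g t) -> 0 <= prod_cV g x.
Proof. by move=> g0; exact: prodr_ge0. Qed.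

Lemma prod_cV_le1 (g : R -> R) n (x : 'cV[R]_n) :
  (forall t, 0 <= g t <= 1) -> prod_cV g x <= 1.
Proof.
move=> g01; rewrite -[leRHS](@big1_eq _ 1 *%R 'I_n (index_enum _) xpredT).
by apply: ler_prod => i _; exact: g01.
Qed.

Lemma prod_cV_cons g n t (y : 'cV[R]_n) :
  prod_cV g (cons_cV (t, y)) = g t * prod_cV g y.
Proof.
rewrite /prod_cV big_ord_recl cons_cV0; congr (_ * _).
by apply: eq_bigr => i _; rewrite cons_cVS.
Qed.

Lemma dot_cons n t (y : 'cV[R]_n) (z : 'cV[R]_n.+1) :
  dot z (cons_cV (t, y)) =
  z ord0 ord0 * t + dot (\col_i z (lift ord0 i) ord0) y.
Proof.
rewrite /dot big_ord_recl cons_cV0; congr (_ + _).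
by apply: eq_bigr => i _; rewrite cons_cVS mxE.
Qed.

Lemma integral_prod_cV (g : R -> R) c n : measurable_fun setT g -> (forall t, 0 <= g t) ->
  (\int[mu1]_t (g t)%:E = c%:E)%E ->
  (\int[leb n]_x (prod_cV g x)%:E = (c ^+ n)%:E)%E.
Proof.
move=> mg g0 gc; elim: n => [|n ih].
  rewrite integral_dirac//; last first.
    by apply/measurable_EFinP; exact: measurable_prod_cV.
  by rewrite diracT mul1e /prod_cV big_ord0.
rewrite ge0_integral_cons_cV//; last 2 first.
- by apply/measurable_EFinP; exact: measurable_prod_cV.
- by move=> x; rewrite lee_fin; exact: prod_cV_ge0.
under eq_integral => t _.
  under eq_integral do rewrite prod_cV_cons EFinM.
  rewrite ge0_integralZl//; last 3 first.
  - by apply/measurable_EFinP; exact: measurable_prod_cV.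
  - by move=> x _; rewrite lee_fin; exact: prod_cV_ge0.
  - by rewrite lee_fin.
  rewrite ih.
  over.
rewrite ge0_integralZr//.
- by rewrite gc -EFinM exprS.
- exact/measurable_EFinP.
- by move=> t _; rewrite lee_fin.
- by rewrite lee_fin exprn_ge0// -lee_fin -gc; apply: integral_ge0 => t _; rewrite lee_fin.
Qed.

Lemma integrable_prod_cV (g : R -> R) c n : measurable_fun setT g -> (forall t, 0 <= g t) ->
  (\int[mu1]_t (g t)%:E = c%:E)%E ->
  (leb n).-integrable setT (EFin \o @prod_cV g n).
Proof.
move=> mg g0 gc; apply/integrableP; split.
  by apply/measurable_EFinP; exact: measurable_prod_cV.
under eq_integral do rewrite /= ger0_norm ?prod_cV_ge0//.
by rewrite (integral_prod_cV _ mg g0 gc) ltry.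
Qed.

Lemma Rintegral_cons_cV n (f : 'cV[R]_n.+1 -> R) g h : measurable_fun setT f ->
  mu1.-integrable setT (EFin \o g) -> (leb n).-integrable setT (EFin \o h) ->
  (forall t y, `|f (cons_cV (t, y))| <= g t * h y) ->
  \int[leb n.+1]_x f x = \int[mu1]_t \int[leb n]_y f (cons_cV (t, y)).
Proof.
move=> mf ig ih fgh.
have mc := @measurable_cons_cV R n.
have mfc := measurableT_comp mf mc.
rewrite -(Rintegral_prod mfc ig ih fgh) /Rintegral; congr fine.
rewrite (eq_measure_integral (pushforward (mu1 \x leb n)%E (@cons_cV R n))) //.
apply: (etrans (integral_pushforward mc _ _ measurableT)).
- exact/measurable_EFinP.
- rewrite preimage_setT.
  exact: (integrable_prod_dom mfc ig ih fgh).
- by rewrite preimage_setT.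
Qed.

(** Up to a constant this is also a product of Poisson kernels, so the function that measures decay
    is the one that appears in Abel summation. *)
Definition weight := prod_cV (fun t => (oneDsqr t)^-1).
Definition abel := prod_cV (fun t => expR (- `|t|)).

End product_kernels.

Section abel_transform.
Context (R : realType).
Local Notation mu1 := (@lebesgue_measure R).
Local Notation leb n := (lebesgue_cV R n).

Lemma measurable_weight n : measurable_fun setT (@weight R n).
Proof.
apply: measurable_prod_cV.
by apply: continuous_measurable_fun; exact: continuous_oneDsqrV.
Qed.

Lemma measurable_abel n : measurable_fun setT (@abel R n).
Proof. exact: measurable_prod_cV (@measurable_expNnorm R). Qed.

Lemma weight_gt0 n (x : 'cV[R]_n) : 0 < weight x.
Proof. by apply: prodr_gt0 => i _; rewrite invr_gt0. Qed.

Lemma abel_gt0 n (x : 'cV[R]_n) : 0 < abel x.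
Proof. by apply: prodr_gt0 => i _; rewrite expR_gt0. Qed.

Lemma abel_cons n t (y : 'cV[R]_n) :
  abel (cons_cV (t, y)) = expR (- `|t|) * abel y.
Proof. exact: (prod_cV_cons (fun t => expR (- `|t|))). Qed.

Lemma weight_cons n t (y : 'cV[R]_n) :
  weight (cons_cV (t, y)) = (oneDsqr t)^-1 * weight y.
Proof. exact: (prod_cV_cons (fun t => (oneDsqr t)^-1)). Qed.

Lemma weight_le1 n (x : 'cV[R]_n) : weight x <= 1.
Proof.
apply: prod_cV_le1 => t.
by rewrite invr_ge0 (le_trans ler01 (oneDsqr_ge1 _))/= invf_le1.
Qed.

Lemma integrable_weight n : (leb n).-integrable setT (EFin \o @weight R n).
Proof.
apply: (@integrable_prod_cV _ _ pi) => //.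
- by apply: continuous_measurable_fun; exact: continuous_oneDsqrV.
- exact: integralT_oneDsqr.
Qed.

Lemma Rintegral_weight n : \int[leb n]_x weight x = pi ^+ n.
Proof.
rewrite /Rintegral (@integral_prod_cV _ _ pi)//.
- by apply: continuous_measurable_fun; exact: continuous_oneDsqrV.
- exact: integralT_oneDsqr.
Qed.

Lemma integrable_abel_cV n : (leb n).-integrable setT (EFin \o @abel R n).
Proof.
apply: (@integrable_prod_cV _ _ 2) => //.
- exact: measurable_expNnorm.
- exact: integral_abel.
Qed.

Lemma measurable_cos_dot d (S : measurableType d) n (g h : S -> 'cV[R]_n) :
  measurable_fun setT g -> measurable_fun setT h ->
  measurable_fun setT (fun x => cos (dot (g x) (h x))).
Proof.
move=> mg mh; apply: measurableT_comp; last exact: measurable_dot.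
exact: continuous_measurable_fun (@continuous_cos R).
Qed.

Lemma measurable_sin_dot d (S : measurableType d) n (g h : S -> 'cV[R]_n) :
  measurable_fun setT g -> measurable_fun setT h ->
  measurable_fun setT (fun x => sin (dot (g x) (h x))).
Proof.
move=> mg mh; apply: measurableT_comp; last exact: measurable_dot.
exact: continuous_measurable_fun (@continuous_sin R).
Qed.

Lemma integrable_cosM n (z : 'cV[R]_n) (f : 'cV[R]_n -> R) :
  (leb n).-integrable setT (EFin \o f) ->
  (leb n).-integrable setT (EFin \o (fun x => cos (dot z x) * f x)).
Proof.
move=> fi; apply: (integrable_dom (g := fun x => `|f x|)).
- apply: measurable_funM (integrable_measurable fi).
  by apply: measurable_cos_dot.
- exact: (integrable_norm fi).
- by move=> x; rewrite normrM ler_piMl// cos_max.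
Qed.

Lemma integrable_sinM n (z : 'cV[R]_n) (f : 'cV[R]_n -> R) :
  (leb n).-integrable setT (EFin \o f) ->
  (leb n).-integrable setT (EFin \o (fun x => sin (dot z x) * f x)).
Proof.
move=> fi; apply: (integrable_dom (g := fun x => `|f x|)).
- apply: measurable_funM (integrable_measurable fi).
  by apply: measurable_sin_dot.
- exact: (integrable_norm fi).
- by move=> x; rewrite normrM ler_piMl// sin_max.
Qed.

(** The addition formulas mix cosine and sine, so the two transforms go through a single induction.
    Integrating over the tail first, every term with the sine of the tail vanishes by induction. *)
Lemma Rintegral_cos_sin_abel_cV n (z : 'cV[R]_n) :
  \int[leb n]_x (cos (dot z x) * abel x) = 2 ^+ n * weight z /\
  \int[leb n]_x (sin (dot z x) * abel x) = 0.
Proof.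
elim: n z => [|n ih] z.
  have d0 x : dot z x = 0 by rewrite /dot big_ord0.
  have a1 x : @abel R 0 x = 1 by rewrite /abel /prod_cV big_ord0.
  rewrite /weight /prod_cV big_ord0 !mulr1; split.
    under eq_Rintegral do rewrite d0 a1 cos0 mulr1.
    by rewrite Rintegral_cst// mul1r /= indicT.
  under eq_Rintegral do rewrite d0 a1 sin0 mulr1.
  by rewrite Rintegral_cst// mul0r.
have i1 := @integrable_abel R.
have iN := integrable_abel_cV n.
have mabel := @measurable_abel n.+1.
pose a := z ord0 ord0; pose z' : 'cV[R]_n := \col_i z (lift ord0 i) ord0.
have [ihc ihs] := ih z'.
split.
- rewrite (@Rintegral_cons_cV _ _ _ _ _ _ i1 iN); first last.
  + move=> t y; rewrite -abel_cons normrM (ger0_norm (ltW (abel_gt0 _))).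
    by rewrite ler_piMl ?cos_max// ltW// abel_gt0.
  + by apply: measurable_funM => //; exact: measurable_cos_dot.
  transitivity (\int[mu1]_t (2 ^+ n * weight z' * (cos (a * t) * expR (- `|t|)))).
    apply: eq_Rintegral => t _.
    transitivity (\int[leb n]_y (cos (a * t) * expR (- `|t|) * (cos (dot z' y) * abel y)
         - sin (a * t) * expR (- `|t|) * (sin (dot z' y) * abel y))).
      apply: eq_Rintegral => y _.
      by rewrite dot_cons abel_cons -/z' -/a cosD; ring.
    rewrite RintegralB//; first last.
    + by apply: integrable_scale; exact: integrable_sinM.
    + by apply: integrable_scale; exact: integrable_cosM.
    rewrite !RintegralZl//; [|exact: integrable_sinM|exact: integrable_cosM].
    by rewrite ihc ihs mulr0 subr0 mulrC.
  rewrite RintegralZl//; last exact: integrable_cos_abel.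
  rewrite Rintegral_cos_abel exprS.
  have -> : weight z = (oneDsqr a)^-1 * weight z'.
    rewrite -weight_cons; congr weight; apply/colP => i.
    case: (unliftP ord0 i) => [j ->|->]; first by rewrite cons_cVS mxE.
    by rewrite cons_cV0.
  ring.
- rewrite (@Rintegral_cons_cV _ _ _ _ _ _ i1 iN); first last.
  + move=> t y; rewrite -abel_cons normrM (ger0_norm (ltW (abel_gt0 _))).
    by rewrite ler_piMl ?sin_max// ltW// abel_gt0.
  + by apply: measurable_funM => //; exact: measurable_sin_dot.
  transitivity (\int[mu1]_t (2 ^+ n * weight z' * (sin (a * t) * expR (- `|t|)))).
    apply: eq_Rintegral => t _.
    transitivity (\int[leb n]_y (sin (a * t) * expR (- `|t|) * (cos (dot z' y) * abel y)
         + cos (a * t) * expR (- `|t|) * (sin (dot z' y) * abel y))).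
      apply: eq_Rintegral => y _.
      by rewrite dot_cons abel_cons -/z' -/a sinD; ring.
    rewrite RintegralD//; first last.
    + by apply: integrable_scale; exact: integrable_sinM.
    + by apply: integrable_scale; exact: integrable_cosM.
    rewrite !RintegralZl//; [|exact: integrable_sinM|exact: integrable_cosM].
    by rewrite ihc ihs mulr0 addr0 mulrC.
  rewrite RintegralZl//; last exact: integrable_sin_abel.
  by rewrite Rintegral_sin_abel mulr0.
Qed.

End abel_transform.

(** * Fourier inversion by Abel summation *)

Section inversion.
Context (R : realType) (n : nat).
Local Notation T := 'cV[R]_n.
Local Notation leb := (lebesgue_cV R n).
Implicit Types (f : T -> R) (x y z nu : T).

(** For real [f] the Fourier transform is [cosFT f - i sinFT f]. *)
Definition cosFT f nu : R := \int[leb]_x (cos (dot nu x) * f x).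
Definition sinFT f nu : R := \int[leb]_x (sin (dot nu x) * f x).

(** Continuity in the form that dominated convergence both consumes and yields. *)
Definition seq_continuous f := forall (a : nat -> T) l,
  (a k @[k --> \oo] --> l) -> f (a k) @[k --> \oo] --> f l.

Lemma dotC x y : dot x y = dot y x.
Proof. by apply: eq_bigr => i _; rewrite mulrC. Qed.

Lemma dotZl (c : R) x y : dot (c *: x) y = c * dot x y.
Proof. by rewrite /dot mulr_sumr; apply: eq_bigr => i _; rewrite mxE mulrA. Qed.

Lemma dotZr (c : R) x y : dot x (c *: y) = c * dot x y.
Proof. by rewrite dotC dotZl dotC. Qed.

Lemma dotDr x y z : dot x (y + z) = dot x y + dot x z.
Proof. by rewrite /dot -big_split; apply: eq_bigr => i _; rewrite mxE mulrDr. Qed.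

Lemma dotNr x y : dot x (- y) = - dot x y.
Proof. by rewrite -scaleN1r dotZr mulN1r. Qed.

Lemma dotNl x y : dot (- x) y = - dot x y.
Proof. by rewrite dotC dotNr dotC. Qed.

Lemma dotBr x y z : dot x (y - z) = dot x y - dot x z.
Proof. by rewrite dotDr dotNr. Qed.

(** Both sides are the real part of exp(i nu . x) times the transform of [f]. *)
Lemma cosFT_sinFT_shift f x nu : leb.-integrable setT (EFin \o f) ->
  cos (dot nu x) * cosFT f nu + sin (dot nu x) * sinFT f nu =
  \int[leb]_y (cos (dot nu (y - x)) * f y).
Proof.
move=> fi; rewrite -!RintegralZl//; [|exact: integrable_sinM|exact: integrable_cosM].
rewrite -RintegralD//; first last.
- by apply: integrable_scale; exact: integrable_sinM.
- by apply: integrable_scale; exact: integrable_cosM.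
apply: eq_Rintegral => y _; rewrite dotBr cosB; ring.
Qed.

Lemma integrable_scale_arg f (e : R) : 0 < e -> leb.-integrable setT (EFin \o f) ->
  leb.-integrable setT (EFin \o (fun x => f (e *: x))).
Proof.
move=> e0 fi; have := integrable_cV_affine (0 : T) (lt0r_neq0 e0) fi.
by under eq_fun do rewrite addr0.
Qed.

(* The transform of abel is 2^n weight, so Abel summation with parameter e
   replaces f by its average against a Poisson kernel of width e. *)
Lemma abel_mean f x (e : R) (K : R) : 0 < e -> measurable_fun setT f ->
  (forall y, `|f y| <= K * weight y) ->
  \int[leb]_nu (abel (e *: nu) *
    (cos (dot nu x) * cosFT f nu + sin (dot nu x) * sinFT f nu)) =
  2 ^+ n * \int[leb]_z (f (e *: z + x) * weight z).
Proof.
move=> e0 mf fK.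
have en0 : e != 0 by rewrite lt0r_neq0.
have Kw : leb.-integrable setT (EFin \o (fun y => K * weight y)).
  exact/integrable_scale/integrable_weight.
have fi := integrable_dom mf Kw fK.
have ai : leb.-integrable setT (EFin \o (fun nu => abel (e *: nu))).
  exact/(integrable_scale_arg e0)/integrable_abel_cV.
have mcos nu : measurable_fun setT (fun y => cos (dot nu (y - x))).
  by apply: measurable_cos_dot => //; exact: measurable_cV_sub.
have ci nu : leb.-integrable setT (EFin \o (fun y => cos (dot nu (y - x)) * f y)).
  apply: (integrable_dom _ (integrable_norm fi)).
    exact: measurable_funM.
  by move=> y; rewrite normrM ler_piMl// cos_max.
pose G (p : T * T) := abel (e *: p.1) * (cos (dot p.1 (p.2 - x)) * f p.2).
have mG : measurable_fun setT G.
  apply: measurable_funM.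
    apply: (measurableT_comp (@measurable_abel R n)).
    exact: measurable_cV_scale.
  apply: measurable_funM.
    by apply: measurable_cos_dot => //; apply: measurable_cV_sub.
  exact: measurableT_comp.
transitivity (\int[leb]_nu \int[leb]_y G (nu, y)).
  apply: eq_Rintegral => nu _.
  by rewrite cosFT_sinFT_shift// -RintegralZl.
rewrite (Rfubini mG ai (integrable_norm fi)); last first.
  move=> nu y; rewrite normrM (ger0_norm (ltW (abel_gt0 _))).
  by rewrite ler_wpM2l ?(ltW (abel_gt0 _))// normrM ler_piMl// cos_max.
transitivity (\int[leb]_y (2 ^+ n * e ^- n * (f y * weight (e^-1 *: (y - x))))).
  apply: eq_Rintegral => y _.
  pose H nu := f y * (cos (dot (e^-1 *: (y - x)) nu) * abel nu).
  have iH : leb.-integrable setT (EFin \o H).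
    by apply: integrable_scale; apply: integrable_cosM; exact: integrable_abel_cV.
  transitivity (\int[leb]_nu H (e *: nu + 0)).
    apply: eq_Rintegral => nu _; rewrite /G /H addr0 dotZl dotZr mulKf// dotC; ring.
  rewrite (Rintegral_cV_affine _ en0 iH) (gtr0_norm e0) RintegralZl//; last first.
    by apply: integrable_cosM; exact: integrable_abel_cV.
  by rewrite (Rintegral_cos_sin_abel_cV _).1; ring.
pose H y := f y * weight (e^-1 *: (y - x)).
have iH : leb.-integrable setT (EFin \o H).
  apply: (integrable_dom _ (integrable_norm fi)).
    apply: measurable_funM => //; apply: (measurableT_comp (@measurable_weight R n)).
    by apply: measurable_cV_scale; exact: measurable_cV_sub.
  move=> y; rewrite normrM ler_piMr// ger0_norm ?weight_le1//.
  exact: ltW (weight_gt0 _).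
rewrite RintegralZl// -mulrA; congr (_ * _).
rewrite -{1}(gtr0_norm e0) -(Rintegral_cV_affine x en0 iH).
by apply: eq_Rintegral => z _; rewrite /H addrK scalerA mulVf// scale1r.
Qed.

Lemma abelE x : abel x = expR (- \sum_i `|x i ord0|).
Proof. by rewrite /abel /prod_cV -expR_sum sumrN. Qed.

(** The damped integrals [J k] have two limits. On the frequency side the damping tends to 1 under
    the integrable majorant given by the transforms. On the space side [abel_mean] turns them into
    averages of [f (e k *: z + x)] against [weight], dominated by [K * weight]. The factor [2 ^+ n]
    and the mass [pi ^+ n] of the weight produce the constant. *)
Theorem fourier_inversion f x (K : R) :
  measurable_fun setT f -> seq_continuous f -> (forall y, `|f y| <= K * weight y) ->
  leb.-integrable setT (EFin \o cosFT f) ->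
  leb.-integrable setT (EFin \o sinFT f) ->
  \int[leb]_nu (cos (dot nu x) * cosFT f nu + sin (dot nu x) * sinFT f nu) =
  (2 * pi) ^+ n * f x.
Proof.
move=> mf cf fK ic isn.
pose e (k : nat) : R := k.+1%:R^-1.
have e0 k : 0 < e k by rewrite invr_gt0.
have ecvg : e k @[k --> \oo] --> 0 by exact: cvg_harmonic.
pose J k := \int[leb]_nu (abel (e k *: nu) *
    (cos (dot nu x) * cosFT f nu + sin (dot nu x) * sinFT f nu)).
have mw := @measurable_weight R n.
have J1 : J k @[k --> \oo] --> \int[leb]_nu
    (cos (dot nu x) * cosFT f nu + sin (dot nu x) * sinFT f nu).
  apply: (Rintegral_cvg (g := fun nu => `|cosFT f nu| + `|sinFT f nu|)).
  - move=> k; apply: measurable_funM.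
      apply: (measurableT_comp (@measurable_abel R n)).
      exact: measurable_cV_scale.
    apply: measurable_funD; apply: measurable_funM.
    + exact: measurable_cos_dot.
    + exact: integrable_measurable ic.
    + exact: measurable_sin_dot.
    + exact: integrable_measurable isn.
  - apply: integrable_add; [exact: (integrable_norm ic)|exact: (integrable_norm isn)].
  - move=> k nu; rewrite normrM (ger0_norm (ltW (abel_gt0 _))).
    apply: (le_trans (ler_piMl _ _)) => //.
      apply: prod_cV_le1 => t.
      by rewrite expR_ge0/= -expR0 ler_expR oppr_le0.
    apply: (le_trans (ler_normD _ _)); rewrite !normrM.
    by apply: lerD; rewrite ler_piMl ?cos_max ?sin_max.
  - move=> nu; rewrite -[X in _ --> X]mul1r; apply: cvgM; last exact: cvg_cst.
    under eq_fun do rewrite abelE.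
    rewrite -expR0; apply: continuous_cvg; first exact: continuous_expR.
    rewrite -[X in _ --> X]oppr0; apply: cvgN.
    rewrite (_ : (fun k => _) = (fun k => e k * \sum_i `|nu i ord0|)).
      rewrite -[X in _ --> X](mul0r (\sum_i `|nu i ord0|)).
      by apply: cvgM => //; exact: cvg_cst.
    apply/funext => k; rewrite mulr_sumr; apply: eq_bigr => i _.
    by rewrite mxE normrM gtr0_norm.
have J2 : J k @[k --> \oo] --> (2 * pi) ^+ n * f x.
  rewrite /J; under eq_fun do rewrite (abel_mean _ (e0 _) mf fK).
  rewrite exprMn -mulrA; apply: cvgM; first exact: cvg_cst.
  rewrite -Rintegral_weight mulrC -RintegralZl//; last exact: integrable_weight.
  apply: (Rintegral_cvg (g := fun z => K * weight z)).
  - move=> k; apply: measurable_funM => //.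
    by apply: (measurableT_comp mf); exact: measurable_affine_cV.
  - exact/integrable_scale/integrable_weight.
  - move=> k z; rewrite normrM (ger0_norm (ltW (weight_gt0 _))).
    rewrite ler_wpM2r ?(ltW (weight_gt0 _))// (le_trans (fK _))//.
    rewrite ler_piMr ?weight_le1//.
    (* [K] is nonnegative, since [K * weight x] bounds an absolute value and the weight is
       positive. *)
    have := le_trans (normr_ge0 _) (fK x).
    by rewrite pmulr_lge0// weight_gt0.
  - move=> z; apply: cvgM; last exact: cvg_cst.
    apply: cf; rewrite -[X in _ --> X]add0r; apply: cvgD; last exact: cvg_cst.
    rewrite -(scale0r z); apply: cvgZl => //.
exact: (cvg_unique _ J1 J2).
Qed.

End inversion.

(** * Schwartz functions *)

Section euclidean_norm.
Context (R : realType) (n : nat).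
Local Notation T := 'cV[R]_n.
Implicit Types (x y h : T).

Lemma dotxx_ge0 x : 0 <= dot x x.
Proof. by apply: sumr_ge0 => i _; rewrite -expr2 sqr_ge0. Qed.

Lemma enorm_ge0 x : 0 <= enorm x.
Proof. exact: sqrtr_ge0. Qed.

Lemma sqr_enorm x : enorm x ^+ 2 = dot x x.
Proof. by rewrite sqr_sqrtr// dotxx_ge0. Qed.

Lemma enormZ (c : R) x : enorm (c *: x) = `|c| * enorm x.
Proof. by rewrite /enorm dotZl dotZr mulrA -expr2 sqrtrM ?sqr_ge0// sqrtr_sqr. Qed.

Lemma enormN x : enorm (- x) = enorm x.
Proof. by rewrite -scaleN1r enormZ normrN1 mul1r. Qed.

Lemma enorm0 : enorm (0 : T) = 0.
Proof. by rewrite -(scale0r 0) enormZ normr0 mul0r. Qed.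

Lemma sqr_coord_le x i : x i ord0 ^+ 2 <= dot x x.
Proof.
rewrite /dot (bigD1 i)//= -expr2 lerDl.
by apply: sumr_ge0 => j _; rewrite -expr2 sqr_ge0.
Qed.

Lemma coord_le_enorm x i : `|x i ord0| <= enorm x.
Proof. by rewrite -sqrtr_sqr ler_wsqrtr// sqr_coord_le. Qed.

Lemma enorm_eq0 x : (enorm x == 0) = (x == 0).
Proof.
apply/idP/idP => [/eqP x0|/eqP->]; last by rewrite enorm0.
apply/eqP/colP => i; rewrite mxE; apply/eqP; rewrite -normr_le0 -x0.
exact: coord_le_enorm.
Qed.

Lemma sum_coord_le_enorm x : \sum_i `|x i ord0| <= n%:R * enorm x.
Proof.
rewrite mulr_natl -[X in _ *+ X]card_ord -sumr_const.
by apply: ler_sum => i _; exact: coord_le_enorm.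
Qed.

(** A deliberately crude form of Cauchy-Schwarz: the product is the inverse of [weight x], so growth
    in the frequency is counted in the same unit as decay. *)
Lemma dot_le x y : `|dot x y| <= n%:R * (\prod_i oneDsqr (x i ord0)) * enorm y.
Proof.
apply: (le_trans (ler_norm_sum _ _ _)).
rewrite -mulrA mulr_natl -[X in _ *+ X]card_ord -sumr_const.
apply: ler_sum => i _; rewrite normrM ler_pM// ?coord_le_enorm//.
rewrite (bigD1 i)//= -[leLHS]mulr1 ler_pM//.
- rewrite /oneDsqr -normr_id -real_normK ?num_real// normr_id.
  have := normr_ge0 (x i ord0); move: `|_| => a a0; nra.
- rewrite -[leLHS](@big1_eq _ 1 *%R 'I_n (index_enum _) (fun j => j != i)).
  by apply: ler_prod => j _; rewrite ler01 oneDsqr_ge1.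
Qed.

Lemma weightV x : (weight x)^-1 = \prod_i oneDsqr (x i ord0).
Proof. by rewrite /weight /prod_cV -prodfV; apply: eq_bigr => i _; rewrite invrK. Qed.

(** Peetre's inequality in one variable; the difference of the two sides for [r = |b|] is a sum of
    squares. *)
Lemma oneDsqr_shift (r a b : R) : `|b| <= r ->
  oneDsqr a <= 2 * (1 + r ^+ 2) * oneDsqr (a + b).
Proof.
move=> br; have b2 : b ^+ 2 <= r ^+ 2 by rewrite -real_normK ?num_real// lerXn2r// nnegrE// (le_trans _ br).
rewrite /oneDsqr; set s := r ^+ 2 in b2 *.
have h : 1 + a ^+ 2 <= 2 * (1 + b ^+ 2) * (1 + (a + b) ^+ 2).
  rewrite -subr_ge0.
  have -> : 2 * (1 + b ^+ 2) * (1 + (a + b) ^+ 2) - (1 + a ^+ 2) =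
     1 + (a + 2 * b) ^+ 2 + 2 * (b * (a + b)) ^+ 2 by ring.
  by have := sqr_ge0 (a + 2 * b); have := sqr_ge0 (b * (a + b)); lra.
apply: (le_trans h); rewrite ler_wpM2r ?addr_ge0 ?sqr_ge0//.
by rewrite ler_wpM2l// lerD2l.
Qed.

Definition shift_const (r : R) : R := (2 * (1 + r ^+ 2)) ^+ n.

Lemma shift_const_ge0 r : 0 <= shift_const r.
Proof. by rewrite exprn_ge0// mulr_ge0// addr_ge0// sqr_ge0. Qed.

Lemma weight_shift (r : R) x h : (forall i, `|h i ord0| <= r) ->
  weight (x + h) <= shift_const r * weight x.
Proof.
move=> hr; suff : (weight x)^-1 <= shift_const r * (weight (x + h))^-1.
  by rewrite ler_pdivlMr ?weight_gt0// mulrC ler_pdivrMr ?weight_gt0.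
rewrite !weightV /shift_const -[X in _ ^+ X]card_ord -prodr_const -big_split/=.
apply: ler_prod => i _; rewrite (le_trans ler01 (oneDsqr_ge1 _))/= mxE.
exact: oneDsqr_shift.
Qed.

End euclidean_norm.

(** * Increments bounded by partial derivatives *)

Section mean_value.
Context (R : realType) (n : nat).
Local Notation T := 'cV[R]_n.
Local Notation e i := (delta_mx i ord0 : 'cV[R]_n).
Implicit Types (g : T -> R) (x y h : T).

Lemma is_derive_line g y i (t : R) : derivable g (y + t *: e i) (e i) ->
  is_derive t 1 (fun s : R => g (y + s *: e i)) ('D_(e i) g (y + t *: e i)).
Proof.
have E : (fun a : R => a^-1 *: (((fun s : R => g (y + s *: e i)) \o shift t) (a *: (1 : R))
      - g (y + t *: e i))) =
    (fun a => a^-1 *: ((g \o shift (y + t *: e i)) (a *: e i) - g (y + t *: e i))).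
  apply/funext => a /=; congr (_ *: (g _ - _)).
  by rewrite [a *: (1 : R)]mulr1 scalerDl addrCA.
move=> dg; split; first by rewrite /derivable E.
by rewrite /derive E.
Qed.

Lemma line_le g y i (t M : R) : (forall x, derivable g x (e i)) ->
  (forall s, `|s| <= `|t| -> `|'D_(e i) g (y + s *: e i)| <= M) ->
  `|g (y + t *: e i) - g y| <= M * `|t|.
Proof.
move=> dg gM; pose F (s : R) := g (y + s *: e i).
have dF (s : R) : is_derive s 1 F ('D_(e i) g (y + s *: e i)).
  exact: is_derive_line.
have cF : continuous F.
  move=> s; apply: differentiable_continuous; apply/derivable1_diffP.
  by have [] := dF s.
have -> : g y = F 0 by rewrite /F scale0r addr0.
rewrite -/(F t); have [t0|t0] := leP 0 t.
  have [|c /[!in_itv]/= /andP[c0 ct] ->] := MVT_segment t0 (fun s _ => dF s).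
    exact: continuous_subspaceT.
  rewrite subr0 normrM ler_wpM2r// gM//.
  by rewrite !ger0_norm// (le_trans _ ct).
have [|c /[!in_itv]/= /andP[c0 ct]] := MVT_segment (ltW t0) (fun s _ => dF s).
  exact: continuous_subspaceT.
rewrite distrC => ->; rewrite sub0r normrM normrN ler_wpM2r// gM//.
by rewrite !ler0_norm ?lerN2// ltW.
Qed.

(** The part of [h] along the coordinates listed in [s]: the corners of a path from 0 to [h]
    parallel to the axes. *)
Let psum (s : seq 'I_n) h : T := \sum_(i <- s) h i ord0 *: e i.

Let psum_coord s h j : uniq s -> psum s h j ord0 = if j \in s then h j ord0 else 0.
Proof.
rewrite /psum; elim: s => [|i s ih] /=; first by rewrite big_nil mxE.
move=> /andP[is_ us]; rewrite big_cons mxE [X in X + _]mxE mxE ih// in_cons.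
rewrite eqxx andbT; have [->|ji] := eqVneq j i; last by rewrite mulr0 add0r.
by rewrite mulr1 (negbTE is_) addr0.
Qed.

Let psum_enum h : psum (index_enum 'I_n) h = h.
Proof.
by apply/colP => j; rewrite psum_coord ?mem_index_enum// index_enum_uniq.
Qed.

(** Only derivatives along the axes are available, so [x] is moved to [x + h] one coordinate at a
    time and the mean value theorem is applied on each segment. All points visited differ from [x]
    by at most [r] in each coordinate, so their weights are comparable to that of [x]. *)
Lemma increment_le g x h (r K : R) : 0 <= K ->
  (forall i x, derivable g x (e i)) ->
  (forall i x, `|'D_(e i) g x| <= K * weight x) ->
  (forall i, `|h i ord0| <= r) ->
  `|g (x + h) - g x| <= K * shift_const n r * n%:R * enorm h * weight x.
Proof.
move=> K0 dg gK hr.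
suff S (s : seq 'I_n) : uniq s ->
    `|g (x + psum s h) - g x| <=
    (K * shift_const n r * weight x) * \sum_(i <- s) `|h i ord0|.
  have := S _ (index_enum_uniq _); rewrite psum_enum => /le_trans; apply.
  rewrite (_ : K * shift_const n r * n%:R * enorm h * weight x =
    K * shift_const n r * weight x * (n%:R * enorm h)); last by ring.
  rewrite ler_wpM2l ?sum_coord_le_enorm// !mulr_ge0 ?shift_const_ge0//.
  exact: ltW (weight_gt0 _).
elim: s => [_|i s ih /= /andP[is_ us]].
  by rewrite /psum !big_nil addr0 subrr normr0 mulr0.
rewrite {1}/psum !big_cons mulrDr.
rewrite (_ : g _ - g x = (g (x + psum s h + h i ord0 *: e i) - g (x + psum s h))
   + (g (x + psum s h) - g x)); last first.
  by rewrite [X in x + X]addrC addrA -/(psum s h) subrKA.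
apply: (le_trans (ler_normD _ _)); apply: lerD; last exact: ih.
apply: line_le => // t ti; apply: (le_trans (gK _ _)).
rewrite -mulrA ler_wpM2l// -addrA; apply: weight_shift => j.
rewrite mxE psum_coord// !mxE eqxx andbT.
have [->|ji] := eqVneq j i.
  by rewrite (negbTE is_) add0r mulr1 (le_trans ti).
rewrite mulr0 addr0; case: ifP => // _.
by rewrite normr0 (le_trans _ (hr j)).
Qed.

End mean_value.

(** * Weighted difference estimates for Schwartz functions *)

Section tameness.
Context (R : realType) (n : nat).
Local Notation T := 'cV[R]_n.
Local Notation e i := (delta_mx i ord0 : 'cV[R]_n).
Implicit Types (f g : T -> R) (x y h k : T) (r : R).

Definition decaying f := exists2 K : R, 0 <= K & forall x, `|f x| <= K * weight x.

(** The input class of one odd operator. Even operators, and the composition of two odd ones, start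
    from [tame2]. *)
Definition tame1 r f := [/\ measurable_fun setT f, seq_continuous f, decaying f &
  exists2 K : R, 0 <= K & forall x h, enorm h <= r ->
    `|f (x + h) - f x| <= K * enorm h * weight x].

(** Two independent increments serve two purposes: [h = w], [k = - w] gives the centred second
    difference of the even operator, while a free [h] with [k = w] and [k = - w] gives a Lipschitz
    bound for the odd difference. *)
Definition tame2 r f := tame1 r f /\
  exists2 K : R, 0 <= K & forall x h k, enorm h <= r -> enorm k <= r ->
    `|(f (x + h + k) - f (x + h)) - (f (x + k) - f x)| <=
      K * enorm h * enorm k * weight x.

Lemma schwartz_partial f i : schwartz f -> schwartz (fun x => 'D_(e i) f x).
Proof.
have E s : partials s (fun x => 'D_(e i) f x) = partials (rcons s i) f.
  by rewrite /partials foldr_rcons.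
by move=> [sf df]; split=> [s|k s]; rewrite E; [exact: sf|exact: df].
Qed.

Lemma schwartz_derivable f i x : schwartz f -> derivable f x (e i).
Proof. by move=> [/(_ [::])[_ +] _]; exact. Qed.

Lemma schwartz_continuous f : schwartz f -> continuous f.
Proof. by move=> [/(_ [::])[+ _] _]; exact. Qed.

(** Reduces decay against the weight to the Schwartz seminorms with exponents 0 and [2 * n]. The
    bound (1 + a)^n <= 2^n (1 + a^n) is checked separately for a <= 1 and for a > 1. *)
Lemma weightV_le x : (weight x)^-1 <= 2 ^+ n * (1 + enorm x ^+ (2 * n)).
Proof.
rewrite weightV; apply: (@le_trans _ _ ((1 + enorm x ^+ 2) ^+ n)).
  rewrite -[X in _ ^+ X]card_ord -prodr_const; apply: ler_prod => i _.
  by rewrite (le_trans ler01 (oneDsqr_ge1 _))/= lerD2l sqr_enorm sqr_coord_le.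
rewrite exprM; move: (enorm x ^+ 2) (sqr_ge0 (enorm x)) => a a0.
have [a1|a1] := leP a 1.
  apply: (@le_trans _ _ (2 ^+ n)); first by rewrite lerXn2r// ?nnegrE ?addr_ge0//; lra.
  by rewrite ler_peMr ?exprn_ge0// lerDl exprn_ge0.
apply: (@le_trans _ _ ((2 * a) ^+ n)).
  by rewrite lerXn2r// ?nnegrE ?addr_ge0 ?mulr_ge0//; lra.
by rewrite exprMn ler_wpM2l ?exprn_ge0// lerDr.
Qed.

Lemma schwartz_decaying f : schwartz f -> decaying f.
Proof.
move=> [_ df]; have [K0 h0] := df 0%N [::]; have [K1 h1] := df (2 * n)%N [::].
have K0p : 0 <= K0 by rewrite (le_trans _ (h0 0))//= expr0 mul1r.
have K1p : 0 <= K1 by rewrite (le_trans _ (h1 0))//= mulr_ge0// exprn_ge0// enorm_ge0.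
exists (2 ^+ n * (K0 + K1)); first by rewrite mulr_ge0 ?exprn_ge0 ?addr_ge0.
move=> x; rewrite -ler_pdivrMr ?weight_gt0//.
apply: (@le_trans _ _ (`|f x| * (2 ^+ n * (1 + enorm x ^+ (2 * n))))).
  by rewrite ler_wpM2l// weightV_le.
rewrite mulrCA ler_wpM2l ?exprn_ge0// mulrDr mulr1 lerD//.
  by have := h0 x; rewrite expr0 mul1r.
by rewrite mulrC; exact: h1.
Qed.

(** Makes finitely many constants uniform, by taking their sum. *)
Lemma bounded_family (I : finType) (P : I -> R -> Prop) :
  (forall i K K', K <= K' -> P i K -> P i K') ->
  (forall i, exists2 K, 0 <= K & P i K) -> exists2 K, 0 <= K & forall i, P i K.
Proof.
move=> Pm PI; pose K i := sval (cid2 (PI i)).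
have K0 i : 0 <= K i by rewrite /K; case: cid2.
have KP i : P i (K i) by rewrite /K; case: cid2.
exists (\sum_i K i); first exact: sumr_ge0.
move=> i; apply: Pm (KP i); rewrite (bigD1 i)//= lerDl.
exact: sumr_ge0.
Qed.

Lemma schwartz_partial_bound f : schwartz f ->
  exists2 K : R, 0 <= K & forall i x, `|'D_(e i) f x| <= K * weight x.
Proof.
move=> sf; apply: (@bounded_family _ (fun i K => forall x, `|'D_(e i) f x| <= K * weight x)).
- move=> i K K' KK' h x; rewrite (le_trans (h x))// ler_wpM2r//.
  exact: ltW (weight_gt0 _).
- by move=> i; exact: schwartz_decaying (schwartz_partial i sf).
Qed.

Lemma schwartz_lip r f : schwartz f ->
  exists2 K : R, 0 <= K & forall x h, enorm h <= r ->
    `|f (x + h) - f x| <= K * enorm h * weight x.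
Proof.
move=> sf; have [K K0 fK] := schwartz_partial_bound sf.
exists (K * shift_const n r * n%:R); first by rewrite !mulr_ge0// shift_const_ge0.
move=> x h hr; apply: increment_le => //.
- by move=> i y; exact: schwartz_derivable.
- by move=> i; rewrite (le_trans (coord_le_enorm _ _)).
Qed.

Lemma is_derive_shift f i k x : derivable f (x + k) (e i) ->
  is_derive x (e i) (fun y => f (y + k)) ('D_(e i) f (x + k)).
Proof.
have E : (fun a : R => a^-1 *: (((fun y => f (y + k)) \o shift x) (a *: e i) - f (x + k))) =
    (fun a => a^-1 *: ((f \o shift (x + k)) (a *: e i) - f (x + k))).
  by apply/funext => a /=; rewrite addrA.
move=> df; split; first by rewrite /derivable E.
by rewrite /derive E.
Qed.

(** The second difference is the increment by [h] of [g y = f (y + k) - f y]. The partials of [g]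
    are increments by [k] of the partials of [f], which are Schwartz and hence already bounded by
    [enorm k] times the weight. *)
Lemma schwartz_lip2 r f : schwartz f ->
  exists2 K : R, 0 <= K & forall x h k, enorm h <= r -> enorm k <= r ->
    `|(f (x + h + k) - f (x + h)) - (f (x + k) - f x)| <=
      K * enorm h * enorm k * weight x.
Proof.
move=> sf.
have [K K0 fK] : exists2 K : R, 0 <= K & forall i x h, enorm h <= r ->
    `|'D_(e i) f (x + h) - 'D_(e i) f x| <= K * enorm h * weight x.
  apply: (@bounded_family _ (fun i K => forall x h, enorm h <= r ->
    `|'D_(e i) f (x + h) - 'D_(e i) f x| <= K * enorm h * weight x)).
  - move=> i K K' KK' H x h hr; rewrite (le_trans (H x h hr))//.
    by rewrite !ler_wpM2r// ?enorm_ge0//; exact: ltW (weight_gt0 _).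
  - by move=> i; exact: schwartz_lip (schwartz_partial i sf).
exists (K * shift_const n r * n%:R); first by rewrite !mulr_ge0// shift_const_ge0.
move=> x h k hr kr.
pose g y := f (y + k) - f y.
have dg i y : is_derive y (e i) g ('D_(e i) f (y + k) - 'D_(e i) f y).
  have d1 := is_derive_shift (@schwartz_derivable f i (y + k) sf).
  have d2 := derivableP (@schwartz_derivable f i y sf).
  exact: (is_deriveB d1 d2).
have := @increment_le _ _ g x h r (K * enorm k).
rewrite /g => H.
rewrite (le_trans (H _ _ _ _))//.
- by rewrite mulr_ge0// enorm_ge0.
- by move=> i y; have [_ ->] := dg i y; exact: fK.
- by move=> i; rewrite (le_trans (coord_le_enorm _ _)).
- by rewrite le_eqVlt; apply/orP; left; apply/eqP; ring.
Qed.

Lemma continuous_seq_continuous f : continuous f -> seq_continuous f.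
Proof. by move=> cf a l al; apply: continuous_cvg => //; exact: cf. Qed.

Lemma schwartz_tame r f : schwartz f -> tame2 r f.
Proof.
move=> sf; have cf := schwartz_continuous sf.
split; last exact: schwartz_lip2.
split; [exact: continuous_measurable_cV|exact: continuous_seq_continuous|
  exact: schwartz_decaying|exact: schwartz_lip].
Qed.

End tameness.

(** * Transforms of translates and of derivatives *)

Section fourier_derivative.
Context (R : realType) (n : nat).
Local Notation T := 'cV[R]_n.
Local Notation leb := (lebesgue_cV R n).
Local Notation e i := (delta_mx i ord0 : 'cV[R]_n).
Implicit Types (f g : T -> R) (x y h nu : T).

Lemma decaying_integrable f : measurable_fun setT f -> decaying f ->
  leb.-integrable setT (EFin \o f).
Proof.
move=> mf [K _ fK]; apply: (integrable_dom mf _ fK).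
exact/integrable_scale/integrable_weight.
Qed.

Lemma measurable_translate f h : measurable_fun setT f ->
  measurable_fun setT (fun x => f (x + h)).
Proof. by move=> mf; apply: (measurableT_comp mf); exact: measurable_cV_add. Qed.

Lemma integrable_translate f h : leb.-integrable setT (EFin \o f) ->
  leb.-integrable setT (EFin \o (fun x => f (x + h))).
Proof.
move=> fi; have := integrable_cV_affine h (oner_neq0 R) fi.
by under eq_fun do rewrite scale1r.
Qed.

Lemma Rintegral_translate f h : leb.-integrable setT (EFin \o f) ->
  \int[leb]_x f (x + h) = \int[leb]_x f x.
Proof.
move=> fi; have := Rintegral_cV_affine h (oner_neq0 R) fi.
by under eq_Rintegral do rewrite scale1r; rewrite normr1 expr1n invr1 mul1r.
Qed.

Lemma cosFT_translate f h nu : leb.-integrable setT (EFin \o f) ->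
  cosFT (fun x => f (x + h)) nu =
  cos (dot nu h) * cosFT f nu + sin (dot nu h) * sinFT f nu.
Proof.
move=> fi; rewrite cosFT_sinFT_shift//.
rewrite -(@Rintegral_translate _ h); last first.
  apply: (integrable_dom _ (integrable_norm fi)).
    apply: measurable_funM; last exact: integrable_measurable fi.
    by apply: measurable_cos_dot => //; exact: measurable_cV_sub.
  by move=> y; rewrite normrM ler_piMl// cos_max.
by apply: eq_Rintegral => x _; rewrite addrK.
Qed.

Lemma sinFT_translate f h nu : leb.-integrable setT (EFin \o f) ->
  sinFT (fun x => f (x + h)) nu =
  cos (dot nu h) * sinFT f nu - sin (dot nu h) * cosFT f nu.
Proof.
move=> fi; rewrite /sinFT /cosFT.
rewrite -!RintegralZl//; [|exact: integrable_cosM|exact: integrable_sinM].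
rewrite -RintegralB//; first last.
- by apply: integrable_scale; exact: integrable_cosM.
- by apply: integrable_scale; exact: integrable_sinM.
rewrite -[RHS](@Rintegral_translate _ h); last first.
  by apply: integrable_sub; apply: integrable_scale;
     [exact: integrable_sinM|exact: integrable_cosM].
apply: eq_Rintegral => x _; rewrite dotDr sinD cosD.
rewrite (_ : cos (dot nu h) * (_ * _) - sin (dot nu h) * (_ * _) =
  (sin (dot nu x) * (cos (dot nu h) ^+ 2 + sin (dot nu h) ^+ 2)) * f (x + h)); last by ring.
by rewrite cos2Dsin2 mulr1.
Qed.

(** Difference quotients along a sequence, ready for dominated convergence. *)
Lemma is_derive_seq f x v d (a : nat -> R) : is_derive x v f d ->
  (forall k, a k != 0) -> a k @[k --> \oo] --> 0 ->
  (a k)^-1 * (f (x + a k *: v) - f x) @[k --> \oo] --> d.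
Proof.
move=> [df dfE] a0 acvg.
have D : a^-1 * (f (x + a *: v) - f x) @[a --> 0^'] --> d.
  rewrite -dfE; move: df; rewrite /derivable /derive.
  under eq_fun do rewrite /= [_ *: v + x]addrC.
  exact.
by move/(cvgr_dnbhsP (fun t : R => t^-1 * (f (x + t *: v) - f x))) : D; apply.
Qed.

Lemma is_derive_seq1 (F : R -> R) d (a : nat -> R) : is_derive (0 : R) 1 F d ->
  (forall k, a k != 0) -> a k @[k --> \oo] --> 0 ->
  (a k)^-1 * (F (a k) - F 0) @[k --> \oo] --> d.
Proof.
move=> [df dfE] a0 acvg.
have D : a^-1 * (F a - F 0) @[a --> 0^'] --> d.
  rewrite -dfE; move: df; rewrite /derivable /derive.
  under eq_fun do rewrite /= addr0 [_ *: (1 : R)]mulr1.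
  exact.
by move/(cvgr_dnbhsP (fun t : R => t^-1 * (F t - F 0))) : D; apply.
Qed.

Let eps k : R := k.+1%:R^-1.
Let eps_gt0 k : 0 < eps k. Proof. by rewrite invr_gt0. Qed.
Let eps_neq0 k : eps k != 0. Proof. exact: lt0r_neq0. Qed.
Let eps_le1 k : eps k <= 1. Proof. by rewrite invf_le1 ?ler1n. Qed.
Let eps_cvg0 : eps k @[k --> \oo] --> 0. Proof. exact: cvg_harmonic. Qed.

Lemma dot_delta nu i : dot nu (e i) = nu i ord0.
Proof.
rewrite /dot (bigD1 i)//= big1 ?addr0 => [|j ji]; rewrite mxE ?eqxx ?mulr1//.
by rewrite (negbTE ji) mulr0.
Qed.

Lemma enorm_delta i : enorm (e i) = 1.
Proof. by rewrite /enorm dot_delta mxE !eqxx sqrtr1. Qed.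

(** The limit passes under the integral because the quotients are dominated by [K * weight]: this is
    the Lipschitz bound of radius 1, which applies as every [eps k] is at most 1. *)
Let quot_cvg f i (c : T -> R) : schwartz f -> measurable_fun setT c ->
  (forall x, `|c x| <= 1) ->
  (eps k)^-1 * (\int[leb]_x (c x * f (x + eps k *: e i)) - \int[leb]_x (c x * f x))
    @[k --> \oo] --> \int[leb]_x (c x * 'D_(e i) f x).
Proof.
move=> sf mc c1.
have [[mf cf df [K K0 fK]] _] := schwartz_tame 1 sf.
have fi := decaying_integrable mf df.
have ci g : leb.-integrable setT (EFin \o g) ->
    leb.-integrable setT (EFin \o (fun x => c x * g x)).
  move=> gi; apply: (integrable_dom _ (integrable_norm gi)).
    by apply: measurable_funM => //; exact: integrable_measurable gi.
  by move=> y; rewrite normrM ler_piMl.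
have -> : (fun k => (eps k)^-1 *
    (\int[leb]_x (c x * f (x + eps k *: e i)) - \int[leb]_x (c x * f x))) =
  (fun k => \int[leb]_x (c x * ((eps k)^-1 * (f (x + eps k *: e i) - f x)))).
  apply/funext => k; rewrite -RintegralB//; last 2 first.
  - by apply: ci; exact: integrable_translate.
  - exact: ci.
  rewrite -RintegralZl//; last first.
    apply: integrable_sub; [|exact: ci].
    by apply: ci; exact: integrable_translate.
  by apply: eq_Rintegral => x _; ring.
apply: (Rintegral_cvg (g := fun x => K * weight x)).
- move=> k; apply: measurable_funM => //; apply: measurable_funM => //.
  by apply: measurable_funB => //; exact: measurable_translate.
- exact/integrable_scale/integrable_weight.
- move=> k x; rewrite normrM (le_trans (ler_piMl _ (c1 x)))//.
  rewrite normrM normfV (gtr0_norm (eps_gt0 k)) ler_pdivrMl ?eps_gt0//.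
  have en : enorm (eps k *: e i) = eps k by rewrite enormZ enorm_delta mulr1 gtr0_norm.
  by rewrite (le_trans (fK _ _ _)) ?en// mulrAC mulrC mulrA.
- move=> x; apply: cvgM; first exact: cvg_cst.
  by apply: is_derive_seq => //; exact/derivableP/schwartz_derivable.
Qed.

Let sin_quot_cvg (a : R) : (eps k)^-1 * sin (eps k * a) @[k --> \oo] --> a.
Proof.
have D : is_derive (0 : R) 1 (fun t : R => sin (t * a)) a.
  by apply: is_derive_eq; rewrite mul0r cos0 /GRing.scale/=; ring.
have := is_derive_seq1 D eps_neq0 eps_cvg0.
by under eq_fun do rewrite mul0r sin0 subr0.
Qed.

Let cos_quot_cvg (a : R) : (eps k)^-1 * (cos (eps k * a) - 1) @[k --> \oo] --> 0.
Proof.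
have D : is_derive (0 : R) 1 (fun t : R => cos (t * a)) 0.
  by apply: is_derive_eq; rewrite mul0r sin0 /GRing.scale/=; ring.
have := is_derive_seq1 D eps_neq0 eps_cvg0.
by under eq_fun do rewrite mul0r cos0.
Qed.

(** One difference quotient, two limits: under the integral by [quot_cvg], and outside it by the
    translation formula, where the quotients of [cos - 1] and [sin] tend to 0 and [nu i ord0].
    Uniqueness of limits takes the place of integration by parts. *)
Lemma cosFT_partial f i nu : schwartz f ->
  cosFT (fun x => 'D_(e i) f x) nu = nu i ord0 * sinFT f nu.
Proof.
move=> sf; have [[mf cf df _] _] := schwartz_tame 1 sf.
have fi := decaying_integrable mf df.
have := @quot_cvg f i (fun x => cos (dot nu x)) sf _ _.
move=> /(_ _ (fun x => cos_max _)) L1.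
have L2 : (eps k)^-1 * (\int[leb]_x (cos (dot nu x) * f (x + eps k *: e i))
      - \int[leb]_x (cos (dot nu x) * f x)) @[k --> \oo] --> nu i ord0 * sinFT f nu.
  rewrite (_ : (fun k => _) = (fun k =>
    (eps k)^-1 * (cos (eps k * nu i ord0) - 1) * cosFT f nu +
    (eps k)^-1 * sin (eps k * nu i ord0) * sinFT f nu)); last first.
    apply/funext => k; have := cosFT_translate (eps k *: e i) nu fi.
    by rewrite {1}/cosFT => ->; rewrite -/(cosFT f nu) dotZr dot_delta; ring.
  rewrite -[X in _ --> X]add0r -[X in X + _](mul0r (cosFT f nu)).
  by apply: cvgD; apply: cvgM; [exact: cos_quot_cvg|exact: cvg_cst|
    exact: sin_quot_cvg|exact: cvg_cst].
by apply: (cvg_unique _ (L1 _) L2) => //; exact: measurable_cos_dot.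
Qed.

Lemma sinFT_partial f i nu : schwartz f ->
  sinFT (fun x => 'D_(e i) f x) nu = - (nu i ord0 * cosFT f nu).
Proof.
move=> sf; have [[mf cf df _] _] := schwartz_tame 1 sf.
have fi := decaying_integrable mf df.
have := @quot_cvg f i (fun x => sin (dot nu x)) sf _ _.
move=> /(_ _ (fun x => sin_max _)) L1.
have L2 : (eps k)^-1 * (\int[leb]_x (sin (dot nu x) * f (x + eps k *: e i))
      - \int[leb]_x (sin (dot nu x) * f x)) @[k --> \oo] --> - (nu i ord0 * cosFT f nu).
  rewrite (_ : (fun k => _) = (fun k =>
    (eps k)^-1 * (cos (eps k * nu i ord0) - 1) * sinFT f nu -
    (eps k)^-1 * sin (eps k * nu i ord0) * cosFT f nu)); last first.
    apply/funext => k; have := sinFT_translate (eps k *: e i) nu fi.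
    by rewrite {1}/sinFT => ->; rewrite -/(sinFT f nu) dotZr dot_delta; ring.
  rewrite -[X in _ --> X]sub0r -[X in X - _](mul0r (sinFT f nu)).
  by apply: cvgB; apply: cvgM; [exact: cos_quot_cvg|exact: cvg_cst|
    exact: sin_quot_cvg|exact: cvg_cst].
by apply: (cvg_unique _ (L1 _) L2) => //; exact: measurable_sin_dot.
Qed.

Lemma FT_bounded f : decaying f -> measurable_fun setT f ->
  exists2 C : R, 0 <= C & forall nu, `|cosFT f nu| <= C /\ `|sinFT f nu| <= C.
Proof.
move=> df mf; have fi := decaying_integrable mf df.
exists (\int[leb]_x `|f x|); first exact: Rintegral_ge0.
have ni := integrable_norm fi.
move=> nu; split; (apply: le_trans (le_normr_Rintegral _ _) _ => //;
  [by [exact: integrable_cosM|exact: integrable_sinM]|]);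
  apply: le_Rintegral => //.
- exact: (integrable_norm (integrable_cosM nu fi)).
- by move=> x _; rewrite normrM ler_piMl// cos_max.
- exact: (integrable_norm (integrable_sinM nu fi)).
- by move=> x _; rewrite normrM ler_piMl// sin_max.
Qed.

(** Multiplying a transform by [oneDsqr (nu i ord0)] gives the transform of [f] minus its second
    partial in direction [i], and both terms are again Schwartz. Repetitions in [s] yield any power
    of the factors. *)
Lemma schwartz_FT_decay_seq f (s : seq 'I_n) : schwartz f ->
  exists2 C : R, 0 <= C & forall nu,
    \prod_(i <- s) oneDsqr (nu i ord0) * `|cosFT f nu| <= C /\
    \prod_(i <- s) oneDsqr (nu i ord0) * `|sinFT f nu| <= C.
Proof.
elim: s f => [|i s ih] f sf.
  have [[mf _ df _] _] := schwartz_tame 1 sf.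
  have [C C0 h] := FT_bounded df mf.
  by exists C => // nu; rewrite !big_nil !mul1r.
pose g x := 'D_(e i) (fun y => 'D_(e i) f y) x.
have s1 := schwartz_partial i sf.
have sg : schwartz g by exact: schwartz_partial.
have [C1 C10 h1] := ih _ sf; have [C2 C20 h2] := ih _ sg.
exists (C1 + C2); first exact: addr_ge0.
move=> nu; have [c1 d1] := h1 nu; have [c2 d2] := h2 nu.
have p0 : 0 <= \prod_(j <- s) oneDsqr (nu j ord0).
  by apply: prodr_ge0 => j _; rewrite (le_trans ler01)// oneDsqr_ge1.
have o0 : 0 <= oneDsqr (nu i ord0) by rewrite (le_trans ler01)// oneDsqr_ge1.
have eC : oneDsqr (nu i ord0) * cosFT f nu = cosFT f nu - cosFT g nu.
  by rewrite /g (cosFT_partial _ _ s1) (sinFT_partial _ _ sf) /oneDsqr; ring.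
have eS : oneDsqr (nu i ord0) * sinFT f nu = sinFT f nu - sinFT g nu.
  by rewrite /g (sinFT_partial _ _ s1) (cosFT_partial _ _ sf) /oneDsqr; ring.
rewrite !big_cons -!(mulrA (oneDsqr _)).
split; rewrite mulrCA -[X in X * `|_|](ger0_norm o0) -normrM ?eC ?eS.
  rewrite (le_trans (ler_wpM2l p0 (ler_normB _ _)))// mulrDr.
  exact: lerD.
rewrite (le_trans (ler_wpM2l p0 (ler_normB _ _)))// mulrDr.
exact: lerD.
Qed.

(* Two powers of the weight absorb the multiplier, which is O(weight^-2); the
   third makes the product integrable. *)
Lemma schwartz_FT_decay f : schwartz f -> exists2 C : R, 0 <= C & forall nu,
  `|cosFT f nu| <= C * weight nu ^+ 3 /\ `|sinFT f nu| <= C * weight nu ^+ 3.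
Proof.
move=> sf; pose s := index_enum 'I_n.
have [C C0 h] := schwartz_FT_decay_seq (s ++ s ++ s) sf.
exists C => // nu; have [hc hs] := h nu.
have E : \prod_(i <- s ++ s ++ s) oneDsqr (nu i ord0) = (weight nu ^+ 3)^-1.
  by rewrite !big_cat/= -weightV exprS expr2 !invfM.
rewrite E in hc hs.
have w0 : 0 < weight nu ^+ 3 by rewrite exprn_gt0// weight_gt0.
by rewrite -!ler_pdivrMr// ![_ / _]mulrC.
Qed.

End fourier_derivative.

(** * Singular kernel operators *)

Section riesz_integrable.
Context (R : realType) (n : nat) (delta beta : R).
Hypotheses (n_gt0 : (0 < n)%N) (delta_gt0 : 0 < delta) (beta_lt : beta < n%:R + 2).
Local Notation T := 'cV[R]_n.
Local Notation leb := (lebesgue_cV R n).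
Implicit Types w : T.

(** The common majorant of the state kernel times [enorm w] and of the bond kernel times
    [enorm w ^+ 2]. *)
Definition riesz w : R := \1_(eball 0 delta) w * (enorm w ^+ 2 / enorm w `^ beta).

Lemma riesz_ge0 w : 0 <= riesz w.
Proof. by rewrite mulr_ge0// divr_ge0 ?sqr_ge0 ?powR_ge0. Qed.

Lemma measurable_riesz : measurable_fun setT riesz.
Proof.
apply: measurable_funM; first by apply: measurable_indic; exact: measurable_eball.
have me : measurable_fun setT (@enorm R n) by exact: measurable_enorm.
apply: measurable_funM; first exact: measurable_funX.
under eq_fun do rewrite -powRN.
exact: (measurableT_comp (@measurable_powR R (- beta)) me).
Qed.

Let h : R := 2^-1.
Let h_gt0 : 0 < h. Proof. by rewrite invr_gt0. Qed.
Let h_lt1 : h < 1. Proof. by rewrite invf_lt1// ltr1n. Qed.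
(* riesz w <= c k on the ring r_(k+1) <= |w| < r_k, which lies in the box Q k;
   t is the order of the singularity at 0, and c k * vol (Q k) is geometric of
   ratio q = 2^(t - n) < 1. *)
Let t : R := Num.max (beta - 2) 0.
Let p : R := 2 - beta + t.
Let r k : R := delta * h ^+ k.
Let r_gt0 k : 0 < r k. Proof. by rewrite mulr_gt0// exprn_gt0. Qed.
Let t_ge0 : 0 <= t. Proof. by rewrite le_max lexx orbT. Qed.
Let p_ge0 : 0 <= p.
Proof. by rewrite /p -opprB addrC subr_ge0 le_max lexx. Qed.
Let t_lt : t < n%:R.
Proof. by rewrite gt_max ltr0n n_gt0 ltrBlDr beta_lt. Qed.

Let c k : R := delta `^ p * ((delta * h) `^ t)^-1 * ((h `^ t)^-1) ^+ k.

Let Q k : set T := [set x | forall i, `](- r k), (r k)[%classic (x i ord0)].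

Let c_ge0 k : 0 <= c k.
Proof. by rewrite !mulr_ge0 ?invr_ge0 ?exprn_ge0 ?invr_ge0 ?powR_ge0. Qed.

Let powXn k : (h ^+ k) `^ t = (h `^ t) ^+ k.
Proof. by rewrite -powR_mulrn ?ltW// powRAC powR_mulrn// powR_ge0. Qed.

Let riesz_le k w : r k.+1 <= enorm w < r k -> riesz w <= c k.
Proof.
move=> /andP[rw wr]; have w0 : 0 < enorm w by exact: lt_le_trans rw.
apply: (@le_trans _ _ (enorm w ^+ 2 / enorm w `^ beta)).
  rewrite ler_piMl ?divr_ge0 ?sqr_ge0 ?powR_ge0// indicE.
rewrite -powR_mulrn ?enorm_ge0// -powRN -powRD ?(gt_eqF w0) ?implybT//.
(* Both [p] and [t] are nonnegative, so each power is monotone: the first is bounded through the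
   radius [delta] of the ball, the second through the inner radius of the ring. *)
rewrite (_ : 2 - beta = p - t); last by rewrite /p addrK.
rewrite powRD ?(gt_eqF w0) ?implybT// /c -mulrA.
apply: ler_pM; rewrite ?powR_ge0//.
  apply: ge0_ler_powR => //; rewrite ?nnegrE ?(ltW w0) ?(ltW delta_gt0)//.
  by rewrite (le_trans (ltW wr))// ler_piMr ?(ltW delta_gt0)// exprn_ile1// ltW.
rewrite powRN exprVn -invfM -powXn -powRM ?exprn_ge0 ?mulr_ge0 ?(ltW h_gt0) ?(ltW delta_gt0)//.
rewrite lef_pV2 ?posrE ?powR_gt0 ?mulr_gt0 ?exprn_gt0//.
apply: ge0_ler_powR => //; rewrite ?nnegrE ?(ltW w0) ?mulr_ge0 ?exprn_ge0 ?(ltW h_gt0) ?(ltW delta_gt0)//.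
by move: rw; rewrite /r exprS mulrA.
Qed.

(** Take the least [k] with [r k.+1 <= enorm w]. Minimality gives the upper bound, except for
    [k = 0], where it is membership in the ball. *)
Let ring_index w : w != 0 -> eball 0 delta w -> exists k, r k.+1 <= enorm w < r k.
Proof.
move=> wn0; rewrite /eball/= subr0 => wd.
have w0 : 0 < enorm w by rewrite lt_neqAle enorm_ge0 eq_sym enorm_eq0 wn0.
have ex : exists k, r k.+1 <= enorm w.
  have : geometric delta h @ \oo --> 0 by apply: cvg_geometric; rewrite gtr0_norm.
  move=> /cvgrPdist_lt/(_ _ w0)[k _ /(_ k.+1 (leqnSn k))].
  by rewrite /= sub0r normrN gtr0_norm ?r_gt0// => /ltW; exists k.
case: (ex_minnP ex) => k rk kmin; exists k; rewrite rk/=.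
case: k rk kmin => [|k] rk kmin; first by rewrite /r expr0 mulr1.
rewrite ltNge; apply/negP => /kmin; by rewrite ltnn.
Qed.

Let mQ k : measurable (Q k).
Proof.
have := @measurable_box R n (fun=> - r k) (fun=> r k).
rewrite (_ : [set _ | _] = Q k)//.
Qed.

Let muQ k : (leb (Q k) = ((2 * r k) ^+ n)%:E)%E.
Proof.
rewrite (@lebesgue_cV_box R n (fun=> `](- r k), (r k)[%classic))//.
rewrite lebesgue_measure_itv/= lte_fin gt0_cp// -EFinB opprK prodEFin.
by rewrite prodr_const card_ord -mulr2n mulr_natl.
Qed.

Let q : R := h ^+ n / h `^ t.
Let q_ge0 : 0 <= q. Proof. by rewrite divr_ge0 ?exprn_ge0 ?powR_ge0 ?ltW. Qed.
(** Here [beta < n + 2] enters: [q] equals [h] to the power [n - t], and [t < n]. *)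
Let q_lt1 : q < 1.
Proof.
rewrite /q -powR_mulrn ?ltW// -powRB ?(gt_eqF h_gt0) ?implybT//.
have e1 : (1 : R) `^ (n%:R - t) = 1 by rewrite powR1.
rewrite -[ltRHS]e1; apply: gt0_ltr_powR; rewrite ?subr_gt0// nnegrE ?(ltW h_gt0)//.
Qed.

Let C : R := delta `^ p * ((delta * h) `^ t)^-1 * (2 * delta) ^+ n.
Let C_ge0 : 0 <= C.
Proof. by rewrite !mulr_ge0 ?invr_ge0 ?exprn_ge0 ?powR_ge0 ?mulr_ge0// ltW. Qed.

Let cmuQ k : c k * (2 * r k) ^+ n = C * q ^+ k.
Proof.
rewrite /c /C /q /r mulrA !exprMn exprVn -!exprM (mulnC n k).
ring.
Qed.

(** Each point lies in some ring, so one term of the series already dominates [riesz]. The boxes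
    overlap, which is harmless for an upper bound. *)
Lemma integrable_riesz : leb.-integrable setT (EFin \o riesz).
Proof.
have mr := measurable_riesz.
apply/integrableP; split; first exact/measurable_EFinP.
under eq_integral do rewrite /= ger0_norm ?riesz_ge0//.
have i0 k w : 0 <= c k * \1_(Q k) w :> R by rewrite mulr_ge0.
apply: (@le_lt_trans _ _ (\int[leb]_w (\sum_(k <oo) (c k * \1_(Q k) w)%:E))%E).
  apply: ge0_le_integral => //.
  - by move=> w _; rewrite lee_fin riesz_ge0.
  - exact/measurable_EFinP.
  - apply: ge0_emeasurable_sum => [|k]; first by move=> *; rewrite lee_fin.
    move=> _; apply/measurable_EFinP/measurable_funM => //; exact: measurable_indic.
  - move=> w _; have [->|wn0] := eqVneq w 0.
      (* The origin lies in no ring; the vanishing numerator settles it whatever the power in the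
         denominator is. *)
      rewrite /riesz enorm0 expr0n/= mul0r mulr0.
      by apply: nneseries_ge0 => k _ _; rewrite lee_fin.
    have [wB|wB] := pselect (eball 0 delta w); last first.
      rewrite /riesz indicE memNset// mul0r.
      by apply: nneseries_ge0 => k _ _; rewrite lee_fin.
    have [k kw] := ring_index wn0 wB.
    apply: (@le_trans _ _ (c k * \1_(Q k) w)%:E).
      have wQ : Q k w.
        move=> i /=; rewrite in_itv/= -ltr_norml.
        by case/andP: kw => _; exact: le_lt_trans (coord_le_enorm _ _).
      by rewrite lee_fin indicE mem_set// mulr1 riesz_le.
    apply: le_trans (nneseries_lim_ge k.+1 _); last by move=> j _ _; rewrite lee_fin.
    by rewrite big_nat_recr//= leeDr// sume_ge0// => j _; rewrite lee_fin.
rewrite integral_nneseries//; last 2 first.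
- by move=> k; apply/measurable_EFinP/measurable_funM => //; exact: measurable_indic.
- by move=> k w _; rewrite lee_fin.
have E k : (\int[leb]_w (c k * \1_(Q k) w)%:E = (C * q ^+ k)%:E)%E.
  under eq_integral do rewrite EFinM.
  rewrite ge0_integralZl//; last 2 first.
  - by apply/measurable_EFinP; exact: measurable_indic.
  - by rewrite lee_fin.
  have iQ : (\int[leb]_x (\1_(Q k) x)%:E = ((2 * r k) ^+ n)%:E)%E.
    by rewrite integral_indic// setIT; exact: muQ.
  by rewrite iQ -EFinM cmuQ.
under eq_eseriesr do rewrite E.
apply: (@le_lt_trans _ _ (C / (1 - q))%:E); last exact: ltry.
apply: lime_le.
  by apply: is_cvg_nneseries => k _ _; rewrite lee_fin mulr_ge0// exprn_ge0.
apply: nearW => N; rewrite sumEFin lee_fin.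
have qn1 : q != 1 by rewrite lt_eqF.
have := geometric_seriesE C qn1 => /(congr1 (@^~ N)).
rewrite /series/= => ->.
rewrite ler_wpM2r ?invr_ge0 ?subr_ge0 ?(ltW q_lt1)// ler_piMr//.
by rewrite gerBl exprn_ge0.
Qed.

End riesz_integrable.

(** * Absolutely convergent kernel operators *)

Section kernel_operator.
Context (R : realType) (n : nat).
Local Notation T := 'cV[R]_n.
Local Notation leb := (lebesgue_cV R n).
Implicit Types (x w nu : T).
Variables (kap sig : T -> R) (D : T * T -> R) (K : R).
Hypotheses (mkap : measurable_fun setT kap) (sig_ge0 : forall w, 0 <= sig w).
Hypothesis ikap : leb.-integrable setT (EFin \o (fun w => `|kap w| * sig w)).
Hypothesis mD : measurable_fun setT D.
Hypothesis K_ge0 : 0 <= K.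
Hypothesis DK : forall x w, kap w != 0 -> `|D (x, w)| <= K * sig w * weight x.

(** [D] is to be a symmetric difference and [sig] the power of [enorm w] that it gains. Its bound is
    asked for only where [kap] is nonzero, because difference estimates hold for bounded increments
    only. *)
Definition kernel_op x : R := \int[leb]_w (kap w * D (x, w)).

Let F (p : T * T) := kap p.2 * D p.

Let mF : measurable_fun setT F.
Proof. by apply: measurable_funM => //; exact: measurableT_comp. Qed.

Let FK x w : `|F (x, w)| <= K * weight x * (`|kap w| * sig w).
Proof.
rewrite /F/= normrM; have [->|k0] := eqVneq (kap w) 0.
  by rewrite normr0 !mul0r mulr0.
rewrite (le_trans (ler_wpM2l (normr_ge0 _) (DK x k0)))// le_eqVlt.
by apply/orP; left; apply/eqP; ring.
Qed.

Let iw : leb.-integrable setT (EFin \o (fun x => K * weight x)).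
Proof. exact/integrable_scale/integrable_weight. Qed.

Lemma measurable_kernel_op : measurable_fun setT kernel_op.
Proof. exact: (integrable_measurable (integrable_Rintegral1 mF iw ikap FK)). Qed.

Lemma integrable_kernel_section x :
  leb.-integrable setT (EFin \o (fun w => kap w * D (x, w))).
Proof. exact: (integrable_section1 mF ikap FK x). Qed.

Lemma decaying_kernel_op : decaying kernel_op.
Proof.
exists (K * \int[leb]_w (`|kap w| * sig w)).
  by rewrite mulr_ge0//; apply: Rintegral_ge0 => w _; rewrite mulr_ge0.
move=> x; rewrite mulrAC -RintegralZl//.
apply: (le_trans (le_normr_Rintegral _ (integrable_kernel_section x))) => //.
apply: le_Rintegral => //.
- exact: (integrable_norm (integrable_kernel_section x)).
- exact: integrable_scale.
- by move=> w _; exact: FK.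
Qed.

Lemma seq_continuous_kernel_op : (forall w, seq_continuous (fun x => D (x, w))) ->
  seq_continuous kernel_op.
Proof.
move=> cD a l al; apply: (Rintegral_cvg (g := fun w => K * (`|kap w| * sig w))).
- by move=> k; exact: (measurableT_comp mF (measurable_pair1 _)).
- exact: integrable_scale.
(* The majorant must not depend on [k], so the weight at [a k] is bounded by 1. *)
- move=> k w; apply: (le_trans (FK (a k) w)); rewrite -!mulrA ler_wpM2l//.
  by rewrite ler_piMl ?weight_le1// mulr_ge0.
- by move=> w; apply: cvgM; [exact: cvg_cst|exact: cD].
Qed.

(** With [c] a cosine or a sine of [dot nu x], this brings the transform inside the kernel
    integral. *)
Lemma Rintegral_kernel_op (c : T -> R) : measurable_fun setT c ->
  (forall x, `|c x| <= 1) ->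
  \int[leb]_x (c x * kernel_op x) =
  \int[leb]_w (kap w * \int[leb]_x (c x * D (x, w))).
Proof.
move=> mc c1.
pose H (p : T * T) := c p.1 * F p.
have mH : measurable_fun setT H.
  by apply: measurable_funM => //; exact: measurableT_comp.
have HK x w : `|H (x, w)| <= K * weight x * (`|kap w| * sig w).
  by rewrite /H normrM (le_trans (ler_piMl _ (c1 x))).
transitivity (\int[leb]_x \int[leb]_w H (x, w)).
  apply: eq_Rintegral => x _; rewrite -RintegralZl//.
  exact: integrable_kernel_section.
rewrite (Rfubini mH iw ikap HK); apply: eq_Rintegral => w _.
(* Off the support of [kap] nothing bounds [D], so the constant cannot be pulled out there; both
   sides are 0 instead. *)
have [k0|k0] := eqVneq (kap w) 0.
  rewrite k0 mul0r; under eq_Rintegral do rewrite /H /F/= k0 mul0r mulr0.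
  by rewrite Rintegral_cst// mul0r.
rewrite -RintegralZl//; first by apply: eq_Rintegral => x _; rewrite mulrCA.
have cw : leb.-integrable setT (EFin \o (fun x => K * sig w * weight x)).
  exact/integrable_scale/integrable_weight.
apply: (integrable_dom _ cw).
  by apply: measurable_funM => //; exact: (measurableT_comp mD (measurable_pair2 _)).
by move=> x; rewrite normrM (le_trans (ler_piMl _ (c1 x)))// DK.
Qed.

End kernel_operator.

Section symmetric_differences.
Context (R : realType) (n : nat) (r : R).
Local Notation T := 'cV[R]_n.
Local Notation leb := (lebesgue_cV R n).
Implicit Types (f : T -> R) (x w nu : T).

(* What remains of f (x + w), resp. f (x + w) - f x, after integration against
   an odd, resp. even, kernel in w. *)
Definition odd_diff f (p : T * T) : R := (f (p.1 + p.2) - f (p.1 - p.2)) / 2.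
Definition even_diff f (p : T * T) : R := (f (p.1 + p.2) + f (p.1 - p.2)) / 2 - f p.1.

Lemma measurable_odd_diff f : measurable_fun setT f -> measurable_fun setT (odd_diff f).
Proof.
move=> mf; apply: measurable_funM => //; apply: measurable_funB.
  by apply: (measurableT_comp mf); exact: measurable_cV_add.
by apply: (measurableT_comp mf); exact: measurable_cV_sub.
Qed.

Lemma measurable_even_diff f : measurable_fun setT f -> measurable_fun setT (even_diff f).
Proof.
move=> mf; apply: measurable_funB; last exact: measurableT_comp.
apply: measurable_funM => //; apply: measurable_funD.
  by apply: (measurableT_comp mf); exact: measurable_cV_add.
by apply: (measurableT_comp mf); exact: measurable_cV_sub.
Qed.

Lemma seq_continuous_translate f (h : T) : seq_continuous f ->
  seq_continuous (fun x => f (x + h)).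
Proof. by move=> cf a l al; apply: cf; apply: cvgD => //; exact: cvg_cst. Qed.

Lemma seq_continuous_odd_diff f w : seq_continuous f ->
  seq_continuous (fun x => odd_diff f (x, w)).
Proof.
move=> cf a l al; apply: cvgM; last exact: cvg_cst.
exact: (cvgB (seq_continuous_translate cf al) (seq_continuous_translate cf al)).
Qed.

Lemma seq_continuous_even_diff f w : seq_continuous f ->
  seq_continuous (fun x => even_diff f (x, w)).
Proof.
move=> cf a l al; apply: cvgB; last exact: cf.
apply: cvgM; last exact: cvg_cst.
exact: (cvgD (seq_continuous_translate cf al) (seq_continuous_translate cf al)).
Qed.

Lemma odd_diff_le f : tame1 r f -> exists2 K : R, 0 <= K &
  forall x w, enorm w <= r -> `|odd_diff f (x, w)| <= K * enorm w * weight x.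
Proof.
move=> [_ _ _ [K K0 fK]]; exists K => // x w wr.
rewrite /odd_diff/= (_ : f _ - f _ = (f (x + w) - f x) - (f (x - w) - f x)); last by ring.
rewrite normrM [`|2^-1|]gtr0_norm// ler_pdivrMr// (le_trans (ler_normB _ _))//.
by rewrite mulrDr mulr1 lerD ?fK// -(enormN w) fK// enormN.
Qed.

(** Up to the factor -1/2, the even difference is the mixed second difference with increments [w]
    and [- w]. *)
Lemma even_diff_le f : tame2 r f -> exists2 K : R, 0 <= K &
  forall x w, enorm w <= r -> `|even_diff f (x, w)| <= K * enorm w ^+ 2 * weight x.
Proof.
move=> [_ [K K0 fK]]; exists K => // x w wr.
have := fK x w (- w) wr; rewrite enormN => /(_ wr).
rewrite addrK /even_diff/= -(mulrA K) -expr2 => h.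
rewrite (_ : _ / 2 - _ = - ((f x - f (x + w) - (f (x - w) - f x)) / 2)); last by field.
rewrite normrN normrM [`|2^-1|]gtr0_norm// ler_pdivrMr// (le_trans h)//.
by rewrite ler_peMr ?ler1n// (le_trans _ h).
Qed.

(** Half the difference of the mixed second differences with increments [h, w] and [h, - w]. *)
Lemma odd_diff_lip f : tame2 r f -> exists2 K : R, 0 <= K &
  forall x h w, enorm h <= r -> enorm w <= r ->
    `|odd_diff f (x + h, w) - odd_diff f (x, w)| <= K * enorm h * enorm w * weight x.
Proof.
move=> [_ [K K0 fK]]; exists K => // x h w hr wr.
have h1 := fK x h w hr wr; have := fK x h (- w) hr; rewrite enormN => /(_ wr) h2.
rewrite /odd_diff/= (_ : _ / 2 - _ / 2 =
  ((f (x + h + w) - f (x + h) - (f (x + w) - f x)) -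
   (f (x + h - w) - f (x + h) - (f (x - w) - f x))) / 2); last by ring.
rewrite normrM [`|2^-1|]gtr0_norm// ler_pdivrMr// (le_trans (ler_normB _ _))//.
by rewrite mulrDr mulr1 lerD.
Qed.

Lemma cosFT_sinFT_linear (a b : R) f g (c : T -> R) : measurable_fun setT c ->
  (forall x, `|c x| <= 1) ->
  leb.-integrable setT (EFin \o f) -> leb.-integrable setT (EFin \o g) ->
  \int[leb]_x (c x * (a * f x + b * g x)) =
  a * \int[leb]_x (c x * f x) + b * \int[leb]_x (c x * g x).
Proof.
move=> mc c1 fi gi.
have ci h : leb.-integrable setT (EFin \o h) ->
    leb.-integrable setT (EFin \o (fun x => c x * h x)).
  move=> hi; apply: (integrable_dom _ (integrable_norm hi)).
    by apply: measurable_funM => //; exact: integrable_measurable hi.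
  by move=> y; rewrite normrM ler_piMl.
have {}fi := ci _ fi; have {}gi := ci _ gi.
rewrite -!RintegralZl// -RintegralD//; [|exact: integrable_scale..].
by apply: eq_Rintegral => x _; ring.
Qed.

End symmetric_differences.

(** * Odd and even operators as Fourier multipliers *)

Section odd_even_operators.
Context (R : realType) (n : nat) (r : R).
Local Notation T := 'cV[R]_n.
Local Notation leb := (lebesgue_cV R n).
Implicit Types (f : T -> R) (x w nu : T).
Variable kap : T -> R.
Hypothesis mkap : measurable_fun setT kap.
Hypothesis kap_supp : forall w, kap w != 0 -> enorm w <= r.

Definition odd_op f x := kernel_op kap (odd_diff f) x.
Definition even_op f x := kernel_op kap (even_diff f) x.
Definition sin_moment nu : R := \int[leb]_w (kap w * sin (dot nu w)).
Definition cos_moment nu : R := \int[leb]_w (kap w * (cos (dot nu w) - 1)).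

Lemma abs_sin_le (a : R) : `|sin a| <= `|a|.
Proof.
have d (s : R) : is_derive s 1 (@sin R) (cos s) by exact: is_derive_sin.
have cs : continuous (@sin R) by exact: continuous_sin.
have [a0|a0] := leP 0 a.
  have [|c _] := MVT_segment a0 (fun s _ => d s); first exact: continuous_subspaceT.
  by rewrite sin0 !subr0 => ->; rewrite normrM ler_piMl// cos_max.
have [|c _] := MVT_segment (ltW a0) (fun s _ => d s); first exact: continuous_subspaceT.
rewrite sin0 !sub0r -normrN => ->.
by rewrite normrM normrN ler_piMl// cos_max.
Qed.

(** Half-angle formula: 1 - cos a = 2 sin^2 (a / 2). *)
Lemma abs_cos1_le (a : R) : `|cos a - 1| <= a ^+ 2.
Proof.
have := cosD (a / 2) (a / 2); rewrite -splitr => ->.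
have := cos2Dsin2 (a / 2); have := abs_sin_le (a / 2).
move: (cos _) (sin _) => c s sa cs.
have s2 : s ^+ 2 <= (a / 2) ^+ 2.
  by rewrite -[s ^+ 2]real_normK ?num_real// -[leRHS]real_normK ?num_real// lerXn2r// nnegrE.
have cc : c * c = 1 - s ^+ 2 by rewrite -cs; ring.
rewrite cc (_ : 1 - s ^+ 2 - s * s - 1 = - (2 * s ^+ 2)); last by ring.
rewrite normrN ger0_norm; last by rewrite mulr_ge0// sqr_ge0.
have := sqr_ge0 a; rewrite exprMn in s2; lra.
Qed.

Section odd.
Hypothesis ikap : leb.-integrable setT (EFin \o (fun w => `|kap w| * enorm w)).

Let odd_diff_bound f : tame1 r f -> exists2 K : R, 0 <= K &
  forall x w, kap w != 0 -> `|odd_diff f (x, w)| <= K * enorm w * weight x.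
Proof.
by move=> /odd_diff_le[K K0 fK]; exists K => // x w /kap_supp; exact: fK.
Qed.

Lemma odd_op_regular f : tame1 r f ->
  [/\ measurable_fun setT (odd_op f), seq_continuous (odd_op f) & decaying (odd_op f)].
Proof.
move=> tf; have [K K0 fK] := odd_diff_bound tf; have [mf cf _ _] := tf.
have mD := measurable_odd_diff mf.
split.
- exact: (measurable_kernel_op mkap ikap mD fK).
- apply: (seq_continuous_kernel_op mkap _ ikap mD K0 fK) => w; last first.
    exact: seq_continuous_odd_diff.
  exact: enorm_ge0.
- by apply: (decaying_kernel_op mkap _ ikap mD K0 fK) => w; exact: enorm_ge0.
Qed.

(** One increment of the second difference compensates the kernel, the other survives as a Lipschitz
    bound. Hence a second odd operator can be applied to the result. *)
Lemma odd_op_tame f : tame2 r f -> tame1 r (odd_op f).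
Proof.
move=> tf; have [tf1 _] := tf; have [mO cO dO] := odd_op_regular tf1.
split => //.
have [K K0 fK] := odd_diff_lip tf.
have [K1 K10 fK1] := odd_diff_bound tf1; have [mf _ _ _] := tf1.
have mD := measurable_odd_diff mf.
have isec x := integrable_kernel_section mkap ikap mD fK1 x.
exists (K * \int[leb]_w (`|kap w| * enorm w)).
  rewrite mulr_ge0//; apply: Rintegral_ge0 => w _.
  by rewrite mulr_ge0// enorm_ge0.
move=> x h hr; rewrite /odd_op /kernel_op -RintegralB//.
have isub := integrable_sub (isec (x + h)) (isec x).
rewrite (le_trans (le_normr_Rintegral _ isub))//.
rewrite (_ : K * _ * _ * _ = (K * enorm h * weight x) * \int[leb]_w (`|kap w| * enorm w)); last by ring.
rewrite -RintegralZl//; apply: le_Rintegral => //.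
- exact: (integrable_norm isub).
- exact: integrable_scale.
- move=> w _; rewrite -mulrBr normrM; have [->|k0] := eqVneq (kap w) 0.
    by rewrite normr0 !mul0r mulr0.
  rewrite mulrCA ler_wpM2l// (le_trans (fK x h w hr (kap_supp k0)))//.
  by rewrite mulrAC.
Qed.

Lemma integrable_sin_moment nu :
  leb.-integrable setT (EFin \o (fun w => kap w * sin (dot nu w))).
Proof.
apply: (integrable_dom (g := fun w => (n%:R * (weight nu)^-1) * (`|kap w| * enorm w))).
- by apply: measurable_funM => //; exact: measurable_sin_dot.
- exact: integrable_scale.
- move=> w; rewrite normrM mulrCA ler_wpM2l// (le_trans (abs_sin_le _))//.
  by rewrite weightV dot_le.
Qed.

Lemma sin_moment_le : exists2 C : R, 0 <= C &
  forall nu, `|sin_moment nu| <= C * (weight nu)^-1.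
Proof.
exists (n%:R * \int[leb]_w (`|kap w| * enorm w)).
  by rewrite mulr_ge0//; apply: Rintegral_ge0 => w _; rewrite mulr_ge0// enorm_ge0.
move=> nu; rewrite (le_trans (le_normr_Rintegral _ (integrable_sin_moment nu)))//.
rewrite mulrAC -RintegralZl//; apply: le_Rintegral => //.
- exact: (integrable_norm (integrable_sin_moment nu)).
- exact: integrable_scale.
- move=> w _; rewrite normrM mulrCA ler_wpM2l// (le_trans (abs_sin_le _))//.
  by rewrite weightV dot_le.
Qed.

(** Translations by [w] and [- w] cancel in the terms with [cos (dot nu w)] and add up in those with
    [sin (dot nu w)]. This is the real part of multiplication by [i * sin_moment nu]; [sinFT_odd_op]
    is the imaginary one. *)
Lemma cosFT_odd_op f nu : tame1 r f ->
  cosFT (odd_op f) nu = sin_moment nu * sinFT f nu.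
Proof.
move=> tf; have [K K0 fK] := odd_diff_bound tf; have [mf _ df _] := tf.
have fi := decaying_integrable mf df.
have mc : measurable_fun setT (fun x : T => cos (dot nu x)).
  exact: measurable_cos_dot.
have mD := measurable_odd_diff mf.
rewrite /cosFT (Rintegral_kernel_op mkap ikap mD fK)//; last first.
  by move=> x; exact: cos_max.
rewrite /sin_moment -(RintegralZr _ measurableT (integrable_sin_moment nu)).
apply: eq_Rintegral => w _; rewrite -mulrA; congr (_ * _).
rewrite (_ : (fun x => _) = (fun x => cos (dot nu x) *
    (2^-1 * f (x + w) + (- 2^-1) * f (x - w)))); last first.
  by apply/funext => x; rewrite /odd_diff/=; ring.
rewrite cosFT_sinFT_linear//; first last.
- exact: integrable_translate.
- exact: integrable_translate.
- by move=> x; exact: cos_max.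
rewrite -!/(cosFT _ nu).
have -> := cosFT_translate w nu fi; have -> := cosFT_translate (- w) nu fi.
by rewrite dotNr cosN sinN; field.
Qed.

Lemma sinFT_odd_op f nu : tame1 r f ->
  sinFT (odd_op f) nu = - (sin_moment nu * cosFT f nu).
Proof.
move=> tf; have [K K0 fK] := odd_diff_bound tf; have [mf _ df _] := tf.
have fi := decaying_integrable mf df.
have mc : measurable_fun setT (fun x : T => sin (dot nu x)).
  exact: measurable_sin_dot.
have mD := measurable_odd_diff mf.
rewrite /sinFT (Rintegral_kernel_op mkap ikap mD fK)//; last first.
  by move=> x; exact: sin_max.
rewrite /sin_moment -mulrN -RintegralZr//; last exact: integrable_sin_moment.
apply: eq_Rintegral => w _; rewrite -mulrA; congr (_ * _).
rewrite (_ : (fun x => _) = (fun x => sin (dot nu x) *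
    (2^-1 * f (x + w) + (- 2^-1) * f (x - w)))); last first.
  by apply/funext => x; rewrite /odd_diff/=; ring.
rewrite cosFT_sinFT_linear//; first last.
- exact: integrable_translate.
- exact: integrable_translate.
- by move=> x; exact: sin_max.
rewrite -!/(sinFT _ nu).
have -> := sinFT_translate w nu fi; have -> := sinFT_translate (- w) nu fi.
by rewrite dotNr cosN sinN; field.
Qed.

End odd.

Section even.
Hypothesis ikap : leb.-integrable setT (EFin \o (fun w => `|kap w| * enorm w ^+ 2)).

Let even_diff_bound f : tame2 r f -> exists2 K : R, 0 <= K &
  forall x w, kap w != 0 -> `|even_diff f (x, w)| <= K * enorm w ^+ 2 * weight x.
Proof.
by move=> /even_diff_le[K K0 fK]; exists K => // x w /kap_supp; exact: fK.
Qed.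

Lemma even_op_regular f : tame2 r f ->
  [/\ measurable_fun setT (even_op f), seq_continuous (even_op f) & decaying (even_op f)].
Proof.
move=> tf; have [K K0 fK] := even_diff_bound tf; have [[mf cf _ _] _] := tf.
have mD := measurable_even_diff mf.
split.
- exact: (measurable_kernel_op mkap ikap mD fK).
- apply: (seq_continuous_kernel_op mkap _ ikap mD K0 fK) => w; last first.
    exact: seq_continuous_even_diff.
  exact: sqr_ge0.
- by apply: (decaying_kernel_op mkap _ ikap mD K0 fK) => w; exact: sqr_ge0.
Qed.

Let cos1_dot_le nu w : `|cos (dot nu w) - 1| <= (n%:R * (weight nu)^-1) ^+ 2 * enorm w ^+ 2.
Proof.
rewrite (le_trans (abs_cos1_le _))// -exprMn -real_normK ?num_real//.
rewrite lerXn2r ?nnegrE ?mulr_ge0 ?invr_ge0 ?enorm_ge0 ?(ltW (weight_gt0 _))//.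
by rewrite weightV dot_le.
Qed.

Lemma integrable_cos_moment nu :
  leb.-integrable setT (EFin \o (fun w => kap w * (cos (dot nu w) - 1))).
Proof.
apply: (integrable_dom (g := fun w => (n%:R * (weight nu)^-1) ^+ 2 * (`|kap w| * enorm w ^+ 2))).
- apply: measurable_funM => //; apply: measurable_funB => //.
  exact: measurable_cos_dot.
- exact: integrable_scale.
- by move=> w; rewrite normrM mulrCA ler_wpM2l.
Qed.

Lemma cos_moment_le : exists2 C : R, 0 <= C &
  forall nu, `|cos_moment nu| <= C * (weight nu) ^- 2.
Proof.
exists (n%:R ^+ 2 * \int[leb]_w (`|kap w| * enorm w ^+ 2)).
  by rewrite mulr_ge0 ?sqr_ge0//; apply: Rintegral_ge0 => w _; rewrite mulr_ge0// sqr_ge0.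
move=> nu; rewrite (le_trans (le_normr_Rintegral _ (integrable_cos_moment nu)))//.
rewrite mulrAC -exprVn -exprMn -RintegralZl//; apply: le_Rintegral => //.
- exact: (integrable_norm (integrable_cos_moment nu)).
- exact: integrable_scale.
- by move=> w _; rewrite normrM mulrCA ler_wpM2l.
Qed.

Let FT_even_diff (c : T -> R) f w : measurable_fun setT c ->
  (forall x, `|c x| <= 1) -> leb.-integrable setT (EFin \o f) ->
  \int[leb]_x (c x * even_diff f (x, w)) =
  2^-1 * \int[leb]_x (c x * f (x + w)) + 2^-1 * \int[leb]_x (c x * f (x - w))
  - \int[leb]_x (c x * f x).
Proof.
move=> mc c1 fi.
have i1 := integrable_translate w fi; have i2 := integrable_translate (- w) fi.
rewrite -cosFT_sinFT_linear//.
have i3 : leb.-integrable setT (EFin \o (fun x => 2^-1 * f (x + w) + 2^-1 * f (x - w))).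
  by apply: integrable_add; exact: integrable_scale.
have := cosFT_sinFT_linear 1 (- 1) mc c1 i3 fi.
rewrite mul1r mulN1r => <-; apply: eq_Rintegral => x _.
rewrite /even_diff/=; ring.
Qed.

(** Here the sine terms of the two translations cancel, so the multiplier is real and does not mix
    the two transforms. *)
Lemma cosFT_even_op f nu : tame2 r f ->
  cosFT (even_op f) nu = cos_moment nu * cosFT f nu.
Proof.
move=> tf; have [K K0 fK] := even_diff_bound tf; have [[mf _ df _] _] := tf.
have fi := decaying_integrable mf df.
have mc : measurable_fun setT (fun x : T => cos (dot nu x)).
  exact: measurable_cos_dot.
have mD := measurable_even_diff mf.
rewrite {1}/cosFT (Rintegral_kernel_op mkap ikap mD fK)//; last first.
  by move=> x; exact: cos_max.
rewrite /cos_moment -(RintegralZr _ measurableT (integrable_cos_moment nu)).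
apply: eq_Rintegral => w _; rewrite -mulrA; congr (_ * _).
rewrite FT_even_diff//; last by move=> x; exact: cos_max.
have := cosFT_translate w nu fi; have := cosFT_translate (- w) nu fi.
rewrite dotNr cosN sinN {1 3}/cosFT => -> ->.
by rewrite -/(cosFT f nu); field.
Qed.

Lemma sinFT_even_op f nu : tame2 r f ->
  sinFT (even_op f) nu = cos_moment nu * sinFT f nu.
Proof.
move=> tf; have [K K0 fK] := even_diff_bound tf; have [[mf _ df _] _] := tf.
have fi := decaying_integrable mf df.
have mc : measurable_fun setT (fun x : T => sin (dot nu x)).
  exact: measurable_sin_dot.
have mD := measurable_even_diff mf.
rewrite {1}/sinFT (Rintegral_kernel_op mkap ikap mD fK)//; last first.
  by move=> x; exact: sin_max.
rewrite /cos_moment -(RintegralZr _ measurableT (integrable_cos_moment nu)).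
apply: eq_Rintegral => w _; rewrite -mulrA; congr (_ * _).
rewrite FT_even_diff//; last by move=> x; exact: sin_max.
have := sinFT_translate w nu fi; have := sinFT_translate (- w) nu fi.
rewrite dotNr cosN sinN {1 3}/sinFT => -> ->.
by rewrite -/(sinFT f nu); field.
Qed.

End even.
End odd_even_operators.

(** * Principal values as symmetrized integrals *)

Section principal_value.
Context (R : realType) (n : nat) (r : R).
Hypothesis r_gt0 : 0 < r.
Local Notation T := 'cV[R]_n.
Local Notation leb := (lebesgue_cV R n).
Implicit Types (f g : T -> R) (x w y : T).

(** Existence and value in one relation, so that finite linear combinations carry both along. *)
Definition pv_is x g (l : R) : Prop :=
  (forall e, 0 < e < r -> leb.-integrable (eannulus x e r) (EFin \o g)) /\
  (\int[leb]_(y in eannulus x e r) g y) @[e --> 0^'+] --> l.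

Lemma pv_isE x g l : pv_is x g l -> pv x r g = l.
Proof. by move=> [_ gl]; exact: cvg_lim. Qed.

Lemma pv_is_exists x g l : pv_is x g l -> pv_exists x r g.
Proof. by move=> [gi gl]; split => //; apply/cvg_ex; exists l. Qed.

Let near_radius : \forall e \near 0^'+, 0 < e < r.
Proof.
near=> e; apply/andP; split; near: e; first exact: nbhs_right_gt.
exact: nbhs_right_lt.
Unshelve. all: by end_near. Qed.

Lemma pv_is_lin x f g a b (c : R) : pv_is x f a -> pv_is x g b ->
  pv_is x (fun y => c * f y + g y) (c * a + b).
Proof.
move=> [fi fa] [gi gb]; have mA e := measurable_eannulus x e r.
have cfi e : 0 < e < r -> leb.-integrable (eannulus x e r) (EFin \o (fun y => c * f y)).
  by move=> er; exact: (integrableZl (mA e) c (fi e er)).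
split=> [e er|]; first exact: (integrableD (mA e) (cfi e er) (gi e er)).
have h : c * (\int[leb]_(y in eannulus x e r) f y) + \int[leb]_(y in eannulus x e r) g y
    @[e --> 0^'+] --> c * a + b.
  by apply: cvgD => //; apply: cvgM => //; exact: cvg_cst.
apply: cvg_trans h; apply: near_eq_cvg.
apply: filterS near_radius => e er.
rewrite RintegralD ?RintegralZl//.
- exact: fi.
- exact: cfi.
- exact: gi.
Qed.

Lemma pv_is0 x : pv_is x (fun=> 0) 0.
Proof.
split=> [e _|]; first exact: integrable0.
rewrite (_ : (fun e => _) = cst 0); first exact: cvg_cst.
apply/funext => e; rewrite Rintegral_cst ?mul0r//.
exact: measurable_eannulus.
Qed.

Lemma pv_is_sum x (I : Type) (s : seq I) (g : I -> T -> R) (l : I -> R) :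
  (forall i, pv_is x (g i) (l i)) ->
  pv_is x (fun y => \sum_(i <- s) g i y) (\sum_(i <- s) l i).
Proof.
move=> gl; elim: s => [|i s ih].
  rewrite big_nil; under eq_fun do rewrite big_nil; exact: pv_is0.
rewrite big_cons; under eq_fun do rewrite big_cons.
have := pv_is_lin 1 (gl i) ih.
by rewrite mul1r; under eq_fun do rewrite mul1r.
Qed.

Lemma pv_is_scale x g l (c : R) : pv_is x g l -> pv_is x (fun y => c * g y) (c * l).
Proof.
move=> gl; have := pv_is_lin c gl (pv_is0 x).
by rewrite addr0; under eq_fun do rewrite addr0.
Qed.

Definition ball_kernel (k0 : T -> R) w : R := \1_(eball 0 r) w * k0 w.

(* s = -1 for an odd kernel, s = 1 for an even one. *)
Section symmetrization.
Variables (k0 F rho : T -> R) (s K : R) (x : T).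
Hypotheses (mk0 : measurable_fun setT k0) (k00 : k0 0 = 0).
Hypotheses (k0N : forall w, k0 (- w) = s * k0 w).
Hypotheses (mF : measurable_fun setT F) (FK : forall y, `|F y| <= K).
Hypothesis irho : leb.-integrable setT (EFin \o rho).
Hypothesis ik : forall e, 0 < e < r ->
  leb.-integrable setT (EFin \o (fun w => \1_(eannulus 0 e r) w * k0 w)).

Let P w := (F (x + w) + s * F (x - w)) / 2.
Hypothesis Prho : forall w, `|ball_kernel k0 w * P w| <= rho w.

Let kA e w := \1_(eannulus 0 e r) w * k0 w.

Let mkA e : measurable_fun setT (kA e).
Proof.
apply: measurable_funM => //; apply: measurable_indic.
exact: measurable_eannulus.
Qed.

Let annulusE e y : (fun y => k0 (y - x) * F y) \_ (eannulus x e r) y = kA e (y - x) * F y.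
Proof.
rewrite patchE /kA indicE.
have -> : (y \in eannulus x e r) = (y - x \in eannulus 0 e r).
  by apply/idP/idP => /set_mem h; apply/mem_set; move: h; rewrite /eannulus/= subr0.
by case: ifPn => _; rewrite ?mul1r// !mul0r.
Qed.

Let kAF_integrable e : 0 < e < r ->
  leb.-integrable setT (EFin \o (fun y => kA e (y - x) * F y)).
Proof.
move=> er; have := integrable_translate (- x) (ik er) => i1.
apply: (integrable_dom _ (integrable_scale K (integrable_norm i1))).
  by apply: measurable_funM => //; exact: measurable_translate.
move=> y; rewrite normrM mulrC ler_wpM2r//.
Qed.

(** On an annulus the integrand is integrable, so half of the integral may be reflected by [w] to
    [- w]. The parity of [k0] then sets both values of [F] against the same kernel. *)
Let annulus_integral e : 0 < e < r ->
  \int[leb]_(y in eannulus x e r) (k0 (y - x) * F y) = \int[leb]_w (kA e w * P w).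
Proof.
move=> er; rewrite Rintegral_mkcond; under eq_Rintegral do rewrite annulusE.
have i1 := kAF_integrable er.
rewrite -(Rintegral_translate x i1).
under eq_Rintegral do rewrite addrK.
have i2 : leb.-integrable setT (EFin \o (fun w => kA e w * F (w + x))).
  by have := integrable_translate x i1; under eq_fun do rewrite addrK.
have kAN w : kA e (- w) = s * kA e w.
  rewrite /kA k0N mulrCA !indicE; congr (_ * (_%:R * _)).
  congr nat_of_bool; apply/idP/idP => /set_mem h; apply/mem_set; move: h;
    by rewrite /eannulus/= !subr0 enormN.
have N0 : - 1 != 0 :> R by rewrite oppr_eq0 oner_eq0.
have refl : \int[leb]_w (kA e (- w) * F (- w + x)) = \int[leb]_w (kA e w * F (w + x)).
  have := Rintegral_cV_affine (0 : T) N0 i2.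
  rewrite normrN1 expr1n invr1 mul1r => <-.
  by apply: eq_Rintegral => w _; rewrite scaleN1r addr0.
have i3 : leb.-integrable setT (EFin \o (fun w => kA e (- w) * F (- w + x))).
  have := integrable_cV_affine (0 : T) N0 i2.
  by under eq_fun do rewrite scaleN1r addr0.
transitivity (2^-1 * \int[leb]_w (kA e w * F (w + x)) +
              2^-1 * \int[leb]_w (kA e (- w) * F (- w + x))).
  by rewrite refl; field.
rewrite -!RintegralZl// -RintegralD//; [|exact: integrable_scale..].
apply: eq_Rintegral => w _; rewrite kAN /P [w + x]addrC [- w + x]addrC.
by field.
Qed.

(** After symmetrization [rho] dominates all truncations at once, and dominated convergence along
    sequences of radii replaces the annuli by the ball. *)
Lemma pv_is_symmetrized :
  pv_is x (fun y => k0 (y - x) * F y) (\int[leb]_w (ball_kernel k0 w * P w)).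
Proof.
split=> [e er|].
  apply/(integrable_mkcond _ (measurable_eannulus _ _ _)).
  apply: eq_integrable (kAF_integrable er) => // y _ /=.
  by rewrite -annulusE restrict_EFin.
apply/cvg_at_rightP => u [u0 ucvg].
have mP : measurable_fun setT P.
  apply: measurable_funM => //; apply: measurable_funD.
    by apply: (measurableT_comp mF); exact: measurable_cV_add.
  apply: measurable_funM => //.
  by apply: (measurableT_comp mF); exact: measurable_cV_sub.
have h : \int[leb]_w (kA (u k) w * P w) @[k --> \oo] -->
    \int[leb]_w (ball_kernel k0 w * P w).
  apply: (Rintegral_cvg (g := rho)) => //.
  - by move=> k; apply: measurable_funM.
  - move=> k w; apply: le_trans (Prho w); rewrite !normrM ler_wpM2r//.
    rewrite ler_wpM2r// !indicE.
    have [/set_mem h|_] := boolP (w \in eannulus 0 (u k) r); last by rewrite normr0.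
    by rewrite mem_set//; move: h; rewrite /eannulus /eball/= => /andP[].
  (* The annuli exhaust only the punctured ball; at the origin the kernel vanishes by [k00].
     Elsewhere the truncations are constant once [u k < enorm w]. *)
  - move=> w; have [->|wn0] := eqVneq w 0.
      rewrite /ball_kernel /kA k00 mulr0 mul0r.
      by under eq_fun do rewrite mulr0 mul0r; exact: cvg_cst.
    have w0 : 0 < enorm w by rewrite lt_neqAle enorm_ge0 eq_sym enorm_eq0 wn0.
    apply: cvg_near_cst; have /cvgrPdist_lt/(_ _ w0) := ucvg.
    apply: filterS => k; rewrite sub0r normrN gtr0_norm ?u0// => uw.
    rewrite /kA /ball_kernel; congr (_ * _ * _); rewrite !indicE; congr (_%:R); congr nat_of_bool.
    apply/idP/idP => /set_mem; rewrite /eannulus /eball/= subr0 => h; apply/mem_set => /=.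
      by rewrite subr0; case/andP: h.
    by rewrite subr0 uw.
apply: cvg_trans h; apply: near_eq_cvg.
(* The reflected form of the integral is available only for radii below [r], hence eventually. *)
have /cvgrPdist_lt/(_ _ r_gt0) := ucvg.
apply: filterS => k; rewrite sub0r normrN gtr0_norm ?u0// => ur.
by rewrite annulus_integral// u0.
Qed.

End symmetrization.
End principal_value.

(** * The peridynamic operator *)

Section peridynamic_kernels.
Context (R : realType) (n : nat) (delta beta : R).
Hypotheses (n_gt0 : (0 < n)%N) (delta_gt0 : 0 < delta) (beta_lt : beta < n%:R + 2).
Local Notation T := 'cV[R]_n.
Local Notation leb := (lebesgue_cV R n).
Implicit Types (f : T -> R) (x w y : T) (i j : 'I_n).

Definition state_kernel i w : R := (enorm w `^ beta)^-1 * w i ord0.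
Definition bond_kernel i j w : R := (enorm w `^ (beta + 2))^-1 * (w i ord0 * w j ord0).
Local Notation KS i := (ball_kernel delta (state_kernel i)).
Local Notation KB i j := (ball_kernel delta (bond_kernel i j)).

Let measurable_enorm_powN (a : R) : measurable_fun setT (fun w : T => (enorm w `^ a)^-1).
Proof.
under eq_fun do rewrite -powRN.
apply: (measurableT_comp (@measurable_powR R (- a))).
exact: (measurable_enorm (@measurable_id _ T setT)).
Qed.

Lemma measurable_state_kernel i : measurable_fun setT (state_kernel i).
Proof. by apply: measurable_funM => //; exact: measurable_coord. Qed.

Lemma measurable_bond_kernel i j : measurable_fun setT (bond_kernel i j).
Proof.
by apply: measurable_funM => //; apply: measurable_funM; exact: measurable_coord.
Qed.

Lemma measurable_ball_kernel (k : T -> R) : measurable_fun setT k ->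
  measurable_fun setT (ball_kernel delta k).
Proof.
move=> mk; apply: measurable_funM => //; apply: measurable_indic.
exact: measurable_eball.
Qed.

Lemma ball_kernel_supp (k : T -> R) w : ball_kernel delta k w != 0 -> enorm w <= delta.
Proof.
rewrite /ball_kernel indicE; case: (boolP (w \in _)) => [/set_mem|_]; last first.
  by rewrite mul0r eqxx.
by rewrite /eball/= subr0 => /ltW.
Qed.

Lemma state_kernel0 i : state_kernel i 0 = 0.
Proof. by rewrite /state_kernel mxE mulr0. Qed.

Lemma bond_kernel0 i j : bond_kernel i j 0 = 0.
Proof. by rewrite /bond_kernel mxE mul0r mulr0. Qed.

Lemma state_kernelN i w : state_kernel i (- w) = - 1 * state_kernel i w.
Proof. by rewrite /state_kernel enormN mxE mulrN mulN1r. Qed.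

Lemma bond_kernelN i j w : bond_kernel i j (- w) = 1 * bond_kernel i j w.
Proof. by rewrite /bond_kernel enormN !mxE mulrNN mul1r. Qed.

Let riesz_dom (k g : T -> R) : measurable_fun setT k -> measurable_fun setT g ->
  (forall w, 0 <= g w) ->
  (forall w, `|k w| * g w <= enorm w ^+ 2 / enorm w `^ beta) ->
  leb.-integrable setT (EFin \o (fun w => `|ball_kernel delta k w| * g w)).
Proof.
move=> mk mg g0 kg.
apply: (integrable_dom _ (integrable_riesz n_gt0 delta_gt0 beta_lt)).
  apply: measurable_funM => //; apply: measurableT_comp => //.
  exact: measurable_ball_kernel.
move=> w; rewrite normrM normr_id (ger0_norm (g0 w)) /ball_kernel /riesz normrM.
by rewrite -mulrA normr_nat; apply: ler_wpM2l.
Qed.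

Let menorm : measurable_fun setT (@enorm R n).
Proof. exact: (measurable_enorm (@measurable_id _ T setT)). Qed.

Lemma integrable_state_kernel i :
  leb.-integrable setT (EFin \o (fun w => `|KS i w| * enorm w)).
Proof.
apply: riesz_dom => //; first exact: measurable_state_kernel.
  by move=> w; exact: enorm_ge0.
move=> w; rewrite /state_kernel normrM ger0_norm ?invr_ge0 ?powR_ge0//.
rewrite -mulrA mulrC ler_wpM2r ?invr_ge0 ?powR_ge0// expr2.
by rewrite ler_wpM2r ?enorm_ge0// coord_le_enorm.
Qed.

Lemma integrable_bond_kernel i j :
  leb.-integrable setT (EFin \o (fun w => `|KB i j w| * enorm w ^+ 2)).
Proof.
apply: riesz_dom => //; first exact: measurable_bond_kernel.
- exact: measurable_funX.
- by move=> w; exact: sqr_ge0.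
move=> w; have [->|w0] := eqVneq w 0.
  by rewrite bond_kernel0 enorm0 expr0n/= mulr0 mul0r.
have e0 : enorm w != 0 by rewrite enorm_eq0.
rewrite /bond_kernel normrM ger0_norm ?invr_ge0 ?powR_ge0//.
have p0 : enorm w `^ beta != 0 by rewrite powR_eq0 negb_and e0.
rewrite powRD ?e0 ?implybT// (powR_mulrn 2) ?enorm_ge0//.
rewrite [leLHS](_ : _ = `|w i ord0 * w j ord0| / enorm w `^ beta); last first.
  by field; rewrite e0 p0.
rewrite ler_wpM2r ?invr_ge0 ?powR_ge0// normrM expr2.
by rewrite ler_pM ?coord_le_enorm.
Qed.

(** On the annulus [enorm w] is at least [e], so the factor [enorm w ^+ m] that tames the
    singularity costs only [e ^- m]. *)
Let annulus_dom (k : T -> R) (m : nat) e : measurable_fun setT k -> 0 < e < delta ->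
  leb.-integrable setT (EFin \o (fun w => `|ball_kernel delta k w| * enorm w ^+ m)) ->
  leb.-integrable setT (EFin \o (fun w => \1_(eannulus 0 e delta) w * k w)).
Proof.
move=> mk /andP[e0 ed] ik.
apply: (integrable_dom (g := fun w => e ^- m * (`|ball_kernel delta k w| * enorm w ^+ m))).
- apply: measurable_funM => //; apply: measurable_indic.
  exact: measurable_eannulus.
- exact: integrable_scale.
- move=> w; rewrite indicE; case: (boolP (w \in _)) => [/set_mem|_]; last first.
    by rewrite mul0r normr0 !mulr_ge0 ?invr_ge0 ?exprn_ge0 ?enorm_ge0// ltW.
  rewrite /eannulus/= subr0 => /andP[ew wd].
  rewrite /ball_kernel indicE mem_set /eball/= ?subr0// !mul1r ler_pdivlMl ?exprn_gt0//.
  by rewrite mulrC ler_wpM2l// lerXn2r ?nnegrE ?enorm_ge0 ?ltW.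
Qed.

Let decaying_bounded f : decaying f -> exists K : R, forall y, `|f y| <= K.
Proof.
move=> [K K0 fK]; exists K => y; rewrite (le_trans (fK y))//.
by rewrite ler_piMr ?weight_le1.
Qed.

Lemma pv_state_kernel i f x : tame1 delta f ->
  pv_is delta x (fun y => state_kernel i (y - x) * f y) (odd_op (KS i) f x).
Proof.
move=> tf; have [mf _ /decaying_bounded[K fK] _] := tf.
have [K1 K10 fK1] := odd_diff_le tf.
have ik := integrable_state_kernel i.
have -> : odd_op (KS i) f x =
    \int[leb]_w (KS i w * ((f (x + w) + - 1 * f (x - w)) / 2)).
  by apply: eq_Rintegral => w _; rewrite /odd_diff/=; ring.
apply: (@pv_is_symmetrized _ _ _ delta_gt0 (state_kernel i) f
  (fun w => K1 * weight x * (`|KS i w| * enorm w)) (- 1) K) => //.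
- exact: measurable_state_kernel.
- exact: state_kernel0.
- exact: state_kernelN.
- exact: integrable_scale.
- move=> e ed; apply: (@annulus_dom _ 1) => //; exact: measurable_state_kernel.
- move=> w; rewrite normrM mulrCA; have [->|k0] := eqVneq (KS i w) 0.
    by rewrite normr0 !mul0r.
  rewrite ler_wpM2l// mulN1r mulrAC.
  exact: fK1 (ball_kernel_supp k0).
Qed.

(** Symmetrizing the increment [f y - f x] about [x] yields [even_diff f], whose quadratic smallness
    is what the bond kernel needs. *)
Lemma pv_bond_kernel i j f x : tame2 delta f ->
  pv_is delta x (fun y => bond_kernel i j (y - x) * (f y - f x)) (even_op (KB i j) f x).
Proof.
move=> tf; have [[mf _ /decaying_bounded[K fK] _] _] := tf.
have [K1 K10 fK1] := even_diff_le tf.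
have ik := integrable_bond_kernel i j.
have -> : even_op (KB i j) f x =
    \int[leb]_w (KB i j w * ((f (x + w) - f x + 1 * (f (x - w) - f x)) / 2)).
  by apply: eq_Rintegral => w _; rewrite /even_diff/=; field.
apply: (@pv_is_symmetrized _ _ _ delta_gt0 (bond_kernel i j) (fun y => f y - f x)
  (fun w => K1 * weight x * (`|KB i j w| * enorm w ^+ 2)) 1 (K + K)) => //.
- exact: measurable_bond_kernel.
- exact: bond_kernel0.
- exact: bond_kernelN.
- exact: measurable_funB.
- by move=> y; rewrite (le_trans (ler_normB _ _))// lerD.
- exact: integrable_scale.
- move=> e ed; apply: (@annulus_dom _ 2) => //; exact: measurable_bond_kernel.
- move=> w; rewrite normrM mulrCA; have [->|k0] := eqVneq (KB i j w) 0.
    by rewrite normr0 !mul0r.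
  rewrite ler_wpM2l// mul1r mulrAC.
  rewrite (_ : (_ + _) / 2 = even_diff f (x, w)); last by rewrite /even_diff/=; field.
  exact: fK1 (ball_kernel_supp k0).
Qed.

End peridynamic_kernels.

(** * Measurability and linearity of the transforms *)

Section fourier_tools.
Context (R : realType) (n : nat).
Local Notation T := 'cV[R]_n.
Local Notation leb := (lebesgue_cV R n).
Implicit Types (f g : T -> R) (x nu : T).

(** Measurability in the parameter comes from Fubini, which needs integrability in [nu] as well. The
    integrand is therefore multiplied by [weight nu], and the positive factor is divided out
    afterwards. *)
Let measurable_FT (c : T * T -> R) f : measurable_fun setT c ->
  (forall p, `|c p| <= 1) -> leb.-integrable setT (EFin \o f) ->
  measurable_fun setT (fun nu => \int[leb]_x (c (nu, x) * f x)).
Proof.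
move=> mc c1 fi; have mf := integrable_measurable fi.
pose F (p : T * T) := weight p.1 * (c p * f p.2).
have mF : measurable_fun setT F.
  apply: measurable_funM; first exact: (measurableT_comp (@measurable_weight R n)).
  by apply: measurable_funM => //; exact: measurableT_comp.
have FK nu x : `|F (nu, x)| <= weight nu * `|f x|.
  rewrite /F/= normrM (ger0_norm (ltW (weight_gt0 _))) ler_wpM2l ?(ltW (weight_gt0 _))//.
  by rewrite normrM ler_piMl.
have mI := integrable_measurable
  (integrable_Rintegral1 mF (integrable_weight R n) (integrable_norm fi) FK).
have E : (fun nu => \int[leb]_x (c (nu, x) * f x)) =
    (fun nu => (weight nu)^-1 * \int[leb]_x F (nu, x)).
  apply/funext => nu; rewrite /F /= RintegralZl; last 2 first.
  - exact: measurableT.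
  - apply: (integrable_dom _ (integrable_norm fi)).
      apply: measurable_funM => //; exact: (measurableT_comp mc (measurable_pair1 _)).
    by move=> x; rewrite normrM ler_piMl.
  by rewrite mulKf// gt_eqF// weight_gt0.
rewrite E; apply: measurable_funM => //.
under eq_fun do rewrite weightV; apply: measurable_prod => i _.
apply: (@measurableT_comp _ _ _ _ _ _ (@oneDsqr R)); last exact: measurable_coord.
by apply: continuous_measurable_fun; exact: continuous_oneDsqr.
Qed.

Lemma measurable_cosFT f : leb.-integrable setT (EFin \o f) ->
  measurable_fun setT (cosFT f).
Proof.
move=> fi; apply: (measurable_FT (c := fun p => cos (dot p.1 p.2))) => //.
  exact: measurable_cos_dot.
by move=> p; exact: cos_max.
Qed.

Lemma measurable_sinFT f : leb.-integrable setT (EFin \o f) ->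
  measurable_fun setT (sinFT f).
Proof.
move=> fi; apply: (measurable_FT (c := fun p => sin (dot p.1 p.2))) => //.
  exact: measurable_sin_dot.
by move=> p; exact: sin_max.
Qed.

Lemma decaying_add (c : R) f g : decaying f -> decaying g ->
  decaying (fun x => c * f x + g x).
Proof.
move=> [K K0 fK] [L L0 gL]; exists (`|c| * K + L).
  by rewrite addr_ge0// mulr_ge0.
move=> x; rewrite (le_trans (ler_normD _ _))// mulrDl lerD// normrM -mulrA.
by rewrite ler_wpM2l.
Qed.

(** What inversion asks of a function, apart from integrability of its transforms. *)
Definition regular f := [/\ measurable_fun setT f, seq_continuous f & decaying f].

Lemma tame1_regular r f : tame1 r f -> regular f.
Proof. by case. Qed.

Lemma regular_integrable f : regular f -> leb.-integrable setT (EFin \o f).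
Proof. by move=> [mf _ df]; exact: decaying_integrable. Qed.

Lemma regular_lin (c : R) f g : regular f -> regular g ->
  regular (fun x => c * f x + g x).
Proof.
move=> [mf cf df] [mg cg dg]; split.
- by apply: measurable_funD => //; apply: measurable_funM.
- move=> a l al; apply: cvgD; last exact: cg.
  by apply: cvgM; [exact: cvg_cst|exact: cf].
- exact: decaying_add.
Qed.

Lemma tame1_lin r (c : R) f g : tame1 r f -> tame1 r g -> tame1 r (fun x => c * f x + g x).
Proof.
move=> tf tg; have [_ _ _ [K K0 fK]] := tf; have [_ _ _ [L L0 gL]] := tg.
have [? ? ?] := regular_lin c (tame1_regular tf) (tame1_regular tg).
split => //; exists (`|c| * K + L); first by rewrite addr_ge0// mulr_ge0.
move=> x h hr.
rewrite (_ : _ - _ = c * (f (x + h) - f x) + (g (x + h) - g x)); last by ring.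
rewrite (le_trans (ler_normD _ _))// !mulrDl lerD ?gL// normrM -!mulrA.
by rewrite ler_wpM2l// mulrA fK.
Qed.

Lemma tame1_0 r : tame1 r ((fun=> 0) : T -> R).
Proof.
split; first exact: measurable_cst.
- by move=> a l _; exact: cvg_cst.
- by exists 0 => // x; rewrite normr0 mul0r.
- by exists 0 => // x h _; rewrite subrr normr0 !mul0r.
Qed.

Lemma tame1_sum r (I : Type) (s : seq I) (F : I -> T -> R) :
  (forall i, tame1 r (F i)) -> tame1 r (fun x => \sum_(i <- s) F i x).
Proof.
move=> tF; elim: s => [|i s ih].
  by under eq_fun do rewrite big_nil; exact: tame1_0.
under eq_fun do rewrite big_cons.
have := tame1_lin 1 (tF i) ih.
by under eq_fun do rewrite mul1r.
Qed.

Lemma regular_sum (I : Type) (s : seq I) (F : I -> T -> R) :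
  (forall i, regular (F i)) -> regular (fun x => \sum_(i <- s) F i x).
Proof.
move=> tF; elim: s => [|i s ih].
  by under eq_fun do rewrite big_nil; exact: (tame1_regular (tame1_0 0)).
under eq_fun do rewrite big_cons.
have := regular_lin 1 (tF i) ih.
by under eq_fun do rewrite mul1r.
Qed.

Lemma cosFT_lin (c : R) f g nu : regular f -> regular g ->
  cosFT (fun x => c * f x + g x) nu = c * cosFT f nu + cosFT g nu.
Proof.
move=> /regular_integrable fi /regular_integrable gi.
have mc : measurable_fun setT (fun x : T => cos (dot nu x)).
  exact: measurable_cos_dot.
have := cosFT_sinFT_linear c 1 mc (fun x => cos_max _) fi gi.
rewrite mul1r => <-; apply: eq_Rintegral => x _; ring.
Qed.

Lemma sinFT_lin (c : R) f g nu : regular f -> regular g ->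
  sinFT (fun x => c * f x + g x) nu = c * sinFT f nu + sinFT g nu.
Proof.
move=> /regular_integrable fi /regular_integrable gi.
have mc : measurable_fun setT (fun x : T => sin (dot nu x)).
  exact: measurable_sin_dot.
have := cosFT_sinFT_linear c 1 mc (fun x => sin_max _) fi gi.
rewrite mul1r => <-; apply: eq_Rintegral => x _; ring.
Qed.

Lemma cosFT_sum (I : Type) (s : seq I) (F : I -> T -> R) nu :
  (forall i, regular (F i)) ->
  cosFT (fun x => \sum_(i <- s) F i x) nu = \sum_(i <- s) cosFT (F i) nu.
Proof.
move=> rF; elim: s => [|i s ih].
  rewrite big_nil /cosFT; under eq_Rintegral do rewrite big_nil mulr0.
  by rewrite Rintegral_cst// mul0r.
rewrite big_cons -ih -[X in X + _]mul1r -cosFT_lin//; last exact: regular_sum.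
by apply: eq_Rintegral => x _; rewrite big_cons mul1r.
Qed.

Lemma sinFT_sum (I : Type) (s : seq I) (F : I -> T -> R) nu :
  (forall i, regular (F i)) ->
  sinFT (fun x => \sum_(i <- s) F i x) nu = \sum_(i <- s) sinFT (F i) nu.
Proof.
move=> rF; elim: s => [|i s ih].
  rewrite big_nil /sinFT; under eq_Rintegral do rewrite big_nil mulr0.
  by rewrite Rintegral_cst// mul0r.
rewrite big_cons -ih -[X in X + _]mul1r -sinFT_lin//; last exact: regular_sum.
by apply: eq_Rintegral => x _; rewrite big_cons mul1r.
Qed.

End fourier_tools.

(** * From real components to complex vector fields *)

Section complex_components.
Context (R : realType) (n : nat).
Local Open Scope complex_scope.
Local Notation T := 'cV[R]_n.
Local Notation leb := (lebesgue_cV R n).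
Local Notation Re := complex.Re.
Local Notation Im := complex.Im.
Implicit Types (f g : T -> R) (u : T -> 'cV[R[i]]_n) (x nu : T).

Lemma ReD (z w : R[i]) : Re (z + w) = Re z + Re w.
Proof. by case: z; case: w. Qed.

Lemma ImD (z w : R[i]) : Im (z + w) = Im z + Im w.
Proof. by case: z; case: w. Qed.

Lemma ReB (z w : R[i]) : Re (z - w) = Re z - Re w.
Proof. by case: z; case: w. Qed.

Lemma ImB (z w : R[i]) : Im (z - w) = Im z - Im w.
Proof. by case: z; case: w. Qed.

Lemma Re_sum (I : Type) (s : seq I) (F : I -> R[i]) :
  Re (\sum_(i <- s) F i) = \sum_(i <- s) Re (F i).
Proof. by elim: s => [|i s ih]; rewrite ?big_nil ?big_cons// ReD ih. Qed.

Lemma Im_sum (I : Type) (s : seq I) (F : I -> R[i]) :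
  Im (\sum_(i <- s) F i) = \sum_(i <- s) Im (F i).
Proof. by elim: s => [|i s ih]; rewrite ?big_nil ?big_cons// ImD ih. Qed.

Lemma Re_realM (c : R) (z : R[i]) : Re (c%:C * z) = c * Re z.
Proof. by case: z => a b /=; rewrite mul0r subr0. Qed.

Lemma Im_realM (c : R) (z : R[i]) : Im (c%:C * z) = c * Im z.
Proof. by case: z => a b /=; rewrite mul0r addr0. Qed.

Lemma complex_ReIm (z w : R[i]) : Re z = Re w -> Im z = Im w -> z = w.
Proof. by case: z => a b; case: w => c d /= -> ->. Qed.

Lemma cplx_mxE p (A : 'M[R]_(p, n)) (v : 'cV[R[i]]_n) i :
  (cplx_mx A *m v) i ord0 = \sum_j (A i j)%:C * v j ord0.
Proof. by rewrite mxE; apply: eq_bigr => j _; rewrite mxE. Qed.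

Lemma fourierE u nu i f g :
  (forall x, Re (u x i ord0) = f x) -> (forall x, Im (u x i ord0) = g x) ->
  regular f -> regular g ->
  fourier u nu i ord0 = (cosFT f nu + sinFT g nu) +i* (cosFT g nu - sinFT f nu).
Proof.
move=> uf ug /regular_integrable fi /regular_integrable gi.
rewrite /fourier /integral_Cmx mxE; congr (_ +i* _).
- rewrite -RintegralD//; [|exact: integrable_cosM|exact: integrable_sinM].
  apply: eq_Rintegral => x _; rewrite mxE -uf -ug /expi cosN sinN.
  by case: (u x i ord0) => a b /=; ring.
- rewrite -RintegralB//; [|exact: integrable_cosM|exact: integrable_sinM].
  apply: eq_Rintegral => x _; rewrite mxE -uf -ug /expi cosN sinN.
  by case: (u x i ord0) => a b /=; ring.
Qed.

Lemma Rintegral_odd f : leb.-integrable setT (EFin \o f) ->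
  (forall x, f (- x) = - f x) -> \int[leb]_x f x = 0.
Proof.
move=> fi fN; have N0 : - 1 != 0 :> R by rewrite oppr_eq0 oner_eq0.
have := Rintegral_cV_affine (0 : T) N0 fi.
rewrite normrN1 expr1n invr1 mul1r.
under eq_Rintegral do rewrite scaleN1r addr0 fN -mulN1r.
rewrite RintegralZl// mulN1r.
have h0 (a : R) : - a = a -> a = 0 by move=> h; lra.
by move/h0.
Qed.

Lemma cosFTN f nu : cosFT f (- nu) = cosFT f nu.
Proof. by apply: eq_Rintegral => x _; rewrite dotNl cosN. Qed.

Lemma sinFTN f nu : leb.-integrable setT (EFin \o f) -> sinFT f (- nu) = - sinFT f nu.
Proof.
move=> fi; rewrite /sinFT -mulN1r -RintegralZl//; last exact: integrable_sinM.
by apply: eq_Rintegral => x _; rewrite dotNl sinN mulN1r mulNr.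
Qed.

(** Up to sign, the integrand is the imaginary part of exp(i nu . x) times the transform of the real
    function [f]. It is odd in [nu], as [cosFT f] is even and [sinFT f] odd. *)
Let mixed_odd f x : regular f ->
  leb.-integrable setT (EFin \o cosFT f) -> leb.-integrable setT (EFin \o sinFT f) ->
  leb.-integrable setT (EFin \o (fun nu => cos (dot nu x) * sinFT f nu)) /\
  leb.-integrable setT (EFin \o (fun nu => sin (dot nu x) * cosFT f nu)) /\
  \int[leb]_nu (cos (dot nu x) * sinFT f nu - sin (dot nu x) * cosFT f nu) = 0.
Proof.
move=> rf ic isn; have fi := regular_integrable rf.
have i1 : leb.-integrable setT (EFin \o (fun nu => cos (dot nu x) * sinFT f nu)).
  by under eq_fun do rewrite /= dotC; exact: integrable_cosM.
have i2 : leb.-integrable setT (EFin \o (fun nu => sin (dot nu x) * cosFT f nu)).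
  by under eq_fun do rewrite /= dotC; exact: integrable_sinM.
split=> //; split=> //; apply: Rintegral_odd; first exact: integrable_sub.
move=> nu; rewrite cosFTN sinFTN// dotNl cosN sinN; ring.
Qed.

Lemma fourier_inversion_cV u x :
  (forall i, let f y := Re (u y i ord0) in let g y := Im (u y i ord0) in
    [/\ regular f, regular g,
      leb.-integrable setT (EFin \o cosFT f) /\ leb.-integrable setT (EFin \o sinFT f) &
      leb.-integrable setT (EFin \o cosFT g) /\ leb.-integrable setT (EFin \o sinFT g)]) ->
  u x = ((2 * pi) ^- n)%:C *:
    integral_Cmx setT (fun nu : T => expi (dot nu x) *: fourier u nu).
Proof.
move=> hu; apply/colP => i.
have [rf rg [cf sf] [cg sg]] := hu i.
set f := fun y => Re (u y i ord0) in rf cf sf.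
set g := fun y => Im (u y i ord0) in rg cg sg.
have FE nu := @fourierE u nu i f g (fun=> erefl) (fun=> erefl) rf rg.
have pi0 : (2 * pi) ^+ n != 0 :> R by rewrite expf_neq0// mulf_neq0// gt_eqF// pi_gt0.
have [mf cof [Kf _ fK]] := rf; have [mg cog [Kg _ gK]] := rg.
have [if1 [if2 f0]] := mixed_odd x rf cf sf.
have [ig1 [ig2 g0]] := mixed_odd x rg cg sg.
have inv h (K : R) (mh : measurable_fun setT h) (ch : seq_continuous h)
    (hK : forall y, `|h y| <= K * weight y)
    (ich : leb.-integrable setT (EFin \o cosFT h))
    (ish : leb.-integrable setT (EFin \o sinFT h)) :
  leb.-integrable setT (EFin \o (fun nu => cos (dot nu x) * cosFT h nu +
    sin (dot nu x) * sinFT h nu)) /\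
  (2 * pi) ^- n * (\int[leb]_nu (cos (dot nu x) * cosFT h nu +
    sin (dot nu x) * sinFT h nu)) = h x.
  split; last by rewrite (fourier_inversion x mh ch hK ich ish) mulKf.
  by apply: integrable_add; under eq_fun do rewrite /= dotC;
    [exact: integrable_cosM|exact: integrable_sinM].
have [iF EF] := inv _ _ mf cof fK cf sf.
have [iG EG] := inv _ _ mg cog gK cg sg.
rewrite mxE mxE; apply: complex_ReIm; rewrite ?Re_realM ?Im_realM/=.
- rewrite -[LHS]EF; congr (_ * _).
  (* The real part of the integrand also contains the mixed term of the imaginary component [g],
     whose integral is 0. *)
  rewrite -[LHS]addr0 -[X in _ + X]g0 -RintegralD//; last exact: integrable_sub.
  by apply: eq_Rintegral => nu _; rewrite mxE FE /expi/=; ring.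
- rewrite -[LHS]EG; congr (_ * _).
  rewrite -[LHS]subr0 -[X in _ - X]f0 -RintegralB//; last exact: integrable_sub.
  by apply: eq_Rintegral => nu _; rewrite mxE FE /expi/=; ring.
Qed.

End complex_components.

(** * Assembling the operator and its multiplier *)

Section peridynamic_operator.
Context (R : realType) (n : nat) (delta beta mu lambda : R).
Hypotheses (n_gt0 : (0 < n)%N) (delta_gt0 : 0 < delta) (beta_lt : beta < n%:R + 2).
Local Open Scope complex_scope.
Local Notation T := 'cV[R]_n.
Local Notation leb := (lebesgue_cV R n).
Local Notation Re := complex.Re.
Local Notation Im := complex.Im.
Local Notation c := (scaling_const n delta beta).
Local Notation KS i := (ball_kernel delta (@state_kernel R n beta i)).
Local Notation KB i j := (ball_kernel delta (@bond_kernel R n beta i j)).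
Local Notation M := (multiplier delta beta mu lambda).
Implicit Types (x y z nu : T) (v : 'I_n -> T -> R) (u : T -> 'cV[R[i]]_n).

Let c1 : R := (n%:R + 2) * mu * c.
Let c2 : R := (lambda - mu) * (c ^+ 2 / 4).

(** Up to normalization, the nonlocal divergence of the field; the state-based term is the matching
    nonlocal gradient of it. *)
Definition dilatation v y : R := \sum_j odd_op (KS j) (v j) y.

(** The operator on a real field. It is real-linear, so it is applied separately to the real and the
    imaginary parts. *)
Definition peridynamic_re v i x : R :=
  c1 * (\sum_j even_op (KB i j) (v j) x) + c2 * odd_op (KS i) (dilatation v) x.

Let mKS i : measurable_fun setT (KS i).
Proof. by apply: measurable_ball_kernel; exact: measurable_state_kernel. Qed.
Let mKB i j : measurable_fun setT (KB i j).
Proof. by apply: measurable_ball_kernel; exact: measurable_bond_kernel. Qed.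
Let sKS i (w : T) : KS i w != 0 -> enorm w <= delta.
Proof. exact: ball_kernel_supp. Qed.
Let sKB i j (w : T) : KB i j w != 0 -> enorm w <= delta.
Proof. exact: ball_kernel_supp. Qed.
Let iKS i := integrable_state_kernel n_gt0 delta_gt0 beta_lt i.
Let iKB i j := integrable_bond_kernel n_gt0 delta_gt0 beta_lt i j.

Lemma multiplierE nu i j :
  M nu i j = c1 * cos_moment (KB i j) nu
             - c2 * (sin_moment (KS i) nu * sin_moment (KS j) nu).
Proof.
have sE k : sine_moment delta beta nu k ord0 = sin_moment (KS k) nu.
  rewrite mxE Rintegral_mkcond; apply: eq_Rintegral => w _.
  rewrite patchE /ball_kernel indicE; case: ifPn => _; last by rewrite !mul0r.
  by rewrite !mxE mul1r mulrC.
have trE : (sine_moment delta beta nu)^T ord0 j = sin_moment (KS j) nu.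
  by rewrite [LHS]mxE sE.
have bE : \int[leb]_(w in eball 0 delta)
    ((cos (dot nu w) - 1) *: ((enorm w `^ (beta + 2))^-1 *: outer w w)) i j =
    cos_moment (KB i j) nu.
  rewrite Rintegral_mkcond; apply: eq_Rintegral => w _.
  rewrite patchE /ball_kernel indicE; case: ifPn => _; last by rewrite !mul0r.
  by rewrite !mxE big_ord1 !mxE mul1r mulrC.
rewrite /multiplier [LHS]mxE; congr (_ + _); rewrite [LHS]mxE [X in _ * X]mxE ?bE//.
by rewrite big_ord1 trE sE mulNr.
Qed.

Section tame_field.
Variable v : 'I_n -> T -> R.
Hypothesis tv : forall j, tame2 delta (v j).

Lemma dilatation_tame : tame1 delta (dilatation v).
Proof. by apply: tame1_sum => j; exact: (odd_op_tame (mKS j) (@sKS j) (iKS j) (tv j)). Qed.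

Let regular_bond i : regular (fun x => \sum_j even_op (KB i j) (v j) x).
Proof. by apply: regular_sum => j; exact: (even_op_regular (mKB i j) (@sKB i j) (iKB i j) (tv j)). Qed.

Let regular_state i : regular (odd_op (KS i) (dilatation v)).
Proof. exact: (odd_op_regular (mKS i) (@sKS i) (iKS i) dilatation_tame). Qed.

Let regular_scale (a : R) f : regular f -> regular (fun x : T => a * f x).
Proof.
move=> rf; have := regular_lin a rf (tame1_regular (@tame1_0 R n 0)).
by under eq_fun do rewrite addr0.
Qed.

Lemma regular_peridynamic_re i : regular (peridynamic_re v i).
Proof. by apply: regular_lin => //; exact: regular_scale. Qed.

Lemma cosFT_dilatation nu :
  cosFT (dilatation v) nu = \sum_j sin_moment (KS j) nu * sinFT (v j) nu.
Proof.
rewrite cosFT_sum => [|j]; last exact: (tame1_regular (odd_op_tame (mKS j) (@sKS j) (iKS j) (tv j))).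
by apply: eq_bigr => j _; rewrite (cosFT_odd_op (mKS j) (@sKS j) (iKS j) _ (tv j).1).
Qed.

Lemma sinFT_dilatation nu :
  sinFT (dilatation v) nu = - \sum_j sin_moment (KS j) nu * cosFT (v j) nu.
Proof.
rewrite sinFT_sum => [|j]; last exact: (tame1_regular (odd_op_tame (mKS j) (@sKS j) (iKS j) (tv j))).
rewrite -sumrN.
by apply: eq_bigr => j _; rewrite (sinFT_odd_op (mKS j) (@sKS j) (iKS j) _ (tv j).1).
Qed.

Let cosFT_scale (a : R) f nu : regular f -> cosFT (fun x => a * f x) nu = a * cosFT f nu.
Proof.
move=> /regular_integrable fi; rewrite -RintegralZl//; last exact: integrable_cosM.
by apply: eq_Rintegral => x _; rewrite mulrCA.
Qed.

Let sinFT_scale (a : R) f nu : regular f -> sinFT (fun x => a * f x) nu = a * sinFT f nu.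
Proof.
move=> /regular_integrable fi; rewrite -RintegralZl//; last exact: integrable_sinM.
by apply: eq_Rintegral => x _; rewrite mulrCA.
Qed.

(** The state term composes two odd operators, each acting as [i] times a sine moment; the minus
    sign in the multiplier is the square of [i]. *)
Lemma cosFT_peridynamic_re i nu :
  cosFT (peridynamic_re v i) nu = \sum_j M nu i j * cosFT (v j) nu.
Proof.
rewrite cosFT_lin//; last exact: regular_scale.
rewrite cosFT_scale// (cosFT_odd_op (mKS i) (@sKS i) (iKS i) _ dilatation_tame).
rewrite sinFT_dilatation cosFT_sum => [|j]; last first.
  exact: (even_op_regular (mKB i j) (@sKB i j) (iKB i j) (tv j)).
rewrite mulrN mulrN !mulr_sumr -sumrB; apply: eq_bigr => j _.
rewrite (cosFT_even_op (mKB i j) (@sKB i j) (iKB i j) _ (tv j)) multiplierE.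
by rewrite mulrBl -!mulrA.
Qed.

Lemma sinFT_peridynamic_re i nu :
  sinFT (peridynamic_re v i) nu = \sum_j M nu i j * sinFT (v j) nu.
Proof.
rewrite sinFT_lin//; last exact: regular_scale.
rewrite sinFT_scale// (sinFT_odd_op (mKS i) (@sKS i) (iKS i) _ dilatation_tame).
rewrite cosFT_dilatation sinFT_sum => [|j]; last first.
  exact: (even_op_regular (mKB i j) (@sKB i j) (iKB i j) (tv j)).
rewrite mulrN !mulr_sumr -sumrB; apply: eq_bigr => j _.
rewrite (sinFT_even_op (mKB i j) (@sKB i j) (iKB i j) _ (tv j)) multiplierE.
by rewrite mulrBl -!mulrA.
Qed.

Lemma pv_bond i x :
  pv_is delta x (fun y => \sum_j bond_kernel beta i j (y - x) * (v j y - v j x))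
    (\sum_j even_op (KB i j) (v j) x).
Proof. by apply: pv_is_sum => // j; exact: pv_bond_kernel. Qed.

Lemma pv_state_inner i x y :
  pv_is delta y (fun z => state_kernel beta i (y - x) *
      \sum_j state_kernel beta j (z - y) * v j z)
    (state_kernel beta i (y - x) * dilatation v y).
Proof.
apply: pv_is_scale => //; apply: pv_is_sum => // j.
by apply: pv_state_kernel => //; exact: (tv j).1.
Qed.

Lemma pv_state_outer i x :
  pv_is delta x (fun y => state_kernel beta i (y - x) * dilatation v y)
    (odd_op (KS i) (dilatation v) x).
Proof. by apply: pv_state_kernel => //; exact: dilatation_tame. Qed.

End tame_field.

(** The cosine moments are of order [weight nu ^- 2], and so is a product of two sine moments, each
    of order [(weight nu)^-1]. *)
Lemma multiplier_le : exists2 C : R, 0 <= C &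
  forall i j nu, `|M nu i j| <= C * weight nu ^- 2.
Proof.
have [S S0 hS] : exists2 C : R, 0 <= C &
    forall i nu, `|sin_moment (KS i) nu| <= C * (weight nu)^-1.
  apply: (@bounded_family _ _ (fun i C => forall nu, `|sin_moment (KS i) nu| <= C * (weight nu)^-1)).
    move=> i K K' KK' h nu; rewrite (le_trans (h nu))// ler_wpM2r//.
    by rewrite invr_ge0 ltW// weight_gt0.
  by move=> i; exact: (sin_moment_le (mKS i) (iKS i)).
have [B B0 hB] : exists2 C : R, 0 <= C &
    forall p : 'I_n * 'I_n, forall nu, `|cos_moment (KB p.1 p.2) nu| <= C * weight nu ^- 2.
  apply: (@bounded_family _ _ (fun p C => forall nu, `|cos_moment (KB p.1 p.2) nu| <= C * weight nu ^- 2)).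
    move=> i K K' KK' h nu; rewrite (le_trans (h nu))// ler_wpM2r//.
    by rewrite invr_ge0 exprn_ge0// ltW// weight_gt0.
  by move=> [i j]; exact: (cos_moment_le (mKB i j) (iKB i j)).
exists (`|c1| * B + `|c2| * (S * S)); first by rewrite addr_ge0 ?mulr_ge0.
move=> i j nu; rewrite multiplierE (le_trans (ler_normB _ _))// mulrDl (normrM c1) (normrM c2) lerD//.
  by rewrite -mulrA ler_wpM2l// (hB (i, j)).
rewrite -mulrA ler_wpM2l//.
rewrite (_ : S * S * weight nu ^- 2 = S / weight nu * (S / weight nu)); last first.
  by rewrite -exprVn expr2; ring.
by rewrite normrM ler_pM.
Qed.

(** Tameness makes the transforms exist but does not make them integrable; here the decay of
    Schwartz transforms is used against the growth of the multiplier. *)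
Lemma integrable_FT_peridynamic_re v i : (forall j, schwartz (v j)) ->
  leb.-integrable setT (EFin \o cosFT (peridynamic_re v i)) /\
  leb.-integrable setT (EFin \o sinFT (peridynamic_re v i)).
Proof.
move=> sv; have tv j : tame2 delta (v j) by exact: schwartz_tame.
have ri := regular_integrable (regular_peridynamic_re tv i).
have [C C0 hC] := multiplier_le.
have [D D0 hD] : exists2 D : R, 0 <= D & forall j nu,
    `|cosFT (v j) nu| <= D * weight nu ^+ 3 /\ `|sinFT (v j) nu| <= D * weight nu ^+ 3.
  apply: (@bounded_family _ _ (fun j D => forall nu,
    `|cosFT (v j) nu| <= D * weight nu ^+ 3 /\ `|sinFT (v j) nu| <= D * weight nu ^+ 3)).
    move=> j K K' KK' h nu; have [h1 h2] := h nu.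
    have KK3 : K * weight nu ^+ 3 <= K' * weight nu ^+ 3.
      by rewrite ler_wpM2r// exprn_ge0// ltW// weight_gt0.
    by split; apply: le_trans KK3.
  by move=> j; exact: schwartz_FT_decay.
have key (g : T -> R) (F : 'I_n -> T -> R) : measurable_fun setT g ->
    (forall nu, g nu = \sum_j M nu i j * F j nu) ->
    (forall j nu, `|F j nu| <= D * weight nu ^+ 3) ->
    leb.-integrable setT (EFin \o g).
  move=> mg gE FD.
  apply: (integrable_dom (g := fun nu => (C * D *+ n) * weight nu)) => //.
    exact/integrable_scale/integrable_weight.
  move=> nu; rewrite gE (le_trans (ler_norm_sum _ _ _))//.
  rewrite mulrnAl -[X in _ *+ X]card_ord -sumr_const; apply: ler_sum => j _.
  rewrite normrM (le_trans (ler_pM _ _ (hC i j nu) (FD j nu)))//.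
  have w0 : weight nu != 0 by rewrite gt_eqF// weight_gt0.
  by rewrite le_eqVlt; apply/orP; left; apply/eqP; field.
split.
- apply: (key _ (fun j => cosFT (v j))); first exact: measurable_cosFT.
  + by move=> nu; exact: cosFT_peridynamic_re.
  + by move=> j nu; case: (hD j nu).
- apply: (key _ (fun j => sinFT (v j))); first exact: measurable_sinFT.
  + by move=> nu; exact: sinFT_peridynamic_re.
  + by move=> j nu; case: (hD j nu).
Qed.

Section schwartz_field.
Variable u : T -> 'cV[R[i]]_n.
Hypothesis su : schwartz_field u.
Let a j x := Re (u x j ord0).
Let b j x := Im (u x j ord0).
Let sa j : schwartz (a j). Proof. exact: (su j).1. Qed.
Let sb j : schwartz (b j). Proof. exact: (su j).2. Qed.
Let ta j : tame2 delta (a j). Proof. exact: schwartz_tame. Qed.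
Let tb j : tame2 delta (b j). Proof. exact: schwartz_tame. Qed.

Let bond_coef i j x y :
  ((enorm (y - x) `^ (beta + 2))^-1 *: outer (y - x) (y - x)) i j =
  bond_kernel beta i j (y - x).
Proof. by rewrite /bond_kernel !mxE big_ord1 !mxE. Qed.

Let state_coef i j x y z :
  outer ((enorm (y - x) `^ beta)^-1 *: (y - x)) ((enorm (z - y) `^ beta)^-1 *: (z - y)) i j =
  state_kernel beta i (y - x) * state_kernel beta j (z - y).
Proof. by rewrite /state_kernel !mxE big_ord1 !mxE. Qed.

Let bond_integrand_Re x i : (fun y => Re (bond_integrand beta u x y i ord0)) =
  (fun y => \sum_j bond_kernel beta i j (y - x) * (a j y - a j x)).
Proof.
apply/funext => y; rewrite cplx_mxE Re_sum; apply: eq_bigr => j _.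
by rewrite Re_realM bond_coef !mxE ReB.
Qed.

Let bond_integrand_Im x i : (fun y => Im (bond_integrand beta u x y i ord0)) =
  (fun y => \sum_j bond_kernel beta i j (y - x) * (b j y - b j x)).
Proof.
apply/funext => y; rewrite cplx_mxE Im_sum; apply: eq_bigr => j _.
by rewrite Im_realM bond_coef !mxE ImB.
Qed.

Let state_integrand_Re x y i : (fun z => Re (state_integrand beta u x y z i ord0)) =
  (fun z => state_kernel beta i (y - x) * \sum_j state_kernel beta j (z - y) * a j z).
Proof.
apply/funext => z; rewrite cplx_mxE Re_sum mulr_sumr; apply: eq_bigr => j _.
by rewrite Re_realM state_coef mulrA.
Qed.

Let state_integrand_Im x y i : (fun z => Im (state_integrand beta u x y z i ord0)) =
  (fun z => state_kernel beta i (y - x) * \sum_j state_kernel beta j (z - y) * b j z).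
Proof.
apply/funext => z; rewrite cplx_mxE Im_sum mulr_sumr; apply: eq_bigr => j _.
by rewrite Im_realM state_coef mulrA.
Qed.

(** An equality of functions of [y], as the outer principal value requires; the inner value is
    therefore computed at every [y], inside the ball or not. *)
Let inner_Re x i :
  (fun y => Re (pv_Cmx y delta (state_integrand beta u x y) i ord0)) =
  (fun y => state_kernel beta i (y - x) * dilatation a y).
Proof.
apply/funext => y; rewrite mxE/= state_integrand_Re.
exact: (pv_isE (pv_state_inner ta i x y)).
Qed.

Let inner_Im x i :
  (fun y => Im (pv_Cmx y delta (state_integrand beta u x y) i ord0)) =
  (fun y => state_kernel beta i (y - x) * dilatation b y).
Proof.
apply/funext => y; rewrite mxE/= state_integrand_Im.
exact: (pv_isE (pv_state_inner tb i x y)).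
Qed.

Lemma schwartz_peridynamic_exists x : peridynamic_exists delta beta u x.
Proof.
split.
- move=> i j; rewrite (ord1 j) bond_integrand_Re bond_integrand_Im; split.
    exact: (pv_is_exists (pv_bond ta i x)).
  exact: (pv_is_exists (pv_bond tb i x)).
- move=> y _ i j; rewrite (ord1 j) state_integrand_Re state_integrand_Im; split.
    exact: (pv_is_exists (pv_state_inner ta i x y)).
  exact: (pv_is_exists (pv_state_inner tb i x y)).
- move=> i j; rewrite (ord1 j) inner_Re inner_Im; split.
    exact: (pv_is_exists (pv_state_outer ta i x)).
  exact: (pv_is_exists (pv_state_outer tb i x)).
Qed.

Lemma peridynamic_Re x i :
  Re (peridynamic delta beta mu lambda u x i ord0) = peridynamic_re a i x.
Proof.
rewrite /peridynamic mxE ReD [in X in X + _]mxE [in X in _ + X]mxE !Re_realM.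
rewrite mxE/= bond_integrand_Re (pv_isE (pv_bond ta i x)).
by rewrite mxE/= inner_Re (pv_isE (pv_state_outer ta i x)).
Qed.

Lemma peridynamic_Im x i :
  Im (peridynamic delta beta mu lambda u x i ord0) = peridynamic_re b i x.
Proof.
rewrite /peridynamic mxE ImD [in X in X + _]mxE [in X in _ + X]mxE !Im_realM.
rewrite mxE/= bond_integrand_Im (pv_isE (pv_bond tb i x)).
by rewrite mxE/= inner_Im (pv_isE (pv_state_outer tb i x)).
Qed.

(** The matrix [M nu] is real, so it acts on the real and imaginary parts of the transform
    separately, and the two real multiplier formulas suffice. *)
Lemma fourier_peridynamic nu :
  fourier (peridynamic delta beta mu lambda u) nu = cplx_mx (M nu) *m fourier u nu.
Proof.
apply/colP => i; rewrite cplx_mxE.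
rewrite (fourierE nu (fun x => peridynamic_Re x i) (fun x => peridynamic_Im x i));
  [|exact: regular_peridynamic_re..].
under eq_bigr => j _ do rewrite (@fourierE _ _ u nu j (a j) (b j) (fun=> erefl) (fun=> erefl)
  (tame1_regular (ta j).1) (tame1_regular (tb j).1)).
apply: complex_ReIm; rewrite ?Re_sum ?Im_sum/=.
- rewrite cosFT_peridynamic_re// sinFT_peridynamic_re// -big_split/=.
  by apply: eq_bigr => j _; rewrite mul0r subr0 mulrDr.
- rewrite cosFT_peridynamic_re// sinFT_peridynamic_re// -sumrB.
  by apply: eq_bigr => j _; rewrite mul0r addr0 mulrBr.
Qed.

Lemma peridynamic_inversion x :
  peridynamic delta beta mu lambda u x =
  ((2 * pi) ^- n)%:C *: integral_Cmx setT (fun nu : T =>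
    expi (dot nu x) *: fourier (peridynamic delta beta mu lambda u) nu).
Proof.
apply: fourier_inversion_cV => i /=.
rewrite (funext (fun y => peridynamic_Re y i)) (funext (fun y => peridynamic_Im y i)).
split; [exact: regular_peridynamic_re|exact: regular_peridynamic_re|..];
  exact: integrable_FT_peridynamic_re.
Qed.

End schwartz_field.
End peridynamic_operator.

Local Open Scope complex_scope.

Theorem proposition1 (R : realType) (n : nat) (delta beta mu lambda : R)
    (hn : (1 <= n)%N) (hdelta : 0 < delta) (hbeta : beta < n%:R + 2)
    (u : 'cV[R]_n -> 'cV[R[i]]_n) (hu : schwartz_field u) :
  [/\ (forall x : 'cV[R]_n, peridynamic_exists delta beta u x),
      (forall x : 'cV[R]_n,
         peridynamic delta beta mu lambda u x =
         ((2 * pi) ^- n)%:C *: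
           integral_Cmx setT (fun nu : 'cV[R]_n =>
             expi (dot nu x) *:
               (cplx_mx (multiplier delta beta mu lambda nu)
                *m fourier u nu))) &
      (forall nu : 'cV[R]_n,
         fourier (peridynamic delta beta mu lambda u) nu =
         cplx_mx (multiplier delta beta mu lambda nu) *m fourier u nu)].
Proof.
split=> [x|x|nu]; first exact: schwartz_peridynamic_exists.
- have -> : (fun nu => expi (dot nu x) *:
      (cplx_mx (multiplier delta beta mu lambda nu) *m fourier u nu)) =
    (fun nu => expi (dot nu x) *: fourier (peridynamic delta beta mu lambda u) nu).
    by apply/funext => nu; congr (_ *: _); apply/esym; exact: fourier_peridynamic.
  exact: peridynamic_inversion.
- exact: fourier_peridynamic.
Qed.
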